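(* Let $D\subset\mathbb R^2$ be a smooth bounded domain, $\alpha\in(0,1)$ and $\lambda>0$. Let $\delta=\delta(\varepsilon)>1$ be such that $\delta\to1$ and $\tilde\varepsilon:=\varepsilon/\sqrt{\delta-1}\to0$ as $\varepsilon\to0$. Assume that $\Omega=\lambda/\tilde\varepsilon^2$ and that $\varepsilon\ll\tilde\varepsilon^2$ as $\varepsilon\to0$. Then for all $\eta>0$ there exist $\beta>0$ and $R_0>0$ such that for $R>R_0$ and for all $\varepsilon$ sufficiently small, if $(u_1,u_2)$ is a minimizer of $E^\Omega_{\varepsilon,\delta}$ in $\mathcal H$, then $$\left|\left\{x\in D:\ \frac{1}{|D(x,R\tilde\varepsilon)|}\int_{D(x,R\tilde\varepsilon)}|u_1|^2<\beta\ \text{ or }\ \frac{1}{|D(x,R\tilde\varepsilon)|}\int_{D(x,R\tilde\varepsilon)}|u_2|^2<\beta\right\}\right|<\eta,$$ where $D(x,R\tilde\varepsilon)$ is the disk of center $x$ and radius $R\tilde\varepsilon$ (intersected with $D$).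
   Context: Notation: $x^\perp=(-x_2,x_1)$; $a\ll b$ means $a/b\to0$ as $\varepsilon\to0$; $|\cdot|$ of a set is Lebesgue measure. $$E^\Omega_{\varepsilon,\delta}(u_1,u_2)=\sum_{k=1}^2\int_D\frac12|\nabla u_k-i\Omega x^\perp u_k|^2+\int_D\frac1{4\varepsilon^2}(1-|u_1|^2-|u_2|^2)^2+\frac{\delta-1}{2\varepsilon^2}|u_1|^2|u_2|^2\,dx,$$ $$\mathcal H=\Big\{(u_1,u_2):u_k\in H^1(D,\mathbb C),\ \frac1{|D|}\int_D|u_1|^2=\alpha,\ \frac1{|D|}\int_D|u_2|^2=1-\alpha\Big\}.$$ *)

(* Defs.v *)
From HB Require Import structures.
From mathcomp Require Import all_boot all_order all_algebra.
From mathcomp Require Import complex.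
From mathcomp Require Import all_classical all_reals all_analysis.

Set Implicit Arguments.
Unset Strict Implicit.
Unset Printing Implicit Defensive.

Import Order.TTheory GRing.Theory Num.Theory.
Import numFieldNormedType.Exports.
Import ComplexField.

Local Open Scope classical_set_scope.
Local Open Scope ring_scope.
Local Open Scope complex_scope.

Section Plane.
Context {R : realType}.
Implicit Types (D : set (R * R)) (f g : R * R -> R) (u : R * R -> R[i]).

Definition area :
    {measure set (measurableTypeR R * measurableTypeR R) -> \bar R} :=
  (@lebesgue_measure R \x @lebesgue_measure R)%E.

(* The norm of the library on R * R is the sup norm, hence this definition. *)
Definition disk (x : R * R) (r : R) : set (R * R) :=
  [set y | (y.1 - x.1) ^+ 2 + (y.2 - x.2) ^+ 2 < r ^+ 2].

Definition e1 : R * R := (1, 0).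
Definition e2 : R * R := (0, 1).

Definition perp (x : R * R) : R * R := (- x.2, x.1).

(* In finite dimension, class C^n in the usual sense: all iterated directional
   derivatives up to order n exist everywhere and are continuous. *)
Fixpoint class_C (V : normedModType R) (n : nat) (f : V -> R) : Prop :=
  continuous f /\
  if n is m.+1 then
    forall v : V, (forall x, derivable f x v) /\ class_C m (fun x => 'D_v f x)
  else True.

Definition smooth (V : normedModType R) (f : V -> R) : Prop :=
  forall n, class_C n f.

(* Near each boundary point, up to a rotation by the angle of (c, s), D is the
   strict epigraph of a smooth function of one variable. *)
Definition smooth_boundary D : Prop :=
  forall p, (closure D `\` interior D) p ->
  exists c s r : R, exists gamma : R -> R,
    [/\ c ^+ 2 + s ^+ 2 = 1, 0 < r, smooth gamma &
      forall x, disk p r x ->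
        (D x <-> gamma (c * x.1 + s * x.2) < - s * x.1 + c * x.2)].

Definition smooth_bounded_domain D : Prop :=
  [/\ D !=set0, open D, connected D, bounded_set D & smooth_boundary D].

Definition test_function D f : Prop :=
  smooth f /\
  exists K, [/\ compact K, K `<=` D & forall x, ~ K x -> f x = 0].

Definition L2 D f : Prop := f \_ D \in Lfun area 2%:E.

(* g is a square-integrable weak derivative of f in the direction v. *)
Definition is_weak_deriv D (v : R * R) f g : Prop :=
  L2 D g /\
  forall phi, test_function D phi ->
    \int[area]_(x in D) (f x * 'D_v phi x) =
    - \int[area]_(x in D) (g x * phi x).

(* Some weak derivative (unique almost everywhere on D if it exists), and 0 if
   there is none. *)
Definition weak_deriv D (v : R * R) f : R * R -> R :=
  xget (cst 0) [set g | is_weak_deriv D v f g].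

Definition cweak_deriv D (v : R * R) u (x : R * R) : R[i] :=
  weak_deriv D v (fun y => complex.Re (u y)) x +i*
  weak_deriv D v (fun y => complex.Im (u y)) x.

Definition sobolev_H1 D f : Prop :=
  [/\ L2 D f, exists g, is_weak_deriv D e1 f g &
      exists g, is_weak_deriv D e2 f g].

Definition csobolev_H1 D u : Prop :=
  sobolev_H1 D (fun x => complex.Re (u x)) /\
  sobolev_H1 D (fun x => complex.Im (u x)).

Definition average (A : set (R * R)) f : R :=
  (\int[area]_(x in A) f x) / fine (area A).

Definition sqmod u (x : R * R) : R := Normc.normc (u x) ^+ 2.

(* Pointwise squared norm, in C^2, of grad u - i Omega x^perp u. *)
Definition sqmod_cov_grad D (Omega : R) u (x : R * R) : R :=
  sqmod (fun y => cweak_deriv D e1 u y - 'i%C * (Omega * (perp y).1)%:C * u y) x +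
  sqmod (fun y => cweak_deriv D e2 u y - 'i%C * (Omega * (perp y).2)%:C * u y) x.

(* For delta >= 1 all integrands are nonnegative, so that the energy is always
   well defined in [0, +oo]. *)
Definition energy D (eps delta Omega : R) (u1 u2 : R * R -> R[i]) : \bar R :=
  (\int[area]_(x in D) (2^-1 * sqmod_cov_grad D Omega u1 x)%:E +
   \int[area]_(x in D) (2^-1 * sqmod_cov_grad D Omega u2 x)%:E +
   \int[area]_(x in D)
     ((4 * eps ^+ 2)^-1 * (1 - sqmod u1 x - sqmod u2 x) ^+ 2 +
      (delta - 1) / (2 * eps ^+ 2) * (sqmod u1 x * sqmod u2 x))%:E)%E.

Definition admissible D (alpha : R) (u1 u2 : R * R -> R[i]) : Prop :=
  [/\ csobolev_H1 D u1, csobolev_H1 D u2,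
      average D (sqmod u1) = alpha & average D (sqmod u2) = 1 - alpha].

Definition minimizer D (alpha eps delta Omega : R) (u1 u2 : R * R -> R[i]) :
    Prop :=
  admissible D alpha u1 u2 /\
  forall v1 v2, admissible D alpha v1 v2 ->
    (energy D eps delta Omega u1 u2 <= energy D eps delta Omega v1 v2)%E.

(* Points of D where u1 or u2 has low mean density at scale r. *)
Definition low_density_set D (r beta : R) (u1 u2 : R * R -> R[i]) :
    set (R * R) :=
  [set x | D x /\
     (average (disk x r `&` D) (sqmod u1) < beta \/
      average (disk x r `&` D) (sqmod u2) < beta)].

Definition eps_tilde (delta : R -> R) (eps : R) : R :=
  eps / Num.sqrt (delta eps - 1).

End Plane.

(* Main.v *)
(* A minimizer has energy at most C / t^2, where t is the rescaled length
   eps_tilde: compare with parallel stripes of width of order t, on which the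
   two components alternate with |u1|^2 + |u2|^2 = 1, the phase of each component
   jumping only where that component vanishes.  Hence, up to a set of small
   measure, x is at distance more than r t from the boundary of D and the
   covariant Dirichlet energy in the disk of radius r t around x is at most K r^2.
   Suppose that u2, say, has low density in such a disk, so that |u1| is close to
   1 there (the penalty (1 - |u1|^2 - |u2|^2)^2 being negligible).  Among finitely
   many dyadic scales s = sigma t / 2^k there is one at which the energy seen by
   difference quotients hardly drops from scale s to scale s / 2; by strict
   convexity the covariant increments of v = u1 / |u1| at that scale are then
   small in L^4.  But for unit vectors the product of these increments around a
   square of side s is the holonomy exp(-2 i Omega s^2) of the magnetic potential,
   and, averaged over the disk, the first order terms telescope to its boundary.
   This bounds sin (2 Omega s^2) by a quantity much smaller than the actual
   order lambda sigma^2 / 4^k, a contradiction. *)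

Require Import Defs.
From HB Require Import structures.
From mathcomp Require Import all_boot all_order all_algebra.
From mathcomp Require Import complex.
From mathcomp Require Import all_classical all_reals all_analysis.
From mathcomp Require Import measurable_realfun.
From mathcomp Require Import ring lra.

Set Implicit Arguments.
Unset Strict Implicit.
Unset Printing Implicit Defensive.

Import Order.TTheory GRing.Theory Num.Theory.
Import numFieldNormedType.Exports.

Local Open Scope classical_set_scope.
Local Open Scope ring_scope.

(** * Planar Lebesgue measure *)

Section PlaneMeasure.
Context {R : realType}.
Local Notation plane := (measurableTypeR R * measurableTypeR R)%type.
Implicit Types (A : set plane) (x y : R * R).

(** The obstacle is one of orders: the holonomy through a square of side s is of order s^2, which is
    also all that the Dirichlet energy gives for the integral of the squared increments. The cubic
    errors are beaten only if the increments are small in a stronger norm, hence the L^4 bound. The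
    linear terms are summed by parts and come with a factor s / a, where a is the half-side of the
    box; they lose against the holonomy as soon as a / t is large, which fixes R0. With Omega =
    lambda / t^2 the flux through a square of side sigma t does not depend on eps. The penalty has
    integral at most C eps^2 / t^2, which is negligible against the area r^2 t^2 of a disk exactly
    because eps / t^2 tends to 0. Since the magnetic field does not vanish, no single gauge removes
    the potential in both directions; each direction has its own. The constants are chosen in the
    order: weights of the AM-GM inequalities, number of scales, then beta, small compared with the
    smallest scale; R0 depends only on the weights and lambda. *)

Definition box (x : R * R) (a : R) : set plane := ball x.1 a `*` ball x.2 a.

Lemma boxP x a y : box x a y <-> `|y.1 - x.1| < a /\ `|y.2 - x.2| < a.
Proof.
by rewrite /box /setX /= -!ball_normE /ball_ /= (distrC x.1) (distrC x.2).
Qed.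

Lemma measurable_box x a : measurable (box x a).
Proof. by apply: measurableX; exact: measurable_ball. Qed.

Lemma area_box x a : 0 <= a -> area (box x a) = ((2 * a) ^+ 2)%:E.
Proof.
move=> a0; rewrite /area /= product_measure1E; last 2 first.
- exact: measurable_ball.
- exact: measurable_ball.
rewrite [X in (X * _)%E](_ : _ = (2 * a)%:E); last first.
  by rewrite mulr_natl; exact: lebesgue_measure_ball.
rewrite [X in (_ * X)%E](_ : _ = (2 * a)%:E) -?EFinM -?expr2//.
by rewrite mulr_natl; exact: lebesgue_measure_ball.
Qed.

(** The box is open around y, but its closure lies in A: closed boxes are needed later as compact
    supports of test functions. The index set is countable. *)
Lemma open_rat_box A y : open (A : set (R * R)) -> A y ->
  exists q : rat * rat * nat, [/\ `|y.1 - ratr q.1.1| < q.2.+1%:R^-1,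
    `|y.2 - ratr q.1.2| < q.2.+1%:R^-1 &
    forall z : R * R, `|z.1 - ratr q.1.1| <= q.2.+1%:R^-1 ->
      `|z.2 - ratr q.1.2| <= q.2.+1%:R^-1 -> A z].
Proof.
move=> oA Ay.
have /nbhs_ballP[e /= e0 yeA] : nbhs (y : R * R) A by exact: open_nbhs_nbhs.
have [n ne] : exists n : nat, n.+1%:R^-1 < e / 2.
  have e20 : 0 < e / 2 by rewrite divr_gt0.
  near \oo => n; exists n; near: n; exact: near_infty_natSinv_lt (PosNum e20).
have rat_near (z : R) : exists q : rat, `|z - ratr q| < n.+1%:R^-1.
  have : 0 < n.+1%:R^-1 :> R by rewrite invr_gt0.
  move: (n.+1%:R^-1 : R) => d d0.
  have n0 : z - d < z + d by lra.
  have [q] := rat_in_itvoo n0; rewrite in_itv/= => /andP[q1 q2]; exists q.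
  by rewrite ltr_distl; apply/andP; split; lra.
have [q1 q1n] := rat_near y.1; have [q2 q2n] := rat_near y.2.
exists (q1, q2, n); split=> // z /= z1 z2; apply: yeA.
suff [] : `|y.1 - z.1| < e /\ `|y.2 - z.2| < e by [].
split.
- rewrite (le_lt_trans (ler_distD (ratr q1) _ _))// (distrC (ratr q1)).
  by rewrite (splitr e) ltrD// ?(lt_trans q1n)// (le_lt_trans z1).
- rewrite (le_lt_trans (ler_distD (ratr q2) _ _))// (distrC (ratr q2)).
  by rewrite (splitr e) ltrD// ?(lt_trans q2n)// (le_lt_trans z2).
Unshelve. all: by end_near. Qed.

Lemma open_measurable2 A : open (A : set (R * R)) -> measurable A.
Proof.
move=> oA.
pose I := [set q : rat * rat * nat |
  box (ratr q.1.1, ratr q.1.2) q.2.+1%:R^-1 `<=` A].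
suff -> : A = \bigcup_(q in I) box (ratr q.1.1, ratr q.1.2) q.2.+1%:R^-1.
  rewrite bigcup_mkcond; apply: countable_bigcupT_measurable => // q.
  by case: ifPn => _ //; exact: measurable_box.
apply/seteqP; split=> [y Ay|y [q Iq] /Iq //].
have [q [q1 q2 qA]] := open_rat_box oA Ay; exists q; last exact/boxP.
by move=> z /boxP /= [/ltW z1 /ltW z2]; exact: qA.
Qed.

Lemma continuous_measurable2 (f : R * R -> R) :
  continuous f -> measurable_fun setT (f : plane -> R).
Proof.
move=> cf; apply: (measurability _ (RGenOpens.measurableE R)).
move=> _ [_ [a [b ->] <-]]; rewrite setTI; apply: open_measurable2.
by move/continuousP : cf; apply; exact: interval_open.
Qed.

Lemma measurable_shift (h : R * R) :
  measurable_fun setT (fun y : plane => (y + h : plane)).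
Proof.
apply: measurable_fun_pair => /=; exact: measurable_funD.
Qed.

Let shift1 (h : R) : measurable_fun setT (fun y : measurableTypeR R => (y + h : measurableTypeR R)).
Proof. exact: measurable_funD. Qed.

Let mshift1 (h : R) (A : set (measurableTypeR R)) :
  measurable A -> measurable ((fun y : R => y + h) @^-1` A : set (measurableTypeR R)).
Proof. by move=> mA; rewrite -(setTI (_ @^-1` _)); exact: shift1. Qed.

(** The translated measure agrees with Lebesgue measure on half-open intervals, and these determine
    it. The planar analogues below use uniqueness on rectangles in the same way. *)
Lemma lebesgue_measure_shift (h : R) (A : set (measurableTypeR R)) :
  measurable A -> lebesgue_measure ((fun y : R => y + h) @^-1` A) = lebesgue_measure A.
Proof.
move=> mA.
pose phi := fun y : measurableTypeR R => y + h : measurableTypeR R.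
pose mu : {measure set _ -> \bar R} := pushforward (@lebesgue_measure R) phi.
apply/esym; apply: (@lebesgue_measure_unique R (mu (shift1 h))) => //.
move=> _ [[a b] _ <-].
rewrite /mu /= /pushforward.
have -> : phi @^-1` `]a, b]%classic = `](a - h), (b - h)]%classic.
  by apply/seteqP; split=> y /=; rewrite !in_itv /= ltrBlDr lerBrDr.
rewrite !lebesgue_measure_itv/= !lte_fin ltrD2r.
by case: ifP => // _; rewrite -!EFinB opprD opprK addrACA addNr addr0.
Qed.

Lemma area_shift (h : R * R) A : measurable A -> area ((fun y => y + h) @^-1` A) = area A.
Proof.
move=> mA.
pose phi := fun y : plane => y + h : plane.
pose mu : {measure set _ -> \bar R} := pushforward (@area R) phi.
apply/esym; apply: (@product_measure_unique _ _ _ _ _ _ _ (mu (measurable_shift h))) => //.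
move=> B C mB mC.
rewrite /mu/= /pushforward.
have -> : phi @^-1` (B `*` C) =
  ((fun y : R => y + h.1) @^-1` B) `*` ((fun y : R => y + h.2) @^-1` C) by [].
have mB' := mshift1 h.1 mB; have mC' := mshift1 h.2 mC.
transitivity (lebesgue_measure ((fun y : R => y + h.1)%R @^-1` B) *
              lebesgue_measure ((fun y : R => y + h.2)%R @^-1` C))%E.
  exact: product_measure1E.
by rewrite !lebesgue_measure_shift.
Qed.

(** The exchange of coordinates serves to deduce statements in the direction [e2] from those in the
    direction [e1]. *)
Definition pswap (y : plane) : plane := (y.2, y.1).

Lemma measurable_pswap : measurable_fun setT pswap.
Proof. exact: measurable_fun_pair. Qed.

Lemma area_pswap A : measurable A -> area (pswap @^-1` A) = area A.
Proof.
move=> mA.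
pose mu : {measure set _ -> \bar R} := pushforward (@area R) pswap.
apply/esym; apply: (@product_measure_unique _ _ _ _ _ _ _ (mu measurable_pswap)) => //.
move=> B C mB mC.
rewrite /mu/= /pushforward.
have -> : pswap @^-1` (B `*` C) = C `*` B.
  by apply/seteqP; split=> -[y z] [].
transitivity (lebesgue_measure C * lebesgue_measure B)%E; last by rewrite muleC.
exact: product_measure1E.
Qed.

Section preserving.
Variable (phi : plane -> plane).
Hypothesis mphi : measurable_fun setT phi.
Hypothesis aphi : forall A, measurable A -> area (phi @^-1` A) = area A.

(** The push-forward of [area] under [phi] is [area] itself, so this is the change of variables for
    push-forward measures. *)
Lemma ge0_integral_preserving A (f : plane -> \bar R) :
  measurable A -> measurable_fun A f -> (forall x, A x -> 0 <= f x)%E ->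
  (\int[area]_(x in phi @^-1` A) f (phi x) = \int[area]_(x in A) f x)%E.
Proof.
move=> mA mf f0.
have := @ge0_integral_pushforward _ _ _ _ R phi mphi area A f mA mf.
move=> <-; last by move=> y /[!inE]; exact: f0.
pose m : {measure set plane -> \bar R} := pushforward (@area R) phi.
exact: (@eq_measure_integral _ _ R A area (m mphi) f (fun B mB _ => aphi mB)).
Qed.

Lemma integrable_preserving A (f : plane -> \bar R) :
  measurable A -> area.-integrable A f ->
  area.-integrable (phi @^-1` A) (f \o phi).
Proof.
move=> mA /integrableP[mf foo]; apply/integrableP; split.
  by apply: (measurable_comp mA) => //; [exact: image_preimage_subset|exact: measurable_funTS].
rewrite (ge0_integral_preserving (f := fun x => `|f x|%E))//.
exact: measurableT_comp.
Qed.

Lemma integral_preserving A (f : plane -> \bar R) :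
  measurable A -> measurable_fun A f ->
  (\int[area]_(x in phi @^-1` A) f (phi x) = \int[area]_(x in A) f x)%E.
Proof.
move=> mA mf; rewrite integralE [RHS]integralE; congr (_ - _)%E.
- rewrite -(ge0_integral_preserving mA (measurable_funepos mf))//.
  by apply: eq_integral => x _; rewrite -[fun x0 => f (phi x0)]/(f \o phi) funepos_comp.
- rewrite -(ge0_integral_preserving mA (measurable_funeneg mf))//.
  by apply: eq_integral => x _; rewrite -[fun x0 => f (phi x0)]/(f \o phi) funeneg_comp.
Qed.

End preserving.

End PlaneMeasure.

(** * Smooth functions *)

Section Smooth.
Context {R : realType}.
Implicit Types V : normedModType R.

(** Reduces a directional derivative to a derivative at 0 in one real variable, where the chain rule
    of one variable applies. *)
Lemma is_derive_line V (f : V -> R) (x v : V) (df : R) :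
  is_derive x v f df <-> is_derive (0 : R) 1 (fun t : R => f (t *: v + x)) df.
Proof.
have E : 'D_1 (fun t : R => f (t *: v + x)) 0 = 'D_v f x.
  rewrite /derive; set g1 := fun h => h^-1 *: _; set g2 := fun h => h^-1 *: _.
  suff -> : g1 = g2 by [].
  apply/funext => h; rewrite /g1 /g2 /=.
  by rewrite addr0 scale0r add0r [_%:A]mulr1.
split=> -[d1 d2]; split.
- exact: (derivable1P f x v).1 d1.
- by rewrite E.
- exact: (derivable1P f x v).2 d1.
- by rewrite -E.
Qed.

Lemma is_derive_comp V (h : R -> R) (f : V -> R) (x v : V) (a b : R) :
  is_derive (f x) 1 h a -> is_derive x v f b -> is_derive x v (h \o f) (a * b).
Proof.
move=> dh /is_derive_line df; apply/is_derive_line.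
apply: (@is_derive1_comp _ h (fun t : R => f (t *: v + x))) => //=.
by rewrite scale0r add0r.
Qed.

Lemma is_derive_dir (h : R -> R) (x v a : R) :
  is_derive x 1 h a -> is_derive x v h (a * v).
Proof.
move=> dh; rewrite -[h]/(h \o id); apply: is_derive_comp => //=.
Qed.

Lemma is_derive_continuous1 (h : R -> R) (dh : R -> R) :
  (forall x : R, is_derive x 1 h (dh x)) -> continuous h.
Proof.
move=> H x; apply: differentiable_continuous.
by apply/derivable1_diffP; case: (H x).
Qed.

Lemma class_C_continuous V n (f : V -> R) : class_C n f -> continuous f.
Proof. by case: n => [|n] []. Qed.

(** Lets the directional derivatives be given by a formula in place of the limits ['D_v f]; it is
    the induction step of the smoothness proofs below. *)
Lemma class_CS V n (f : V -> R) (df : V -> V -> R) :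
  continuous f -> (forall v x, is_derive x v f (df v x)) ->
  (forall v, class_C n (df v)) -> class_C n.+1 f.
Proof.
move=> cf dfE cdf; split=> // v; split=> [x|]; first by case: (dfE v x).
suff -> : (fun x => 'D_v f x) = df v by exact: cdf.
by apply/funext => x; apply: derive_val.
Qed.

Lemma class_C_derive V n (f : V -> R) (v x : V) : class_C n.+1 f ->
  is_derive x v f ('D_v f x).
Proof. by move=> [_ /(_ v)[dfx _]]; exact: derivableP. Qed.

Lemma class_CW V n (f : V -> R) : class_C n.+1 f -> class_C n f.
Proof.
elim: n f => [f []//|n IH f [cf df]]; split=> // v.
by have [d c] := df v; split=> //; exact: IH.
Qed.

Lemma class_C_cst V n (c : R) : class_C n (fun _ : V => c).
Proof.
elim: n c => [c|n IH c]; first by split=> // x; exact: cvg_cst.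
apply: (class_CS (df := fun _ _ => 0)).
- by move=> x; exact: cvg_cst.
- by move=> v; exact: IH.
Qed.

Lemma class_CD V n (f g : V -> R) :
  class_C n f -> class_C n g -> class_C n (fun x => f x + g x).
Proof.
elim: n f g => [f g [cf _] [cg _]|n IH f g cf cg].
  by split=> // x; apply: cvgD; [exact: cf|exact: cg].
apply: (class_CS (df := fun v x => 'D_v f x + 'D_v g x)).
- move=> x; apply: cvgD; [exact: (class_C_continuous cf)|].
  exact: (class_C_continuous cg).
- move=> v x; have df := class_C_derive v x cf.
  by have dg := class_C_derive v x cg; exact: is_deriveD.
- move=> v; apply: IH; [by case: cf => _ /(_ v) []|by case: cg => _ /(_ v) []].
Qed.

Lemma class_CM V n (f g : V -> R) :
  class_C n f -> class_C n g -> class_C n (fun x => f x * g x).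
Proof.
elim: n f g => [f g [cf _] [cg _]|n IH f g cf cg].
  by split=> // x; apply: cvgM; [exact: cf|exact: cg].
apply: (class_CS (df := fun v x => f x * 'D_v g x + g x * 'D_v f x)).
- move=> x; apply: cvgM; [exact: (class_C_continuous cf)|].
  exact: (class_C_continuous cg).
- move=> v x; have df := class_C_derive v x cf.
  by have dg := class_C_derive v x cg; exact: is_deriveM.
- move=> v; apply: class_CD; apply: IH; do ?exact: class_CW.
    by case: cg => _ /(_ v) [].
  by case: cf => _ /(_ v) [].
Qed.

Lemma class_CN V n (f : V -> R) : class_C n f -> class_C n (fun x => - f x).
Proof.
move=> cf; have := class_CM (class_C_cst V n (-1)) cf.
by congr (class_C n _); apply/funext => x; rewrite mulN1r.
Qed.

Lemma class_C_comp V n (h : R -> R) (f : V -> R) :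
  class_C n h -> class_C n f -> class_C n (h \o f).
Proof.
elim: n h f => [h f [ch _] [cf _]|n IH h f ch cf].
  split=> // x; apply: continuous_comp; [exact: cf|exact: ch].
apply: (class_CS (df := fun v x => 'D_1 h (f x) * 'D_v f x)).
- move=> x; apply: continuous_comp; [exact: (class_C_continuous cf)|].
  exact: (class_C_continuous ch).
- move=> v x; apply: is_derive_comp; last exact: (class_C_derive v x cf).
  by case: ch => _ /(_ 1) [/(_ (f x)) dh _]; exact: derivableP.
- move=> v; apply: class_CM; last by case: cf => _ /(_ v) [].
  apply: (IH (fun y => 'D_1 h y)); last exact: class_CW.
  by case: ch => _ /(_ 1) [].
Qed.

Lemma class_CS1 n (h dh : R -> R) :
  (forall x : R, is_derive x 1 h (dh x)) -> class_C n dh -> class_C n.+1 h.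
Proof.
move=> H c; apply: (class_CS (df := fun v x => dh x * v)).
- exact: is_derive_continuous1 H.
- by move=> v x; exact: is_derive_dir.
- move=> v; apply: class_CM => //; exact: class_C_cst.
Qed.

Lemma smooth_expR : smooth (@expR R).
Proof.
elim=> [|n IH]; first by split=> //; exact: continuous_expR.
exact: (class_CS1 (dh := expR)).
Qed.

Lemma smooth_sin_cos n : class_C n (@sin R) /\ class_C n (@cos R).
Proof.
elim: n => [|n [IH1 IH2]].
  by split; split=> //; [exact: continuous_sin|exact: continuous_cos].
split; first by apply: (class_CS1 (dh := cos)).
by apply: (class_CS1 (dh := fun x => - sin x)) => //; exact: class_CN.
Qed.

Lemma class_C_id n : class_C n (fun x : R => x).
Proof.
case: n => [|n]; first by split=> // x; exact: cvg_id.
apply: (class_CS1 (dh := fun=> 1)); last exact: class_C_cst.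
Qed.

Lemma is_derive_fst (x v : R * R) : is_derive x v (fun y : R * R => y.1) v.1.
Proof.
apply/is_derive_line => /=.
by apply: is_derive_eq; rewrite addr0 scaler0 add0r [_%:A]mulr1.
Qed.

Lemma is_derive_snd (x v : R * R) : is_derive x v (fun y : R * R => y.2) v.2.
Proof.
apply/is_derive_line => /=.
by apply: is_derive_eq; rewrite addr0 scaler0 add0r [_%:A]mulr1.
Qed.

Lemma class_C_fst n : class_C n (fun y : R * R => y.1).
Proof.
case: n => [|n]; first by split=> // x; exact: cvg_fst.
apply: (class_CS (df := fun v x => v.1)).
- by move=> x; exact: cvg_fst.
- by move=> v x; exact: is_derive_fst.
- by move=> v; exact: class_C_cst.
Qed.

Lemma class_C_snd n : class_C n (fun y : R * R => y.2).
Proof.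
case: n => [|n]; first by split=> // x; exact: cvg_snd.
apply: (class_CS (df := fun v x => v.2)).
- by move=> x; exact: cvg_snd.
- by move=> v x; exact: is_derive_snd.
- by move=> v; exact: class_C_cst.
Qed.


(* x^-m exp(-1/x) for x > 0; the case m = 0 is the usual smooth function that
   is flat at 0, and the others occur in its derivatives. *)
Definition flat (m : nat) (x : R) : R :=
  if 0 < x then x^-1 ^+ m * expR (- x^-1) else 0.

Lemma flat_ge0 m x : 0 <= flat m x.
Proof.
rewrite /flat; case: ifPn => // x0.
by rewrite mulr_ge0 ?expR_ge0// exprn_ge0// invr_ge0 ltW.
Qed.

(** With y = 1/x the claim reads y^(m+1) <= (m+1)! exp y, which is one term of the exponential
    series. It gives the continuity at 0 from which differentiability there follows. *)
Lemma flat_le m (x : R) : 0 <= x -> flat m x <= m.+1`!%:R * x.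
Proof.
rewrite /flat => x0; case: ifPn => [{}x0|_]; last by rewrite mulr_ge0.
have y0 : 0 < x^-1 by rewrite invr_gt0.
rewrite -[x in leRHS]invrK; move: y0; move: (x^-1) => y y0.
rewrite expRN ler_pdivrMr ?expR_gt0// mulrAC ler_pdivlMr// -exprSr.
have f0 : 0 < m.+1`!%:R :> R by rewrite ltr0n fact_gt0.
rewrite -ler_pdivrMl// mulrC.
by apply: le_trans (expR_ge1Dxn m (ltW y0)); rewrite lerDr.
Qed.

Lemma is_derive_flat m (x : R) :
  is_derive x 1 (flat m) (flat m.+2 x - m%:R * flat m.+1 x).
Proof.
have [x0|x0|<-] := ltgtP 0 x.
- pose F := fun y : R => y^-1 ^+ m * expR (- y^-1).
  have dF : is_derive x 1 F (flat m.+2 x - m%:R * flat m.+1 x).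
    have dV : is_derive x 1 (fun y : R => y^-1) (- x^-1 ^+ 2).
      have := @is_deriveV R (id : R -> R) x 1 1 (lt0r_neq0 x0) (is_derive_id x 1).
      by rewrite /GRing.scale /= mulr1 exprVn.
    have dE : is_derive x 1 (fun y : R => expR (- y^-1)) (expR (- x^-1) * x^-1 ^+ 2).
      apply: (@is_derive_comp _ expR (fun y : R => - y^-1)).
      by have := is_deriveN dV; rewrite opprK.
    have dX : is_derive x 1 (fun y : R => y^-1 ^+ m) (m%:R * x^-1 ^+ m.-1 * - x^-1 ^+ 2).
      apply: (@is_derive_comp _ (fun z : R => z ^+ m)) => //.
      apply: DeriveDef; first exact: exprn_derivable.
      by rewrite exp_derive /GRing.scale /= mulr1.
    have := is_deriveM dX dE; rewrite /F => H; apply: is_derive_eq H _.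
    rewrite /flat x0 /GRing.scale /=; clear F dX; case: m => [|m] /=.
      by rewrite !expr0 !mul0r mulr0 addr0 subr0 mul1r mulrC.
    by rewrite !exprS; ring.
  apply: near_eq_is_derive dF => //.
  by near=> y; rewrite /F /flat ifT//; near: y; exact: lt_nbhsr.
- have -> : flat m.+2 x - m%:R * flat m.+1 x = 0.
    by rewrite /flat ltNge ltW//= mulr0 subr0.
  apply: (@near_eq_is_derive _ _ _ (cst 0)) => //.
  near=> y; rewrite /flat ltNge ltW//; near: y; exact: lt_nbhsl.
- have -> : flat m.+2 0 - m%:R * flat m.+1 0 = 0.
    by rewrite /flat ltxx mulr0 subr0.
  have H : (h^-1 *: ((flat m \o shift 0) (h *: 1) - flat m 0) @[h --> 0^'] --> (0:R)).
    apply/cvgrPdist_le => e e0.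
    have K0 : 0 < m.+2`!%:R :> R by rewrite ltr0n fact_gt0.
    near=> h; rewrite sub0r normrN [flat m 0]/flat ltxx subr0 /= addr0.
    rewrite /GRing.scale /= mulr1 normrM normfV.
    have [h0|h0] := ltP 0 h; last by rewrite /flat ltNge h0 normr0 mulr0 ltW.
    rewrite (gtr0_norm h0) (ger0_norm (flat_ge0 m h)).
    (* The difference quotient at 0 is again a member of the family, and [flat_le] makes it tend to
       0. *)
    have -> : h^-1 * flat m h = flat m.+1 h by rewrite /flat h0 exprS mulrA.
    rewrite (le_trans (flat_le _ (ltW h0)))// -ler_pdivlMl//.
    rewrite -(gtr0_norm h0); near: h; apply: dnbhs0_le.
    by rewrite mulr_gt0// invr_gt0.
  by split; [apply/cvg_ex; exists 0|exact: cvg_lim].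
Unshelve. all: by end_near. Qed.

Lemma class_C_flat n m : class_C n (flat m).
Proof.
elim: n m => [|n IH] m.
  by split=> //; exact: is_derive_continuous1 (is_derive_flat m).
apply: (class_CS1 (is_derive_flat m)).
apply: class_CD => //; apply: class_CN; apply: class_CM => //.
exact: class_C_cst.
Qed.

(* Smooth functions with support in [a, b] increasing to the indicator of
   ]a, b[ as n grows. *)
Definition bump (a b : R) (n : nat) (x : R) : R :=
  1 - expR (- (n%:R * (flat 0 (x - a) * flat 0 (b - x)))).

Lemma smooth_bump a b n : smooth (bump a b n).
Proof.
move=> k; apply: class_CD; first exact: class_C_cst.
apply: class_CN; apply: (@class_C_comp _ _ expR) => //; first exact: smooth_expR.
apply: class_CN; apply: class_CM; first exact: class_C_cst.
apply: class_CM.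
  apply: (@class_C_comp _ _ (flat 0)); first exact: class_C_flat.
  by apply: class_CD; [exact: class_C_id|exact: class_C_cst].
apply: (@class_C_comp _ _ (flat 0)); first exact: class_C_flat.
apply: class_CD; [exact: class_C_cst|apply: class_CN; exact: class_C_id].
Qed.

Lemma bump_out a b n x : ~~ (a < x < b) -> bump a b n x = 0.
Proof.
move=> h; rewrite /bump /flat !subr_gt0.
by case: (ltP a x) (ltP x b) h => _ [] //= _ _; rewrite ?mul0r ?mulr0 oppr0 expR0 subrr.
Qed.

Lemma bump_itv01 a b n x : 0 <= bump a b n x <= 1.
Proof.
have f0 : 0 <= n%:R * (flat 0 (x - a) * flat 0 (b - x)).
  by rewrite !mulr_ge0 ?flat_ge0.
by rewrite /bump subr_ge0 expR_le1 oppr_le0 f0/= gerBl expR_ge0.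
Qed.

Lemma bump_cvg a b x : bump a b n x @[n --> \oo] --> (\1_(`]a, b[%classic) x : R).
Proof.
have [xab|xab] := boolP (a < x < b); last first.
  under eq_fun do rewrite bump_out//.
  by rewrite indicE memNset ?inE//= ?in_itv/=; [exact: cvg_cst|exact/negP].
have c0 : 0 < flat 0 (x - a) * flat 0 (b - x).
  move: xab => /andP[ax xb].
  by rewrite /flat !subr_gt0 ax xb !expr0 !mul1r mulr_gt0 ?expR_gt0.
rewrite indicE mem_set//= ?in_itv//=.
rewrite -[X in _ --> X]subr0; apply: cvgB; first exact: cvg_cst.
apply: (@cvg_comp _ _ _ (fun n : nat => n%:R : R)
  (fun y => expR (- (y * (flat 0 (x - a) * flat 0 (b - x))))) \oo +oo%R).
  exact: cvgr_idn.
apply: (@cvg_comp _ _ _ (fun y : R => y * (flat 0 (x - a) * flat 0 (b - x)))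
  (fun y => expR (- y)) +oo%R +oo%R); last exact: cvgr_expR.
by apply: gt0_cvgMly; [exact: c0|exact: cvg_id].
Qed.

End Smooth.

(** * Weak derivatives *)

Lemma integral_EFin_Rintegral d (T : measurableType d) (R : realType)
    (mu : {measure set T -> \bar R}) (A : set T) (f : T -> R) :
  measurable A -> mu.-integrable A (EFin \o f) ->
  (\int[mu]_(x in A) (f x)%:E)%E = (\int[mu]_(x in A) f x)%:E.
Proof. by move=> mA fi; rewrite /Rintegral fineK//; exact: integrable_fin_num. Qed.

Section Fundamental.
Context {R : realType}.
Local Notation plane := (measurableTypeR R * measurableTypeR R)%type.

Definition rect (a b c d : R) : set plane :=
  `]a, b[%classic `*` `]c, d[%classic.

Lemma measurable_rect a b c d : measurable (rect a b c d).
Proof. by apply: measurableX; exact: measurable_itv. Qed.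

Lemma rectI a b c d a' b' c' d' : rect a b c d `&` rect a' b' c' d' =
  rect (Num.max a a') (Num.min b b') (Num.max c c') (Num.min d d').
Proof.
apply/seteqP; split=> -[y z]; rewrite /rect /= /setX /= !in_itv/= !gt_max !lt_min.
  by move=> [[/andP[-> ->] /andP[-> ->]] [/andP[-> ->] /andP[-> ->]]].
by move=> [/andP[/andP[-> ->] /andP[-> ->]] /andP[/andP[-> ->] /andP[-> ->]]].
Qed.

Definition rects : set (set plane) :=
  [set X | exists a b c d, X = rect a b c d].

Lemma itv_cover (x : R) : exists n : nat, - n%:R < x < n%:R.
Proof.
exists (Num.bound `|x|); rewrite -ltr_norml.
exact: archi_boundP (normr_ge0 x).
Qed.

(** An open strip is a countable union of rectangles, so both coordinates are measurable for the
    sigma-algebra that rectangles generate. Rectangles being stable under intersection, Dynkin's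
    theorem becomes available. *)
Lemma measurable_rects : @measurable _ plane = <<s rects >>.
Proof.
apply/seteqP; split; last first.
  apply: smallest_sub; first exact: sigma_algebra_measurable.
  by move=> _ [a [b [c [d ->]]]]; exact: measurable_rect.
have mfst : measurable_fun setT (fst : g_sigma_algebraType rects -> measurableTypeR R).
  apply: (measurability _ (RGenOpens.measurableE R)).
  move=> _ [_ [a [b ->]] <-]; rewrite setTI.
  suff -> : fst @^-1` `]a, b[ = \bigcup_n rect a b (- n%:R) n%:R.
    by apply: bigcup_measurable => n _; apply: sub_sigma_algebra; do 4 eexists.
  apply/seteqP; split=> [[y z] /= yab|[y z] [n _ []]//].
  by have [n zn] := itv_cover z; exists n => //; split=> //=; rewrite in_itv.
have msnd : measurable_fun setT (snd : g_sigma_algebraType rects -> measurableTypeR R).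
  apply: (measurability _ (RGenOpens.measurableE R)).
  move=> _ [_ [a [b ->]] <-]; rewrite setTI.
  suff -> : snd @^-1` `]a, b[ = \bigcup_n rect (- n%:R) n%:R a b.
    by apply: bigcup_measurable => n _; apply: sub_sigma_algebra; do 4 eexists.
  apply/seteqP; split=> [[y z] /= yab|[y z] [n _ []]//].
  by have [n zn] := itv_cover y; exists n => //; split=> //=; rewrite in_itv.
apply: smallest_sub; first exact: smallest_sigma_algebra.
move=> X [[Y mY <-]|[Y mY <-]].
- exact: (mfst measurableT Y mY).
- exact: (msnd measurableT Y mY).
Qed.

(** Dynkin induction carries the vanishing of the integral from rectangles to all measurable sets.
    Since [h] lives in one fixed rectangle, its total integral is among the assumed ones, which
    handles complements. *)
Lemma ae0_of_rect (h : plane -> R) A B C E :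
  area.-integrable setT (EFin \o h) ->
  (forall y, ~ rect A B C E y -> h y = 0) ->
  (forall a b c d, A <= a -> b <= B -> C <= c -> d <= E ->
     (\int[area]_(y in rect a b c d) (h y)%:E = 0)%E) ->
  {ae area, forall y, h y = 0}.
Proof.
move=> ih h0 H.
have hE S : (\int[area]_(y in S) (h y)%:E =
             \int[area]_(y in S `&` rect A B C E) (h y)%:E)%E.
  rewrite [RHS]integral_mkcondr; apply: eq_integral => y _.
  rewrite patchE; case: ifPn => // /negP; rewrite inE => yr.
  by rewrite h0.
have G0 S : rects S -> (\int[area]_(y in S) (h y)%:E = 0)%E.
  move=> [a [b [c [d ->]]]]; rewrite hE rectI; apply: H.
  - by rewrite le_max lexx orbT.
  - by rewrite ge_min lexx orbT.
  - by rewrite le_max lexx orbT.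
  - by rewrite ge_min lexx orbT.
have iS S : measurable S -> area.-integrable S (EFin \o h).
  by move=> mS; exact: (integrableS measurableT).
have H0 S : measurable S -> (\int[area]_(y in S) (h y)%:E = 0)%E.
  move=> mS; have : <<s rects >> S by rewrite -measurable_rects.
  move: S {mS}; apply: (@dynkin_induction _ plane rects
    (fun S => \int[area]_(y in S) (h y)%:E = 0)%E measurable_rects).
  - move=> _ _ [a [b [c [d ->]]]] [a' [b' [c' [d' ->]]]]; rewrite rectI.
    by do 4 eexists.
  - by rewrite hE setTI; apply: G0; exists A, B, C, E.
  - exact: G0.
  - move=> S mS S0.
    have mSC := measurableC mS.
    have T0 : (\int[area]_y (h y)%:E = 0)%E.
      by rewrite hE setTI; apply: G0; exists A, B, C, E.
    have ihU : area.-integrable (S `|` ~` S) (EFin \o h) by rewrite setUv.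
    have dS : [disjoint S & ~` S] by rewrite disj_set2E setICr.
    have := Rintegral_setU mS mSC ihU dS.
    rewrite setUv /Rintegral T0 S0 /= add0r => h1.
    by rewrite integral_EFin_Rintegral ?iS// /Rintegral -h1.
  - move=> F mF tF F0; rewrite integral_bigcup//; last first.
      by apply: iS; exact: bigcupT_measurable.
    by apply: eseries0 => k _ _; exact: F0.
have : ae_eq area setT (EFin \o h) (cst 0%E).
  apply: integral_ae_eq => // S _ mS.
  by rewrite H0// integral0_eq.
by apply: filterS => y /(_ I) [].
Qed.

Lemma bump2_le1 a b c d n (y : plane) :
  `|bump a b n y.1 * bump c d n y.2| <= 1.
Proof.
have /andP[x0 x1] := bump_itv01 a b n y.1.
have /andP[z0 z1] := bump_itv01 c d n y.2.
move: (bump a b n y.1) (bump c d n y.2) x0 x1 z0 z1 => p q p0 p1 q0 q1.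
by rewrite ger0_norm; nra.
Qed.

Lemma integral_bump_cvg (h : plane -> R) a b c d :
  area.-integrable setT (EFin \o h) ->
  (\int[area]_y (h y * (bump a b n y.1 * bump c d n y.2))%:E @[n --> \oo] -->
    \int[area]_(y in rect a b c d) (h y)%:E)%E.
Proof.
move=> ih; rewrite integral_mkcond.
have mh : measurable_fun setT h by apply/measurable_EFinP; exact: measurable_int ih.
have mb (e e' : R) n : measurable_fun setT (bump e e' n : measurableTypeR R -> R).
  apply: continuous_measurable_fun.
  by have [] := smooth_bump e e' n 0.
apply: (@dominated_cvg _ _ _ _ _ _ _ _ (fun y => `|(h y)%:E|)%E) => //.
- move=> n; apply/measurable_EFinP; apply: measurable_funM => //.
  by apply: measurable_funM; apply: measurableT_comp.
- move=> y _; rewrite restrict_EFin; apply: cvg_EFin; first by near=> n.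
  have -> : (h \_ (rect a b c d)) y = h y * (\1_(`]a, b[%classic) y.1 * \1_(`]c, d[%classic) y.2).
    by rewrite patchE !indicE /rect in_setX; do 2 case: (_ \in _); rewrite ?(mulr0,mul0r,mulr1).
  apply: cvgM; first exact: cvg_cst.
  by apply: cvgM; exact: bump_cvg.
- exact: integrable_abse.
- move=> n y _; rewrite /= lee_fin normrM; apply: ler_piMr; first exact: normr_ge0.
  exact: bump2_le1.
Unshelve. all: by end_near. Qed.

Lemma integrable_bump (h : plane -> R) a b c d n :
  area.-integrable setT (EFin \o h) ->
  area.-integrable setT (EFin \o (fun y => h y * (bump a b n y.1 * bump c d n y.2))).
Proof.
move=> ih.
have mh : measurable_fun setT h by apply/measurable_EFinP; exact: measurable_int ih.
have mb (e e' : R) : measurable_fun setT (bump e e' n : measurableTypeR R -> R).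
  apply: continuous_measurable_fun.
  by have [] := smooth_bump e e' n 0.
apply: (le_integrable _ _ _ ih) => //.
  apply/measurable_EFinP; apply: measurable_funM => //.
  by apply: measurable_funM; apply: measurableT_comp.
move=> y _; rewrite /= lee_fin normrM; apply: ler_piMr; first exact: normr_ge0.
exact: bump2_le1.
Qed.

(** The fundamental lemma of the calculus of variations, for tests that are products of one-variable
    bumps; these converge boundedly to indicators of open rectangles. *)
Lemma ae0_of_bump (h : plane -> R) A B C E :
  area.-integrable setT (EFin \o h) ->
  (forall y, ~ rect A B C E y -> h y = 0) ->
  (forall a b c d n, A <= a -> b <= B -> C <= c -> d <= E ->
     \int[area]_y (h y * (bump a b n y.1 * bump c d n y.2)) = 0) ->
  {ae area, forall y, h y = 0}.
Proof.
move=> ih h0 H; apply: (ae0_of_rect ih h0) => a b c d Aa bB Cc dE.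
have := @integral_bump_cvg h a b c d ih.
rewrite (_ : (fun n => _) = cst 0%E); last first.
  apply/funext => n /=; rewrite integral_EFin_Rintegral ?H//.
  exact: integrable_bump.
by move=> /(cvg_lim (@ereal_hausdorff R)) <-; rewrite lim_cst.
Qed.

Lemma L2_measurable (D : set (R * R)) f : L2 D f ->
  measurable_fun setT (f \_ D : plane -> R).
Proof. by rewrite /L2 inE => /andP[/[!inE]]. Qed.

Lemma L2_integrable_sqr (D : set (R * R)) f : L2 D f ->
  area.-integrable setT (EFin \o (fun x : plane => (f \_ D) x ^+ 2)).
Proof. exact: Lfun2_integrable_sqr. Qed.

Lemma L2_integrable (D : set (R * R)) f : measurable (D : set plane) ->
  (area D < +oo)%E -> L2 D f -> area.-integrable setT (EFin \o (f \_ D : plane -> R)).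
Proof.
move=> mD Doo fD; have i2 := L2_integrable_sqr fD; have mf := L2_measurable fD.
have i1 : area.-integrable setT (EFin \o (\1_D : plane -> R)).
  apply/integrableP; split; first exact/measurable_EFinP/measurable_indic.
  under eq_integral => x _ do rewrite /= ger0_norm//.
  by rewrite integral_indic// setIT.
apply: (le_integrable measurableT _ _ (integrableD measurableT i1 i2)) => //.
  exact/measurable_EFinP.
move=> y _ /=; rewrite lee_fin patchE indicE; case: (y \in D) => /=; last first.
  by rewrite normr0.
set z := f y; rewrite [leRHS]ger0_norm ?addr_ge0 ?sqr_ge0//.
have := sqr_ge0 (`|z| - 1); rewrite -(real_normK (num_real z)).
by have := normr_ge0 z; nra.
Qed.

Lemma L2_of_integrable (D : set (R * R)) f :
  measurable_fun setT (f \_ D : plane -> R) ->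
  area.-integrable setT (EFin \o (fun x : plane => (f \_ D) x ^+ 2)) -> L2 D f.
Proof.
move=> mf /integrableP[_ i2]; rewrite /L2 inE; apply/andP; split; rewrite inE//=.
rewrite /finite_norm unlock. rewrite poweR_lty//.
apply: le_lt_trans i2; rewrite le_eqVlt; apply/orP; left; apply/eqP.
apply: eq_integral => y _ /=.
by rewrite powR_mulrn// real_normK ?num_real// ger0_norm ?sqr_ge0.
Qed.

Lemma test_function_bump (D : set (R * R)) a b c d n :
  (`[a, b]%classic `*` `[c, d]%classic `<=` D) ->
  test_function D (fun y => bump a b n y.1 * bump c d n y.2).
Proof.
move=> KD; split.
  move=> k; apply: class_CM.
    by apply: (class_C_comp (smooth_bump a b n k)); exact: class_C_fst.
  by apply: (class_C_comp (smooth_bump c d n k)); exact: class_C_snd.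
exists (`[a, b]%classic `*` `[c, d]%classic); split=> //.
  by apply: compact_setX; exact: segment_compact.
move=> y yK; have [y1|/negP y1] := boolP (a < y.1 < b); last first.
  by rewrite bump_out ?mul0r//; exact/negP.
rewrite mulrC bump_out ?mul0r//; apply/negP => y2; apply: yK.
by split=> /=; rewrite in_itv/=; [move: y1|move: y2] => /andP[/ltW-> /ltW->].
Qed.

Lemma rect_cover (D : set (R * R)) : open D ->
  exists r : nat -> R * R * (R * R),
    (forall n, `[(r n).1.1, (r n).1.2]%classic `*` `[(r n).2.1, (r n).2.2]%classic `<=` D) /\
    D `<=` \bigcup_n rect (r n).1.1 (r n).1.2 (r n).2.1 (r n).2.2.
Proof.
move=> oD.
pose d (q : rat * rat * nat) : R := q.2.+1%:R^-1.
pose ok (q : rat * rat * nat) := forall z : R * R, `|z.1 - ratr q.1.1| <= d q ->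
      `|z.2 - ratr q.1.2| <= d q -> D z.
pose r0 : R * R * (R * R) := ((1, 0), (1, 0)).
pose r n := if unpickle n is Some q then
   if `[< ok q >] then ((ratr q.1.1 - d q, ratr q.1.1 + d q),
                       (ratr q.1.2 - d q, ratr q.1.2 + d q)) else r0 else r0.
exists r; split.
  have r0D : `[1, 0]%classic `*` `[1, 0]%classic `<=` D.
    by move=> y [/= + _]; rewrite in_itv/= => /andP[y1 y0]; have := le_trans y1 y0; rewrite ler10.
  move=> n; rewrite /r; case: unpickle => //= q; case: asboolP => // okq y [].
  rewrite /= !in_itv/= => /andP[y1 y2] /andP[y3 y4]; apply: okq.
    by rewrite ler_distl y1 y2.
  by rewrite ler_distl y3 y4.
move=> y Dy; have [q [q1 q2 qD]] := open_rat_box oD Dy.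
exists (pickle q) => //; rewrite /r pickleK.
case: asboolP => // _; split=> /=.
  by rewrite in_itv/=; move: q1; rewrite ltr_distl.
by rewrite in_itv/=; move: q2; rewrite ltr_distl.
Qed.

(** [D] is a countable union of open rectangles whose closures lie in [D]. On each of them bumps are
    admissible tests, and the fundamental lemma applies to the difference of the two derivatives. *)
Lemma weak_deriv_unique (D : set (R * R)) (v : R * R) f g1 g2 :
  open D -> (area D < +oo)%E ->
  is_weak_deriv D v f g1 -> is_weak_deriv D v f g2 ->
  {ae area, forall x, D x -> g1 x = g2 x}.
Proof.
move=> oD Doo [L1 H1] [L2' H2].
have mD := open_measurable2 oD.
have [r [rD Dr]] := rect_cover oD.
have i1 := L2_integrable mD Doo L1; have i2 := L2_integrable mD Doo L2'.
pose h n y := ((g1 \_ D) y - (g2 \_ D) y) *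
   \1_(rect (r n).1.1 (r n).1.2 (r n).2.1 (r n).2.2) y.
have hn0 n : {ae area, forall y, h n y = 0}.
  apply: (@ae0_of_bump _ (r n).1.1 (r n).1.2 (r n).2.1 (r n).2.2).
  - have i12 := integrableB measurableT i1 i2.
    apply: (integrableMl measurableT i12).
    + have mr := measurable_rect (r n).1.1 (r n).1.2 (r n).2.1 (r n).2.2.
      exact: (measurable_indic mr).
    + exists 1; split=> // M M1 y _ /=; rewrite indicE ger0_norm//.
      by rewrite (le_trans _ (ltW M1))//; case: (_ \in _).
  - by move=> y yr; rewrite /h indicE memNset// mulr0.
  - move=> a b c d k ra rb rc rd.
    have tphi : test_function D (fun y => bump a b k y.1 * bump c d k y.2).
      apply: test_function_bump => y [] /=; rewrite !in_itv/= => /andP[ay yb] /andP[cy yd].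
      apply: (rD n); split=> /=; rewrite in_itv/=.
        by rewrite (le_trans ra)// (le_trans yb).
      by rewrite (le_trans rc)// (le_trans yd).
    have := H1 _ tphi; rewrite (H2 _ tphi) => /oppr_inj.
    rewrite (Rintegral_mkcond _ _ (fun _ => _ * _)) [in RHS]Rintegral_mkcond => E12.
    have e g : (fun y => g y * (bump a b k y.1 * bump c d k y.2)) \_ D =
      (fun y => (g \_ D) y * (bump a b k y.1 * bump c d k y.2)).
      by apply/funext => y; rewrite !patchE; case: ifP => //; rewrite mul0r.
    rewrite !e in E12.
    under eq_Rintegral => y _.
      rewrite (_ : h n y * _ =
        (g1 \_ D) y * (bump a b k y.1 * bump c d k y.2) -
        (g2 \_ D) y * (bump a b k y.1 * bump c d k y.2)); last first.
        rewrite /h indicE; have [_|] := boolP (y \in _); first by rewrite mulr1 mulrBl.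
        move=> /negP; rewrite inE => yr; rewrite mulr0 mul0r.
        have [y1|y1] := boolP (a < y.1 < b); last by rewrite bump_out// !mul0r !mulr0 subr0.
        have [y2|y2] := boolP (c < y.2 < d); last by rewrite (bump_out _ y2) !mulr0 subr0.
        exfalso; apply: yr; split=> /=; rewrite in_itv/=.
          by move: y1 => /andP[/(le_lt_trans ra) -> /lt_le_trans ->].
        by move: y2 => /andP[/(le_lt_trans rc) -> /lt_le_trans ->].
      over.
    by rewrite RintegralB//; [rewrite E12 subrr|exact: integrable_bump|exact: integrable_bump].
have := ae_foralln hn0; apply: filterS => y hy Dy.
have [n _ yn] := Dr y Dy.
have := hy n; rewrite /h indicE mem_set// mulr1 !patchE mem_set//.
by move/eqP; rewrite subr_eq0 => /eqP.
Qed.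

End Fundamental.

(** * Difference quotients *)

Section DifferenceQuotient.
Context {R : realType}.
Local Notation plane := (measurableTypeR R * measurableTypeR R)%type.
Local Notation leb := (@lebesgue_measure R).

(* A copy of area, on which the sigma-finite instance needed by Fubini's theorem
   can be declared. *)
Definition sarea : set plane -> \bar R :=
  (@lebesgue_measure R \x @lebesgue_measure R)%E.

HB.instance Definition _ := Measure.on sarea.

Let sarea_sigma_finite : sigma_finite setT sarea.
Proof.
exists (fun n => box (0, 0) n%:R).
  apply/esym/seteqP; split=> // y _.
  have [n ny] := itv_cover y.1; have [m my] := itv_cover y.2.
  exists (maxn n m) => //; apply/boxP; rewrite !subr0 !ltr_norml.
  have nn : (n%:R : R) <= (maxn n m)%:R by rewrite ler_nat leq_maxl.
  have mm : (m%:R : R) <= (maxn n m)%:R by rewrite ler_nat leq_maxr.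
  move: ny my => /andP[ny1 ny2] /andP[my1 my2].
  by split; apply/andP; split; lra.
move=> n; split; first exact: measurable_box.
have E : sarea (box (0, 0) n%:R) = _ := @area_box R (0, 0) n%:R (ler0n _ _).
by rewrite E; exact: ltry.
Qed.

HB.instance Definition _ := @Measure_isSigmaFinite.Build _ _ _ sarea
  sarea_sigma_finite.

Lemma tonelli_area (f : plane * measurableTypeR R -> \bar R) :
  measurable_fun setT f -> (forall z, 0 <= f z)%E ->
  (\int[area]_y \int[leb]_t f (y, t) = \int[leb]_t \int[area]_y f (y, t))%E.
Proof. by move=> mf f0; exact: (@fubini_tonelli _ _ _ _ R sarea leb f mf f0). Qed.

Lemma fubini_area (f : plane * measurableTypeR R -> \bar R) :
  measurable_fun setT f ->
  (\int[leb]_t \int[area]_y `|f (y, t)| < +oo)%E ->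
  (\int[area]_y \int[leb]_t f (y, t) = \int[leb]_t \int[area]_y f (y, t))%E /\
  area.-integrable setT (fun y => \int[leb]_t f (y, t))%E.
Proof.
move=> mf foo.
have fi : (sarea \x leb)%E.-integrable setT f by exact: (integrable21ltyP sarea leb mf).2.
split; first exact: (Fubini fi).
exact: (integrable_fubini_F fi).
Qed.

Lemma exists_primitive (h : R -> R) (a : R) : continuous h ->
  (forall z, z <= a -> h z = 0) -> exists P : R -> R, forall z : R, is_derive z 1 P (h z).
Proof.
move=> ch h0.
(* Starting at a - 1 leaves every z >= a strictly inside the interval of integration, as the
   fundamental theorem requires; to the left of a the function vanishes anyway. *)
pose P z := (\int[leb]_(t in `[a - 1, z]) h t)%R.
exists P => z; have [za|az] := ltP z a.
  rewrite h0; last exact: ltW.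
  apply: (@near_eq_is_derive _ _ _ (cst 0)) => //.
  near=> y; rewrite /P /=.
  apply/esym; rewrite (@eq_Rintegral _ _ _ leb _ (cst 0)) ?Rintegral_cst ?mul0r// => t.
  rewrite inE /= in_itv/= => /andP[_ ty]; rewrite h0// (le_trans ty)//.
  by apply: ltW; near: y; exact: lt_nbhsl.
have az1 : a - 1 < z by lra.
have zz : z < z + 1 by lra.
have [|dP PE] := @continuous_FTC1_closed R h (a - 1) z (z + 1) zz _ az1 (ch z).
  apply: continuous_compact_integrable; first exact: segment_compact.
  exact: continuous_subspaceT.
by rewrite derive1E in PE; exact: DeriveDef dP PE.
Unshelve. all: by end_near. Qed.

Lemma integral_primitive (h P : R -> R) (z s : R) : 0 < s -> continuous h ->
  (forall z : R, is_derive z 1 P (h z)) ->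
  (\int[leb]_(t in `[0%R, s]) (h (z - t)%R)%:E = (P z - P (z - s))%R%:E)%E.
Proof.
move=> s0 ch dP.
have dz (t : R) : is_derive t 1 (fun t => - P (z - t)) (h (z - t)).
  have dzt : is_derive t 1 (fun t : R => z - t) (-1).
    have := @is_deriveB _ _ _ (cst z) id t 1 0 1 _ _.
    by rewrite sub0r => /(_ (is_derive_cst _ _ _) (is_derive_id _ _)).
  have := is_deriveN (@is_derive_comp _ _ P (fun t : R => z - t) t 1 _ _ (dP (z - t)) dzt).
  by rewrite mulrN1 opprK.
have cz : continuous (fun t : R => h (z - t)).
  move=> t; apply: (@continuous_comp _ _ _ (fun t => z - t) h); last exact: ch.
  by apply: cvgB; [exact: cvg_cst|exact: cvg_id].
have cP := is_derive_continuous1 dz.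
rewrite (@continuous_FTC2 R _ (fun t => - P (z - t)))//.
- by rewrite subr0 -EFinB opprK addrC.
- exact: continuous_subspaceT.
- split.
  + by move=> t _; case: (dz t).
  + exact: cvg_at_right_filter (cP 0).
  + exact: cvg_at_left_filter (cP s).
- by move=> t _; rewrite derive1E; exact: derive_val.
Qed.


Lemma integral_shift (v : R * R) (f : plane -> \bar R) :
  measurable_fun setT f ->
  (\int[area]_y f (y + v)%R = \int[area]_y f y)%E.
Proof.
move=> mf.
by have := integral_preserving (measurable_shift v) (area_shift v) measurableT mf.
Qed.

Lemma integrable_shift (v : R * R) (f : plane -> R) :
  area.-integrable setT (EFin \o f) ->
  area.-integrable setT (EFin \o (fun y => f (y + v))).
Proof.
move=> fi.
by have := integrable_preserving (measurable_shift v) (area_shift v) measurableT fi.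
Qed.

Lemma integrable_mulb d (X : measurableType d) (mu : {measure set X -> \bar R})
    (h w : X -> R) (M : R) :
  mu.-integrable setT (EFin \o h) -> measurable_fun setT w ->
  (forall y, `|w y| <= M) -> mu.-integrable setT (EFin \o (fun y => h y * w y)).
Proof.
move=> ih mw wM; apply: (integrableMl measurableT ih mw).
exists M; split; first exact: num_real.
by move=> N MN y _ /=; exact: le_trans (wM y) (ltW MN).
Qed.

Definition hshift (t : R) (y : plane) : plane := y + (t, 0).

Lemma hshiftK t y : hshift (- t) (hshift t y) = y.
Proof. by case: y => y1 y2; congr pair => /=; rewrite ?addrK ?addr0. Qed.

Lemma measurable_hshift t : measurable_fun setT (hshift t).
Proof. exact: measurable_shift. Qed.

Lemma measurable_hshift2 : measurable_fun setT
  (fun z : plane * measurableTypeR R => hshift z.2 z.1).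
Proof.
apply: measurable_fun_pair => /=.
  apply: measurable_funD; last exact: measurable_snd.
  by apply: measurableT_comp => //; exact: measurable_fst.
apply: measurable_funD => //.
by apply: measurableT_comp => //; exact: measurable_fst.
Qed.

Lemma integral_hshift t (f : plane -> \bar R) : measurable_fun setT f ->
  (\int[area]_y f (hshift t y) = \int[area]_y f y)%E.
Proof. exact: integral_shift. Qed.

Lemma integrable_hshift t (f : plane -> R) :
  area.-integrable setT (EFin \o f) ->
  area.-integrable setT (EFin \o (f \o hshift t)).
Proof. exact: integrable_shift. Qed.

Lemma integral_indicM (A : set (measurableTypeR R)) (c : \bar R) :
  measurable A -> (0 <= c)%E ->
  (\int[leb]_t ((\1_A t)%:E * c) = leb A * c)%E.
Proof.
move=> mA c0.
have m1 : measurable_fun setT (fun t : measurableTypeR R => (\1_A t : R)%:E).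
  by apply/measurable_EFinP; exact: measurable_indic.
by rewrite (ge0_integralZr leb measurableT m1)// integral_indic// setIT.
Qed.

(** * Absolute continuity along horizontal segments *)

Section WeakDifference.
Variables (D : set (R * R)) (f g : R * R -> R) (x : R * R) (a s : R).
Hypotheses (oD : open D) (Doo : (area D < +oo)%E) (s0 : 0 < s).
Hypotheses (fL2 : L2 D f) (wfg : is_weak_deriv D e1 f g).
Hypothesis xD : forall y, `|y.1 - x.1| <= a + s -> `|y.2 - x.2| <= a + s -> D y.
Let F : plane -> R := f \_ D.
Let G : plane -> R := g \_ D.
Let mD : measurable (D : set plane) := open_measurable2 oD.
Let gL2 : L2 D g := wfg.1.
Let mF : measurable_fun setT F := L2_measurable fL2.
Let mG : measurable_fun setT G := L2_measurable gL2.
Let iF : area.-integrable setT (EFin \o F) := L2_integrable mD Doo fL2.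
Let iG : area.-integrable setT (EFin \o G) := L2_integrable mD Doo gL2.
Let T := hshift.

Let mT t : measurable_fun setT (T t). Proof. exact: measurable_hshift. Qed.

Let mTT : measurable_fun setT (fun z : plane * measurableTypeR R => T z.2 z.1).
Proof. exact: measurable_hshift2. Qed.

Let S01 : set (measurableTypeR R) := `[0, s]%classic.
Let mS : measurable S01. Proof. exact: measurable_itv. Qed.

Let sS01 : leb S01 = s%:E.
Proof. by rewrite /S01 lebesgue_measure_itv /= lte_fin s0 -EFinB subr0. Qed.

(** The integral of the weak derivative along the segment from y to y + s e1. The aim is to show
    that it equals the increment of [F] almost everywhere near x. *)
Let K (y : plane) : \bar R := (\int[leb]_(t in S01) (G (T t y))%:E)%E.

Let mcw (c : R) (h : plane -> R) : measurable_fun setT h ->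
  measurable_fun setT (fun y => c * h y).
Proof. by move=> mh; exact: measurable_funM. Qed.

(* Weighted by a bounded w, so that K may be tested against bumps. *)
Let k (w : plane -> R) (z : plane * measurableTypeR R) : \bar R :=
  (G (T z.2 z.1) * (\1_S01 z.2 * w z.1))%:E.

Let mk (w : plane -> R) : measurable_fun setT w -> measurable_fun setT (k w).
Proof.
move=> mw; apply/measurable_EFinP; apply: measurable_funM.
  exact: (measurableT_comp mG mTT).
apply: measurable_funM.
  by apply: (measurableT_comp (measurable_indic mS)); exact: measurable_snd.
by apply: (measurableT_comp mw); exact: measurable_fst.
Qed.

Let koo (w : plane -> R) : measurable_fun setT w -> (forall y, `|w y| <= 1) ->
  (\int[leb]_t \int[area]_y `|k w (y, t)| < +oo)%E.
Proof.
move=> mw w1; pose I := (\int[area]_y `|(G y)%:E|)%E.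
have Ioo : (I < +oo)%E by move/integrableP : iG => [].
apply: (@le_lt_trans _ _ (\int[leb]_t ((\1_S01 t)%:E * I))%E).
  apply: ge0_le_integral => //.
  - by move=> t _; exact: integral_ge0.
  - apply: (@measurable_fun_fubini_tonelli_G _ _ _ _ R sarea (fun z => `|k w z|%E)) => //.
    by apply: measurableT_comp => //; exact: mk.
  - apply: emeasurable_funM => //; apply/measurable_EFinP; exact: measurable_indic.
  - move=> t _; rewrite /I -(integral_hshift t (f := fun y => `|(G y)%:E|%E))//; last first.
      by apply: measurableT_comp => //; exact/measurable_EFinP.
    rewrite -ge0_integralZl//; last first.
    + apply: measurableT_comp => //; apply/measurable_EFinP; exact: (measurableT_comp mG (mT t)).
    apply: ge0_le_integral => //.
    + apply: measurableT_comp => //; apply/measurable_EFinP; apply: measurable_funM.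
        exact: (measurableT_comp mG (mT t)).
      exact: (mcw (\1_S01 t) mw).
    + apply: emeasurable_funM => //; apply: measurableT_comp => //.
      apply/measurable_EFinP; exact: (measurableT_comp mG (mT t)).
    + move=> y _; rewrite /k /= -EFinM lee_fin !normrM mulrCA.
      rewrite ger0_norm// ler_wpM2l// ler_piMr//.
by rewrite integral_indicM ?integral_ge0// lte_mul_pinfty// sS01.
Qed.

Let Kk y : (\int[leb]_t k (fun=> 1%R) (y, t) = K y)%E.
Proof.
rewrite /K [RHS]integral_mkcond; apply: eq_integral => t _.
by rewrite /k /= patchE indicE; case: (t \in S01); rewrite ?(mulr1,mulr0).
Qed.

Let iK : area.-integrable setT K.
Proof.
have m1 : measurable_fun setT ((fun=> 1) : plane -> R) by exact: measurable_cst.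
have n1 (y : plane) : `|(fun=> 1 : R) y| <= 1 :> R by rewrite normr1.
have [_] := fubini_area (mk m1) (koo m1 n1).
by congr (area.-integrable setT _); apply/funext => y; rewrite Kk.
Qed.

(** [K] is integrable, so that [fine] changes it only on a null set, where infinite values become
    0. *)
Let fK (y : plane) : R := fine (K y).

Let ifK : area.-integrable setT (EFin \o fK).
Proof.
apply: (le_integrable measurableT _ _ iK).
  apply/measurable_EFinP; apply: measurableT_comp => //; exact: measurable_int iK.
move=> y _ /=; rewrite /fK; case: (K y) => [r| |] /=; rewrite ?normr0 ?leey ?lexx//.
Qed.

Let aeK (w : plane -> R) : measurable_fun setT w -> (forall y, `|w y| <= 1) ->
  (\int[area]_y (fK y * w y)%:E = \int[area]_y \int[leb]_t k w (y, t))%E.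
Proof.
move=> mw w1.
have m1 : measurable_fun setT ((fun=> 1) : plane -> R) by exact: measurable_cst.
have n1 (y : plane) : `|(fun=> 1 : R) y| <= 1 :> R by rewrite normr1.
have [_ iw] := fubini_area (mk mw) (koo mw w1).
have i1 := (integrable21ltyP sarea leb (mk m1)).2 (koo m1 n1).
have := ae_integrable1 i1; move=> ae1.
apply: ae_eq_integral => //.
- by apply: (measurable_int area); exact: (integrable_mulb ifK mw w1).
- exact: measurable_int iw.
apply: filterS ae1 => y /= iy _.
have -> : (fun t => k w (y, t)) = (fun t => (w y)%:E * k (fun=> 1%R) (y, t))%E.
  by apply/funext => t; rewrite /k /= -EFinM; congr (_%:E); ring.
rewrite integralZl// Kk EFinM muleC; congr (_ * _)%E.
rewrite /fK fineK// -Kk; exact: integrable_fin_num.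
Qed.

Section Test.
Variables (a' b' c' d' : R) (chi zeta : R -> R).
Hypotheses (aA : x.1 - a <= a') (bB : b' <= x.1 + a).
Hypotheses (cC : x.2 - a <= c') (dE : d' <= x.2 + a).
Hypotheses (schi : smooth chi) (szeta : smooth zeta).
Hypothesis chi_out : forall z, ~~ (a' < z < b') -> chi z = 0.
Hypothesis zeta_out : forall z, ~~ (c' < z < d') -> zeta z = 0.
Hypothesis w1 : forall y : plane, `|chi y.1 * zeta y.2| <= 1.
Let w (y : plane) : R := chi y.1 * zeta y.2.

Let cchi : continuous chi. Proof. exact: class_C_continuous (schi 0). Qed.
Let czeta : continuous zeta. Proof. exact: class_C_continuous (szeta 0). Qed.

Let mw : measurable_fun setT w.
Proof.
apply: measurable_funM.
  by apply: (measurableT_comp (continuous_measurable_fun cchi)); exact: measurable_fst.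
by apply: (measurableT_comp (continuous_measurable_fun czeta)); exact: measurable_snd.
Qed.

Let mwT t : measurable_fun setT (fun y => w (T t y)).
Proof. exact: (measurableT_comp mw (mT t)). Qed.

Let Phi_int z (P : R -> R) : (forall z : R, is_derive z 1 P (chi z)) ->
  (\int[leb]_(t in S01) (chi (z - t))%:E = (P z - P (z - s))%:E)%E.
Proof. by move=> dP; exact: (integral_primitive z s0 cchi dP). Qed.

(** Fubini, followed at fixed t by a translation of y, moves the shift from [G] to the test [w].
    Integrating [chi (y.1 - t)] over t then gives a difference of values of the primitive of
    [chi]. *)
Let swap_k (P : R -> R) : (forall z : R, is_derive z 1 P (chi z)) ->
  (\int[area]_y \int[leb]_t k w (y, t) =
   \int[area]_y (G y * ((P y.1 - P (y.1 - s)) * zeta y.2))%:E)%E.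
Proof.
move=> dP.
rewrite (fubini_area (mk mw) (koo mw w1)).1.
pose k2 (z : plane * measurableTypeR R) : \bar R :=
  (G z.1 * (\1_S01 z.2 * w (T (- z.2) z.1)))%:E.
have E t : (\int[area]_y k w (y, t) = \int[area]_y k2 (y, t))%E.
  have m2 : measurable_fun setT (fun y => k2 (y, t)).
    apply/measurable_EFinP; apply: (measurable_funM mG).
    exact: (mcw (\1_S01 t) (mwT (- t))).
  apply: (etrans _ (integral_hshift t m2)); apply: eq_integral => y _.
  by rewrite /k /k2 /= /T hshiftK.
have mTN : measurable_fun setT (fun z : plane * measurableTypeR R => T (- z.2) z.1).
  have mN : measurable_fun setT (fun z : plane * measurableTypeR R =>
      (z.1, - z.2) : plane * measurableTypeR R).
    apply: measurable_fun_pair; first exact: measurable_fst.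
    by apply: measurableT_comp => //; exact: measurable_snd.
  exact: (measurableT_comp mTT mN).
have mk2 : measurable_fun setT k2.
  apply/measurable_EFinP; apply: measurable_funM.
    exact: (measurableT_comp mG measurable_fst).
  apply: measurable_funM; last exact: (measurableT_comp mw mTN).
  by apply: (measurableT_comp (measurable_indic mS)); exact: measurable_snd.
have k2oo : (\int[leb]_t \int[area]_y `|k2 (y, t)| < +oo)%E.
  apply: le_lt_trans (koo mw w1); rewrite le_eqVlt; apply/orP; left; apply/eqP.
  apply: eq_integral => t _.
  have m2 : measurable_fun setT (fun y => `|k2 (y, t)|%E).
    apply: measurableT_comp => //; apply/measurable_EFinP; apply: (measurable_funM mG).
    exact: (mcw (\1_S01 t) (mwT (- t))).
  apply: (etrans (esym (integral_hshift t m2))); apply: eq_integral => y _.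
  by rewrite /k /k2 /= /T hshiftK.
under eq_integral => t _ do rewrite E.
rewrite -(fubini_area mk2 k2oo).1.
apply: eq_integral => y _.
have -> : (fun t => k2 (y, t)) = (fun t => (G y * zeta y.2)%:E *
    ((fun t => (chi (y.1 - t))%:E) \_ S01) t)%E.
  apply/funext => t; rewrite /k2 /= patchE indicE /w /T /hshift /= addr0.
  by case: (t \in S01); rewrite /= -EFinM; congr (_%:E); ring.
have ic : leb.-integrable S01 (fun t => (chi (y.1 - t))%:E).
  apply: continuous_compact_integrable; first exact: segment_compact.
  apply: continuous_subspaceT => t.
  apply: (@continuous_comp _ _ _ (fun t => y.1 - t) chi); last exact: cchi.
  by apply: cvgB; [exact: cvg_cst|exact: cvg_id].
rewrite integralZl//; last exact: ((integrable_mkcond _ mS).1 ic).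
by rewrite -integral_mkcond Phi_int// -EFinM; congr (_%:E); ring.
Qed.

Let Phi_out (P : R -> R) z : (forall z : R, is_derive z 1 P (chi z)) ->
  ~~ (a' <= z <= b' + s) -> P z - P (z - s) = 0.
Proof.
move=> dP zab; apply/eqP; rewrite -eqe -Phi_int//; apply/eqP.
apply: integral0_eq => t; rewrite /S01 /= in_itv/= => /andP[t0 ts].
congr (_%:E); apply: chi_out; apply: contra zab => /andP[h1 h2].
by apply/andP; split; lra.
Qed.

(** The primitive [P] need not have compact support, but P z - P (z - s) does: it is the integral of
    [chi] over an interval of length s, and vanishes when this interval misses the support. The
    support grows by s to the right, for which the margin in [xD] provides. *)
Let test (P : R -> R) : (forall z : R, is_derive z 1 P (chi z)) ->
  test_function D (fun y => (P y.1 - P (y.1 - s)) * zeta y.2).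
Proof.
move=> dP.
have cP m : class_C m P.
  case: m => [|m]; first by split=> //; exact: is_derive_continuous1 dP.
  exact: class_CS1 dP (schi m).
split.
  move=> m; apply: class_CM; last first.
    by apply: (class_C_comp (szeta m)); exact: class_C_snd.
  apply: class_CD; first by apply: (class_C_comp (cP m)); exact: class_C_fst.
  apply: class_CN; apply: (class_C_comp (cP m)).
  by apply: class_CD; [exact: class_C_fst|exact: class_C_cst].
exists (`[a', b' + s]%classic `*` `[c', d']%classic); split.
- by apply: compact_setX; exact: segment_compact.
- move=> y [] /=; rewrite !in_itv/= => /andP[y1 y2] /andP[y3 y4].
  have y5 : y.2 <= x.2 + a := le_trans y4 dE.
  have y6 : x.2 - a <= y.2 := le_trans cC y3.
  have y7 : y.1 <= x.1 + (a + s) by rewrite addrA (le_trans y2)// lerD2r.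
  have y8 : x.1 - a <= y.1 := le_trans aA y1.
  by apply: xD; rewrite ler_distl; apply/andP; split=> //; move: y5 y6 y8 s0; lra.
- move=> y yK; have [y1|y1] := boolP (a' <= y.1 <= b' + s); last first.
    by rewrite Phi_out// mul0r.
  rewrite zeta_out ?mulr0//; apply/negP => /andP[/ltW y2 /ltW y3]; apply: yK.
  by split=> /=; rewrite in_itv//= y2 y3.
Qed.

Let weak (P : R -> R) : (forall z : R, is_derive z 1 P (chi z)) ->
  (\int[area]_y (F y * ((chi y.1 - chi (y.1 - s)) * zeta y.2)) =
  - \int[area]_y (G y * ((P y.1 - P (y.1 - s)) * zeta y.2)))%R.
Proof.
move=> dP; have := wfg.2 _ (test dP).
rewrite Rintegral_mkcond [in X in _ = X -> _]Rintegral_mkcond.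
have e (h : plane -> R) (u : plane -> R) :
    (fun y => h y * u y) \_ D = (fun y => (h \_ D) y * u y).
  by apply/funext => y; rewrite !patchE; case: ifP => //; rewrite mul0r.
rewrite !e -/F -/G => <-; apply: eq_Rintegral => y _; congr (_ * _).
have d1 : is_derive y e1 (fun y : R * R => P y.1 - P (y.1 - s)) (chi y.1 - chi (y.1 - s)).
  have f1 : is_derive y e1 (fun y : R * R => y.1) 1 := is_derive_fst y e1.
  have A1 : is_derive y e1 (P \o fst) (chi y.1 * 1) := is_derive_comp (dP y.1) f1.
  have f2 : is_derive y e1 (fun y : R * R => y.1 - s) 1.
    by have := is_deriveB f1 (is_derive_cst s y e1); rewrite subr0.
  have A2 : is_derive y e1 (fun y => P (y.1 - s)) (chi (y.1 - s) * 1) :=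
    @is_derive_comp _ _ P (fun y : R * R => y.1 - s) y e1 _ _ (dP (y.1 - s)) f2.
  by have := is_deriveB A1 A2; rewrite !mulr1.
have d2 : is_derive y e1 (fun y : R * R => zeta y.2) 0.
  have f1 : is_derive y e1 (fun y : R * R => y.2) 0 := is_derive_snd y e1.
  have z1 : is_derive y.2 1 zeta ('D_1 zeta y.2).
    exact: class_C_derive (szeta 1).
  by have := is_derive_comp z1 f1; rewrite mulr0.
have := is_deriveM d1 d2 => d12.
by rewrite derive_val scaler0 add0r mulrC.
Qed.

(** The derivative of (P y.1 - P (y.1 - s)) zeta y.2 along e1 is [w] minus its translate by s. The
    definition of the weak derivative with this test, after a translation in the term with [F], is
    exactly the identity sought tested against [w]. *)
Lemma weak_difference_test : \int[area]_y ((F (T s y) - F y - fK y) * w y) = 0.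
Proof.
have [P dP] : exists P : R -> R, forall z : R, is_derive z 1 P (chi z).
  apply: (exists_primitive (a := a')) => // z za; apply: chi_out.
  by rewrite negb_and -leNgt za.
have iFT : area.-integrable setT (EFin \o (fun y => F (T s y) * w y)).
  exact: (integrable_mulb (integrable_hshift s iF) mw w1).
have iFw := integrable_mulb iF mw w1.
have iKw := integrable_mulb ifK mw w1.
have -> : \int[area]_y ((F (T s y) - F y - fK y) * w y) =
   \int[area]_y (F (T s y) * w y) - \int[area]_y (F y * w y) - \int[area]_y (fK y * w y).
  rewrite -RintegralB// -RintegralB//.
    by apply: eq_Rintegral => y _; ring.
  by have := integrableB measurableT iFT iFw.
have -> : \int[area]_y (F (T s y) * w y) = \int[area]_y (F y * w (T (- s) y)).
  have m2 : measurable_fun setT (fun y => (F y * w (T (- s) y))%:E).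
    apply/measurable_EFinP; exact: (measurable_funM mF (mwT (- s))).
  congr fine; apply: (etrans _ (integral_hshift s m2)); apply: eq_integral => y _.
  by rewrite /T hshiftK.
have -> : \int[area]_y (fK y * w y) = \int[area]_y (G y * ((P y.1 - P (y.1 - s)) * zeta y.2)).
  by rewrite /Rintegral aeK// (swap_k dP).
rewrite -[X in _ - X]opprK -(weak dP) opprK -RintegralB//; last first.
  exact: (integrable_mulb iF (mwT (- s)) (fun y => w1 (T (- s) y))).
rewrite -RintegralD//.
- rewrite (@eq_Rintegral _ _ _ area _ (fun=> 0)); first by rewrite Rintegral_cst// mul0r.
  by move=> y _; rewrite /w /T /hshift /= addr0; ring.
- have := integrableB measurableT (integrable_mulb iF (mwT (- s)) (fun y => w1 (T (- s) y))) iFw.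
  by [].
- have := integrableB measurableT iFw (integrable_mulb iF (mwT (- s)) (fun y => w1 (T (- s) y))).
  congr (area.-integrable setT _); apply/funext => y /=.
  by rewrite -EFinB; congr (_%:E); rewrite /w /T /hshift /= addr0; ring.
Qed.

End Test.

Let H (y : plane) : R := (F (T s y) - F y - fK y) *
  \1_(rect (x.1 - a) (x.1 + a) (x.2 - a) (x.2 + a)) y.

(** The fundamental lemma in the box turns the tested identity into one that holds almost
    everywhere. *)
Let aeH : {ae area, forall y, H y = 0}.
Proof.
apply: (@ae0_of_bump _ _ (x.1 - a) (x.1 + a) (x.2 - a) (x.2 + a)).
- have mr := measurable_rect (x.1 - a) (x.1 + a) (x.2 - a) (x.2 + a).
  have i1 := integrableB measurableT (integrable_hshift s iF) iF.
  have i2 := integrableB measurableT i1 ifK.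
  apply: (integrable_mulb (h := fun y => F (T s y) - F y - fK y) (M := 1) i2).
    exact: (measurable_indic mr).
  by move=> y; rewrite indicE ger0_norm//; case: (_ \in _).
- by move=> y yr; rewrite /H indicE memNset// mulr0.
- move=> a' b' c' d' n aA bB cC dE.
  rewrite -[RHS](weak_difference_test aA bB cC dE (smooth_bump a' b' n) (smooth_bump c' d' n)
    (@bump_out R a' b' n) (@bump_out R c' d' n) (bump2_le1 a' b' c' d' n)).
  apply: eq_Rintegral => y _.
  rewrite /H indicE; have [_|] := boolP (y \in _); first by rewrite mulr1.
  move=> /negP; rewrite inE => yr; rewrite mulr0 mul0r.
  have [y1|y1] := boolP (a' < y.1 < b'); last by rewrite (bump_out n y1) mul0r mulr0.
  have [y2|y2] := boolP (c' < y.2 < d'); last by rewrite (bump_out n y2) !mulr0.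
  exfalso; apply: yr; split=> /=; rewrite in_itv/=.
    by move: y1 => /andP[/(le_lt_trans aA) -> /lt_le_trans ->].
  by move: y2 => /andP[/(le_lt_trans cC) -> /lt_le_trans ->].
Qed.

Let J (y : plane) : \bar R := (\int[leb]_(t in S01) ((G (T t y)) ^+ 2)%:E)%E.

Let mGt y : measurable_fun setT (fun t : measurableTypeR R => G (T t y)).
Proof. exact: (measurable_fun_pair2 y (measurableT_comp mG mTT)). Qed.

(* The integral of (G - m)^2, with m the mean of G, is nonnegative. *)
Let fK_sqr y : (((fK y) ^+ 2)%:E <= s%:E * J y)%E.
Proof.
have [Joo|Joo] := ltP (J y) +oo%E; last first.
  have -> : J y = +oo%E by apply/eqP; rewrite -leye_eq.
  by rewrite gt0_muley ?lte_fin// leey.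
have m2 : measurable_fun S01 (fun t => ((G (T t y)) ^+ 2)%:E).
  apply/measurable_EFinP; apply: measurable_funTS.
  by apply: measurable_funX; exact: mGt.
have i2 : leb.-integrable S01 (EFin \o (fun t : measurableTypeR R => (G (T t y)) ^+ 2)).
  apply/integrableP; split=> //.
  rewrite (eq_integral (fun t : measurableTypeR R => ((G (T t y)) ^+ 2)%:E))// => t _.
  by rewrite /= ger0_norm// sqr_ge0.
have icst (c : R) : leb.-integrable S01 (EFin \o (fun=> c)).
  apply: continuous_compact_integrable; first exact: segment_compact.
  by apply: continuous_subspaceT => t; exact: cvg_cst.
have i1 : leb.-integrable S01 (EFin \o (fun t => G (T t y))).
  apply: (le_integrable mS _ _ (integrableD mS (icst 1) i2)).
    by apply/measurable_EFinP; apply: measurable_funTS; exact: mGt.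
  move=> t _; rewrite /= lee_fin.
  move: (G (T t y)) => z.
  rewrite [leRHS]ger0_norm ?addr_ge0 ?sqr_ge0//.
  have := sqr_ge0 (`|z| - 1); rewrite -(real_normK (num_real z)).
  by have := normr_ge0 z; nra.
have KE : fK y = \int[leb]_(t in S01) G (T t y) by [].
have -> : J y = (\int[leb]_(t in S01) (G (T t y) ^+ 2))%:E.
  by rewrite /J integral_EFin_Rintegral.
rewrite -EFinM lee_fin.
pose m := fK y / s.
have : 0 <= \int[leb]_(t in S01) (G (T t y) - m) ^+ 2.
  by apply: Rintegral_ge0 => t _; exact: sqr_ge0.
have iZ : leb.-integrable S01 (EFin \o (fun t => 2 * m * G (T t y))).
  by have := integrableZl mS (2 * m) i1.
rewrite (@eq_Rintegral _ _ _ leb _ (fun t => (G (T t y) ^+ 2 - 2 * m * G (T t y)) + m ^+ 2)); last first.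
  by move=> t _; ring.
rewrite RintegralD//; last by have := integrableB mS i2 iZ.
have cE : \int[leb]_(_ in S01) (m ^+ 2) = m ^+ 2 * s.
  by rewrite Rintegral_cst//; congr (_ * _); rewrite -[RHS]/(fine s%:E) -sS01.
rewrite RintegralB// RintegralZl// -KE cE.
set j := \int[leb]_(t in S01) _; move=> h.
have ms : m * s = fK y by rewrite /m divfK// gt_eqF.
have : 0 <= s * (j - 2 * m * fK y + m ^+ 2 * s) by rewrite mulr_ge0// ltW.
by rewrite -ms; lra.
Qed.

(** Cauchy-Schwarz on each segment costs one factor s, and Tonelli's theorem gives the other: for
    every t in [0, s] the translate of the box of half-side a lies in that of half-side a + s. *)
Lemma weak_difference_sqr :
  (\int[area]_(y in box x a) (((f \_ D) (hshift s y) - (f \_ D) y) ^+ 2)%:E <=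
   (s ^+ 2)%:E * \int[area]_(y in box x (a + s)) ((g \_ D) y ^+ 2)%:E)%E.
Proof.
have mb := @measurable_box R x a.
have mTG : measurable_fun setT (fun z : plane * measurableTypeR R => ((G (T z.2 z.1)) ^+ 2)%:E).
  by apply/measurable_EFinP; apply: measurable_funX; exact: (measurableT_comp mG mTT).
pose k3 (z : plane * measurableTypeR R) : \bar R :=
  (((G (T z.2 z.1)) ^+ 2)%:E * (\1_S01 z.2 * \1_(box x a) z.1)%:E)%E.
have mk3 : measurable_fun setT k3.
  apply: emeasurable_funM => //; apply/measurable_EFinP; apply: measurable_funM.
    by apply: (measurableT_comp (measurable_indic mS)); exact: measurable_snd.
  by apply: (measurableT_comp (measurable_indic mb)); exact: measurable_fst.
have k30 z : (0 <= k3 z)%E by rewrite mule_ge0 ?lee_fin ?sqr_ge0 ?mulr_ge0.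
have E1 : (\int[area]_(y in box x a) ((F (T s y) - F y) ^+ 2)%:E <=
    s%:E * \int[area]_y \int[leb]_t k3 (y, t))%E.
  rewrite integral_mkcond -ge0_integralZl//; last 2 first.
  - by move=> y _; exact: integral_ge0.
  - by rewrite lee_fin ltW.
  apply: ae_ge0_le_integral => //.
  - by move=> y _; rewrite erestrict_ge0// => z _; rewrite lee_fin sqr_ge0.
  - have mFF : measurable_fun setT (fun y : plane => ((F (T s y) - F y) ^+ 2)%:E).
      apply/measurable_EFinP; apply: measurable_funX; apply: measurable_funB => //.
      exact: (measurableT_comp mF (mT s)).
    exact: ((measurable_restrictT _ mb).1 (measurable_funTS mFF)).
  - by move=> y _; rewrite mule_ge0 ?lee_fin ?(ltW s0)//; exact: integral_ge0.
  - apply: emeasurable_funM => //.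
    exact: (@measurable_fun_fubini_tonelli_F _ _ _ _ R leb k3).
  apply: filterS aeH => y Hy _; rewrite patchE; case: ifPn => yb; last first.
    by rewrite mule_ge0 ?lee_fin ?(ltW s0)//; exact: integral_ge0.
  have -> : F (T s y) - F y = fK y.
    move: Hy; rewrite /H indicE mem_set ?mulr1; first by move/eqP; rewrite subr_eq0 => /eqP.
    move: yb; rewrite inE => /boxP[]; rewrite !ltr_distl => y1 y2.
    by split; rewrite /= in_itv.
  apply: le_trans (fK_sqr y) _; rewrite le_eqVlt; apply/orP; left; apply/eqP.
  congr (_ * _)%E; rewrite /J integral_mkcond; apply: eq_integral => t _.
  rewrite patchE /k3 /= !indicE yb mulr1.
  by case: (t \in S01); rewrite ?mule1 ?mule0.
  exact: (@measurable_fun_fubini_tonelli_F _ _ _ _ R leb k3).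
apply: le_trans E1 _.
rewrite expr2 EFinM -muleA; apply: lee_wpmul2l; first by rewrite lee_fin ltW.
rewrite (tonelli_area mk3 k30).
have mbs := @measurable_box R x (a + s).
pose I := (\int[area]_(y in box x (a + s)) ((G y) ^+ 2)%:E)%E.
apply: (@le_trans _ _ (\int[leb]_t ((\1_S01 t)%:E * I))%E); last first.
  rewrite integral_indicM ?sS01//.
  by apply: integral_ge0 => y _; rewrite lee_fin sqr_ge0.
apply: ge0_le_integral => //.
- by move=> t _; exact: integral_ge0.
- exact: (@measurable_fun_fubini_tonelli_G _ _ _ _ R sarea k3).
- apply: emeasurable_funM => //; apply/measurable_EFinP; exact: measurable_indic.
move=> t _; rewrite indicE; have [|tS] := boolP (t \in S01); last first.
  rewrite mul0e integral0_eq// => y _; rewrite /k3 /= indicE.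
  by rewrite (negbTE tS) mul0r mule0.
move=> tS; rewrite mul1e.
pose Q := (fun y : plane => ((G y) ^+ 2)%:E) \_ (box x (a + s)).
have mQ : measurable_fun setT Q.
  have mG2 : measurable_fun setT (fun y : plane => ((G y) ^+ 2)%:E).
    by apply/measurable_EFinP; exact: measurable_funX.
  exact: ((measurable_restrictT _ mbs).1 (measurable_funTS mG2)).
have Q0 y : (0 <= Q y)%E.
  by rewrite /Q patchE; case: ifP => // _; rewrite lee_fin sqr_ge0.
apply: (@le_trans _ _ (\int[area]_y Q (hshift t y))%E); last first.
  by rewrite integral_hshift// /Q -integral_mkcond.
apply: ge0_le_integral => //.
- exact: (measurable_fun_pair1 t mk3).
- exact: (measurableT_comp mQ (mT t)).
move=> y _; rewrite /k3 /= !indicE tS mul1r.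
have [yb|yb] := boolP (y \in box x a); last by rewrite mule0.
rewrite mule1 /Q patchE ifT//.
move: tS yb; rewrite !inE /S01 /= in_itv/= => /andP[t0 ts] /boxP[].
rewrite !ltr_distl => /andP[y1 y2] /andP[y3 y4].
apply/boxP; rewrite /hshift /= !ltr_distl addr0.
by split; apply/andP; split; move: y1 y2 y3 y4 t0 ts s0; lra.
Qed.

End WeakDifference.

End DifferenceQuotient.

Import ComplexField.

(** * Unit complex numbers *)

Section Pointwise.
Context {R : realType}.
Implicit Types (z a b m : R[i]) (q : R).
Local Notation n := Normc.normc.
Local Notation re := complex.Re.
Local Notation im := complex.Im.

Lemma normc_sqr z : n z ^+ 2 = re z ^+ 2 + im z ^+ 2.
Proof. by case: z => x y; rewrite /Normc.normc /= sqr_sqrtr// addr_ge0 ?sqr_ge0. Qed.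

Lemma normc_ge0 z : 0 <= n z.
Proof. by case: z => x y; exact: sqrtr_ge0. Qed.

Lemma normcV z : n z^-1 = (n z)^-1.
Proof. exact: Normc.normcV. Qed.

Lemma normc_conj z : n (conjc z) = n z.
Proof. by case: z => x y; rewrite /Normc.normc /= sqrrN. Qed.

Definition cis q : R[i] := (cos q +i* sin q)%C.

Lemma cisD p q : cis (p + q) = cis p * cis q.
Proof. by rewrite /cis cosD sinD; apply/eqP; rewrite eq_complex /= eqxx /= addrC. Qed.

Lemma normc_cis q : n (cis q) = 1.
Proof. by rewrite /cis /Normc.normc /= cos2Dsin2 sqrtr1. Qed.

Lemma conj_cis q : conjc (cis q) = cis (- q).
Proof. by rewrite /cis cosN sinN. Qed.

Lemma normcD a b : n (a + b) <= n a + n b.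
Proof.
have := normc_sqr a; have := normc_sqr b; have := normc_sqr (a + b).
have := normc_ge0 a; have := normc_ge0 b; have := normc_ge0 (a + b).
move: (n a) (n b) (n (a + b)); case: a => a1 a2; case: b => b1 b2 /= p q r r0 q0 p0 Er Eq Ep.
rewrite leNgt; apply/negP => h.
have h1 : (p + q) ^+ 2 < r ^+ 2 by rewrite ltrXn2r// ?nnegrE ?addr_ge0.
have h2 : p * q < a1 * b1 + a2 * b2 by nra.
have pq0 : 0 <= p * q by rewrite mulr_ge0.
have h3 : (p * q) ^+ 2 < (a1 * b1 + a2 * b2) ^+ 2.
  by rewrite ltrXn2r// ?nnegrE// (le_trans pq0)// ltW.
have h4 := sqr_ge0 (a1 * b2 - a2 * b1).
by rewrite exprMn Eq Ep in h3; nra.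
Qed.

Lemma normcN a : n (- a) = n a.
Proof. by case: a => x y; rewrite /Normc.normc /= !sqrrN. Qed.

Lemma normcB a b : n (a - b) = n (b - a).
Proof. by rewrite -normcN opprB. Qed.

Lemma normc_unit_conj z : n z = 1 -> conjc z * z = 1.
Proof.
move=> z1; have := normc_sqr z; rewrite z1 expr1n; case: z {z1} => x y /= h.
by apply/eqP; rewrite eq_complex /=; apply/andP; split; apply/eqP; [rewrite h|]; ring.
Qed.

Lemma normc_im z : `|im z| <= n z.
Proof.
rewrite -(ler_pXn2r (n := 2))// ?nnegrE ?normc_ge0// real_normK ?num_real//.
by rewrite normc_sqr lerDr sqr_ge0.
Qed.

Lemma parallelogram a b m :
  n (b - a) ^+ 2 + n (b - 2 * m + a) ^+ 2 = 2 * (n (m - a) ^+ 2 + n (b - m) ^+ 2).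
Proof.
rewrite !normc_sqr; case: a b m => a1 a2 [b1 b2] [m1 m2] /=.
by ring.
Qed.

(* If b + a is close to 2 m with |a| = |b| = |m| = 1, then by strict convexity
   of the disk a is close to b. *)
Lemma strict_convexity a b m : n a = 1 -> n b = 1 -> n m = 1 ->
  n (b - a) ^+ 4 <= 16 * n (b - 2 * m + a) ^+ 2.
Proof.
move=> a1 b1 m1.
have ab : n (b - a) ^+ 2 + n (b + a) ^+ 2 = 4.
  have := parallelogram a b 0; rewrite mulr0 !subr0 sub0r normcN a1 b1 => ->.
  by ring.
have t : 2 <= n (b - 2 * m + a) + n (b + a).
  have e2 : n (2 * m) = 2.
    rewrite Normc.normcM m1 mulr1.
    have := normc_sqr 2; rewrite /= => h; apply/eqP.
    by rewrite -(eqrXn2 (n := 2))// ?normc_ge0// h/=; apply/eqP; ring.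
  have e : 2 * m = - (b - 2 * m + a) + (b + a) by ring.
  by rewrite -{1}e2 {1}e (le_trans (normcD _ _))// normcN.
have := normc_ge0 (b + a); have := normc_ge0 (b - 2 * m + a); have := sqr_ge0 (n (b - a)).
move: ab t; rewrite (exprM (n (b - a)) 2 2).
move: (n (b - a) ^+ 2) (n (b - 2 * m + a)) (n (b + a)) => X d S XS dS X0 d0 S0.
have XE : X = (2 - S) * (2 + S) by rewrite -[LHS](addrK (S ^+ 2)) XS; ring.
have S2 : S <= 2 by nra.
have h1 : (2 - S) ^+ 2 <= d ^+ 2 by rewrite ler_pXn2r// ?nnegrE; lra.
have h2 : (2 + S) ^+ 2 <= 16 by nra.
by rewrite XE exprMn mulrC ler_pM ?sqr_ge0.
Qed.

(** For a unit number, Re a = 1 - |a - 1|^2 / 2. Hence the imaginary part turns products into sums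
    up to third order, with no quadratic error. *)
Lemma im_mul_cubic a b : n a = 1 -> n b = 1 ->
  `|im (a * b) - im a - im b| <= 2^-1 * (n (a - 1) * n (b - 1) * (n (a - 1) + n (b - 1))).
Proof.
move=> a1 b1.
have ra : re a = 1 - n (a - 1) ^+ 2 / 2.
  have := normc_sqr a; rewrite a1 expr1n normc_sqr; case: (a) => x y /= h; nra.
have rb : re b = 1 - n (b - 1) ^+ 2 / 2.
  have := normc_sqr b; rewrite b1 expr1n normc_sqr; case: (b) => x y /= h; nra.
have ia : `|im a| <= n (a - 1).
  by have := normc_im (a - 1); case: (a) => x y /=; rewrite subr0.
have ib : `|im b| <= n (b - 1).
  by have := normc_im (b - 1); case: (b) => x y /=; rewrite subr0.
have -> : im (a * b) - im a - im b =
   - (2^-1 * (im a * n (b - 1) ^+ 2 + im b * n (a - 1) ^+ 2)).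
  have -> : im (a * b) = re a * im b + im a * re b by case: (a) (b) => ? ? [].
  by rewrite ra rb; ring.
rewrite normrN normrM ger0_norm ?invr_ge0// ler_wpM2l ?invr_ge0//.
rewrite (le_trans (ler_normD _ _))// (normrM (im a)) (normrM (im b)).
rewrite (ger0_norm (sqr_ge0 (n (a - 1)))) (ger0_norm (sqr_ge0 (n (b - 1)))).
have := normc_ge0 (a - 1); have := normc_ge0 (b - 1).
move: (n (a - 1)) (n (b - 1)) ia ib => p q ia ib q0 p0.
have h1 : `|im a| * q ^+ 2 <= p * q ^+ 2 by rewrite ler_wpM2r ?sqr_ge0.
have h2 : `|im b| * p ^+ 2 <= q * p ^+ 2 by rewrite ler_wpM2r ?sqr_ge0.
by apply: le_trans (lerD h1 h2) _; rewrite le_eqVlt; apply/orP; left; apply/eqP; ring.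
Qed.

Lemma normc_mulB1 a b : n a = 1 -> n (a * b - 1) <= n (a - 1) + n (b - 1).
Proof.
move=> a1; have -> : a * b - 1 = (a - 1) + a * (b - 1) by ring.
by rewrite (le_trans (normcD _ _))// Normc.normcM a1 mul1r.
Qed.

Lemma cube_sum (p q r t : R) : 0 <= p -> 0 <= q -> 0 <= r -> 0 <= t ->
  (p + q + r + t) ^+ 3 <= 16 * (p ^+ 3 + q ^+ 3 + r ^+ 3 + t ^+ 3).
Proof.
move=> p0 q0 r0 t0.
have h (x y : R) : 0 <= x -> 0 <= y -> (x + y) ^+ 3 <= 4 * (x ^+ 3 + y ^+ 3).
  move=> x0 y0; have : 0 <= 3 * (x + y) * (x - y) ^+ 2 by rewrite mulr_ge0 ?sqr_ge0// mulr_ge0// addr_ge0.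
  by nra.
have h1 := h _ _ (addr_ge0 p0 q0) (addr_ge0 r0 t0).
have h2 := h _ _ p0 q0; have h3 := h _ _ r0 t0.
by rewrite -addrA; lra.
Qed.

(** Grouping the factors in pairs, the three errors add up to at most half of the cube of the sum of
    the four distances to 1; [cube_sum] has the constant 16, whence 8. *)
Lemma im_mul4_cubic a b c d : n a = 1 -> n b = 1 -> n c = 1 -> n d = 1 ->
  `|im (a * b * (c * d)) - (im a + im b + im c + im d)| <=
  8 * (n (a - 1) ^+ 3 + n (b - 1) ^+ 3 + n (c - 1) ^+ 3 + n (d - 1) ^+ 3).
Proof.
move=> a1 b1 c1 d1.
have nab : n (a * b) = 1 by rewrite Normc.normcM a1 b1 mul1r.
have ncd : n (c * d) = 1 by rewrite Normc.normcM c1 d1 mul1r.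
have h1 := im_mul_cubic nab ncd.
have h2 := im_mul_cubic a1 b1; have h3 := im_mul_cubic c1 d1.
have k1 := normc_mulB1 b a1; have k2 := normc_mulB1 d c1.
have := cube_sum (normc_ge0 (a - 1)) (normc_ge0 (b - 1)) (normc_ge0 (c - 1)) (normc_ge0 (d - 1)).
have := normc_ge0 (a - 1); have := normc_ge0 (b - 1); have := normc_ge0 (c - 1); have := normc_ge0 (d - 1).
have := normc_ge0 (a * b - 1); have := normc_ge0 (c * d - 1).
move: h1 h2 h3 k1 k2; move: (n (a - 1)) (n (b - 1)) (n (c - 1)) (n (d - 1)) (n (a * b - 1)) (n (c * d - 1)).
move=> p q r t P Q h1 h2 h3 k1 k2 Q0 P0 t0 r0 q0 p0 cube.
have l1 : 2^-1 * (P * Q * (P + Q)) <= 2^-1 * ((p + q) * (r + t) * (p + q + (r + t))).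
  rewrite ler_wpM2l ?invr_ge0// ler_pM ?mulr_ge0 ?addr_ge0// ?lerD//.
  by rewrite ler_pM.
have -> : im (a * b * (c * d)) - (im a + im b + im c + im d) =
  (im (a * b * (c * d)) - im (a * b) - im (c * d)) + (im (a * b) - im a - im b)
   + (im (c * d) - im c - im d) by ring.
rewrite (le_trans (ler_normD _ _))// (le_trans (lerD (ler_normD _ _) (lexx _)))//.
apply: le_trans (lerD (lerD (le_trans h1 l1) h2) h3) _.
have e : 0 <= (p + q + r + t) ^+ 3 - (p + q) * (r + t) * (p + q + (r + t)) - p * q * (p + q) - r * t * (r + t).
  have -> : (p + q + r + t) ^+ 3 - (p + q) * (r + t) * (p + q + (r + t)) - p * q * (p + q) - r * t * (r + t) =
   2 * (p + q) * (r + t) * (p + q + (r + t)) + (p ^+ 3 + 2 * p * q * (p + q) + q ^+ 3) + (r ^+ 3 + 2 * r * t * (r + t) + t ^+ 3) by ring.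
  by rewrite !(addr_ge0, mulr_ge0, exprn_ge0).
by lra.
Qed.

(* The junk value z / 0 = 0 is replaced by 1. *)
Definition unitc z : R[i] := if z == 0 then 1 else ((n z)^-1)%:C%C * z.

Lemma normc_real (r : R) : n (r%:C)%C = `|r|.
Proof. by rewrite /Normc.normc /= expr0n/= addr0 sqrtr_sqr. Qed.

Lemma normc_unitc z : n (unitc z) = 1.
Proof.
rewrite /unitc; case: eqVneq => [_|z0]; first by rewrite Normc.normc1.
rewrite Normc.normcM normc_real ger0_norm ?invr_ge0 ?normc_ge0// mulVf//.
by apply: contra_neq z0; exact: Normc.eq0_normc.
Qed.

(** The distance is |1 - |z||, and |1 - |z|| <= 1 + |z|. Thus replacing a function by its phase
    costs, in squared L^2 norm, only the L^1 norm of 1 - |u|^2. *)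
Lemma unitc_sub z : n (unitc z - z) ^+ 2 <= `|1 - n z ^+ 2|.
Proof.
have E : n (unitc z - z) = `|1 - n z|.
  rewrite /unitc; case: eqVneq => [->|z0].
    by rewrite subr0 Normc.normc0 subr0 Normc.normc1 normr1.
  have nz0 : n z != 0 by apply: contra_neq z0; exact: Normc.eq0_normc.
  have -> : ((n z)^-1)%:C%C * z - z = (((n z)^-1 - 1)%:C)%C * z.
    by case: (z) => x y; apply/eqP; rewrite eq_complex /=; apply/andP; split; apply/eqP; ring.
  rewrite Normc.normcM normc_real -{2}(ger0_norm (normc_ge0 z)) -normrM mulrBl mulVf//.
  by rewrite mul1r.
rewrite E; have -> : 1 - n z ^+ 2 = (1 - n z) * (1 + n z) by ring.
rewrite normrM expr2 ler_wpM2l//; have := normc_ge0 z.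
by move=> z0; rewrite [leRHS]ger0_norm ?addr_ge0// ler_norml; apply/andP; split; lra.
Qed.

Lemma normc_sqr_add3 a b c : n (a + b + c) ^+ 2 <= 3 * (n a ^+ 2 + n b ^+ 2 + n c ^+ 2).
Proof.
rewrite !normc_sqr; case: a b c => a1 a2 [b1 b2] [c1 c2] /=.
have := sqr_ge0 (a1 - b1); have := sqr_ge0 (a1 - c1); have := sqr_ge0 (b1 - c1).
have := sqr_ge0 (a2 - b2); have := sqr_ge0 (a2 - c2); have := sqr_ge0 (b2 - c2).
by nra.
Qed.

Lemma normc_sqr_second a b m d : 
  n (d + (b - 2 * m + a)) ^+ 2 <= 2 * n d ^+ 2 + 8 * (n b ^+ 2 + 2 * n m ^+ 2 + n a ^+ 2).
Proof.
rewrite !normc_sqr; case: a b m d => a1 a2 [b1 b2] [m1 m2] [d1 d2] /=.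
have h (x y z : R) : (x - 2 * y + z) ^+ 2 <= 4 * (x ^+ 2 + 2 * y ^+ 2 + z ^+ 2).
  have := sqr_ge0 (x + y); have := sqr_ge0 (y + z); have := sqr_ge0 (x - z); nra.
have h1 := h b1 m1 a1; have h2 := h b2 m2 a2.
have k (x y : R) : (x + y) ^+ 2 <= 2 * x ^+ 2 + 2 * y ^+ 2.
  by have := sqr_ge0 (x - y); nra.
have k1 := k d1 (b1 - 2 * m1 + a1); have k2 := k d2 (b2 - 2 * m2 + a2).
by move: h1 h2 k1 k2; rewrite !(mul0r, addr0, subr0); lra.
Qed.

(** The ratio of b to a after transport, p being the increment of the gauge phase between the two
    points. For unit numbers it is 1 when b is the parallel transport of a. *)
Definition ratio (p : R) (a b : R[i]) : R[i] := conjc a * (cis p * b).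

Lemma normc_ratio p a b : n a = 1 -> n b = 1 -> n (ratio p a b) = 1.
Proof. by move=> a1 b1; rewrite /ratio !Normc.normcM normc_conj normc_cis a1 b1 !mulr1. Qed.

(* Holonomy of the connection around a square: the four transported ratios
   multiply to exp(-2 i q), whence the sum of their imaginary parts is
   - sin (2 q) up to cubic errors. *)
Lemma plaquette (v00 v10 v01 v11 f1 f2 g1 g2 : R[i]) (q00 q10 q01 q11 q : R) :
  n v00 = 1 -> n v10 = 1 -> n v01 = 1 -> n v11 = 1 ->
  q00 + q11 - q10 - q01 = q ->
  f1 = ratio (q10 - q00) v00 v10 ->
  f2 = ratio (q10 - q11) v10 v11 ->
  g1 = ratio (q11 - q01) v01 v11 ->
  g2 = ratio (q00 - q01) v00 v01 ->
  sin (2 * q) <= - (im f1 + im f2 - im g1 - im g2) +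
    8 * (n (f1 - 1) ^+ 3 + n (f2 - 1) ^+ 3 + n (g1 - 1) ^+ 3 + n (g2 - 1) ^+ 3).
Proof.
move=> u00 u10 u01 u11 qE f1E f2E g1E g2E.
have conjM (a b : R[i]) : conjc (a * b) = conjc a * conjc b.
  by case: a b => a1 a2 [b1 b2]; apply/eqP; rewrite eq_complex /=; apply/andP; split; apply/eqP; ring.
have imC (z : R[i]) : im (conjc z) = - im z by case: z.
have nC (z : R[i]) : n (conjc z - 1) = n (z - 1).
  by rewrite -[RHS]normc_conj; congr n; case: z => x y; apply/eqP; rewrite eq_complex /=;
  apply/andP; split; apply/eqP; ring.
have n1 : n f1 = 1 by rewrite f1E; exact: normc_ratio.
have n2 : n f2 = 1 by rewrite f2E; exact: normc_ratio.
have n3 : n (conjc g1) = 1 by rewrite normc_conj ?g1E ?g2E; exact: normc_ratio.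
have n4 : n (conjc g2) = 1 by rewrite normc_conj ?g1E ?g2E; exact: normc_ratio.
have := im_mul4_cubic n1 n2 n3 n4; rewrite !imC !nC.
have -> : f1 * f2 * (conjc g1 * conjc g2) = cis (- (2 * q)).
  rewrite f1E f2E g1E g2E /ratio !conjM !conj_cis !conjcK.
  have -> : - (2 * q) = (q10 - q00) + (q10 - q11) + ((q01 - q11) + (q01 - q00)).
    by rewrite -qE; ring.
  rewrite !opprB !cisD.
  move: (normc_unit_conj u00) (normc_unit_conj u10) (normc_unit_conj u01) (normc_unit_conj u11).
  move: (conjc v00) (conjc v10) (conjc v01) (conjc v11) => w00 w10 w01 w11 e00 e10 e01 e11.
  move: (cis q10) (cis (- q00)) (cis (- q11)) (cis q01) => k1 k2 k3 k4.
  transitivity ((w00 * v00) * (w10 * v10) * (w01 * v01) * (w11 * v11) * (k1 * k2 * (k1 * k3) * (k4 * k3 * (k4 * k2)))).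
    by ring.
  by rewrite e00 e10 e01 e11 !mul1r.
rewrite /cis /= sinN => /ler_normlP[]; lra.
Qed.

End Pointwise.

(** * Integrals over boxes *)

Section BoxIntegrals.
Context {R : realType}.
Local Notation plane := (measurableTypeR R * measurableTypeR R)%type.
Implicit Types (h g : plane -> R) (x v : R * R) (a s : R).

Lemma box_lty x a : (area (box x a) < +oo)%E.
Proof.
have [a0|a0] := leP 0 a; first by rewrite area_box// ltry.
rewrite (_ : box x a = set0) ?measure0//.
by apply/seteqP; split=> // y /boxP[]; have := normr_ge0 (y.1 - x.1); lra.
Qed.

Lemma box_subset x a b : a <= b -> box x a `<=` box x b.
Proof. by move=> ab y /boxP[y1 y2]; apply/boxP; split; exact: lt_le_trans ab. Qed.

Lemma box_shift x a s v y : `|v.1| <= s -> `|v.2| <= s ->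
  box x a y -> box x (a + s) (y + v).
Proof.
move=> v1 v2 /boxP[y1 y2]; apply/boxP; split=> /=.
  by rewrite addrAC (le_lt_trans (ler_normD _ _))// ltr_leD.
by rewrite addrAC (le_lt_trans (ler_normD _ _))// ltr_leD.
Qed.

Lemma integrable_box h x a (M : R) : measurable_fun setT h ->
  (forall y, `|h y| <= M) -> area.-integrable (box x a) (EFin \o h).
Proof.
move=> mh hM; apply: measurable_bounded_integrable.
- exact: measurable_box.
- exact: box_lty.
- exact: measurable_funTS.
- exists M; split; first exact: num_real.
  by move=> N MN y _ /=; exact: le_trans (hM y) (ltW MN).
Qed.

Lemma integrableTS h (A : set plane) : measurable A ->
  area.-integrable setT (EFin \o h) -> area.-integrable A (EFin \o h).
Proof. by move=> mA; exact: integrableS. Qed.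

Lemma integrable_patch h (A : set plane) : measurable A ->
  area.-integrable A (EFin \o h) -> area.-integrable setT (EFin \o (h \_ A)).
Proof. by move=> mA /(integrable_mkcond _ mA); rewrite restrict_EFin. Qed.

Lemma le_Rintegral_subset h (A B : set plane) : measurable A -> measurable B ->
  A `<=` B -> (forall y, 0 <= h y) -> area.-integrable B (EFin \o h) ->
  \int[area]_(y in A) h y <= \int[area]_(y in B) h y.
Proof.
move=> mA mB AB h0 ih.
have iA : area.-integrable A (EFin \o h) by exact: (integrableS mB).
rewrite -lee_fin -!integral_EFin_Rintegral//.
apply: ge0_subset_integral => //.
- by apply: (measurable_int area); exact: ih.
- by move=> y _; rewrite lee_fin.
Qed.

(** Cutting [h] off outside the larger box makes it integrable on the plane, so that translation
    invariance applies; the smaller box is shifted into the larger one. *)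
Lemma Rintegral_box_shift h x a s v : `|v.1| <= s -> `|v.2| <= s ->
  (forall y, 0 <= h y) -> measurable_fun setT h ->
  area.-integrable (box x (a + s)) (EFin \o h) ->
  area.-integrable (box x a) (EFin \o (fun y => h (y + v))) /\
  \int[area]_(y in box x a) h (y + v) <= \int[area]_(y in box x (a + s)) h y.
Proof.
move=> v1 v2 h0 mh ih.
pose g := h \_ (box x (a + s)).
have mB := @measurable_box R x (a + s); have mA := @measurable_box R x a.
have ig : area.-integrable setT (EFin \o g) by exact: integrable_patch.
have igv := integrable_shift v ig.
have g0 y : 0 <= g y by rewrite /g patchE; case: ifP.
have gE y : box x a y -> h (y + v) = g (y + v).
  by move=> yA; rewrite /g patchE ifT// inE; exact: box_shift.
have iA : area.-integrable (box x a) (EFin \o (fun y => h (y + v))).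
  apply: (eq_integrable mA (EFin \o (fun y => g (y + v)))); last exact: integrableTS.
  by move=> y /[!inE] yA /=; rewrite gE.
split=> //.
rewrite (@eq_Rintegral _ _ _ area _ (fun y => g (y + v))); last first.
  by move=> y /[!inE]; exact: gE.
rewrite [leRHS]Rintegral_mkcond -/g.
have mg : measurable_fun setT (EFin \o g) by exact: measurable_int ig.
have -> : \int[area]_y g y = \int[area]_y g (y + v).
  by rewrite /Rintegral; congr fine; rewrite -(integral_shift v mg).
exact: le_Rintegral_subset.
Qed.

Lemma Rintegral_box_cst x a (c : R) : 0 <= a ->
  \int[area]_(y in box x a) c = c * (2 * a) ^+ 2.
Proof. by move=> a0; rewrite Rintegral_cst ?area_box//; exact: measurable_box. Qed.

(** A cut-off with Lipschitz constant 1 / a for the sup norm. Unlike the indicator of the box, it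
    changes by at most s / a under a translation by s. *)
Definition tent x a (y : plane) : R := Num.max 0 (1 - Num.max `|y.1 - x.1| `|y.2 - x.2| / a).

Lemma tent_ge0 x a y : 0 <= tent x a y.
Proof. by rewrite /tent le_max lexx. Qed.

Lemma tent_le1 x a y : 0 < a -> tent x a y <= 1.
Proof.
move=> a0; by rewrite /tent ge_max ler01 gerBl divr_ge0 ?(ltW a0)// le_max normr_ge0.
Qed.

Lemma tent_out x a y : 0 < a -> ~ box x a y -> tent x a y = 0.
Proof.
move=> a0 yB; apply/max_idPl; rewrite subr_le0 ler_pdivlMr// mul1r leNgt gt_max.
by apply/negP => /andP[h1 h2]; apply: yB; apply/boxP.
Qed.

Lemma tent_ge_half x a y : 0 < a -> box x (a / 2) y -> 2^-1 <= tent x a y.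
Proof.
move=> a0 /boxP[y1 y2]; rewrite /tent le_max; apply/orP; right.
rewrite lerBrDr -lerBrDl ler_pdivrMr// ge_max.
have -> : (1 - 2^-1) * a = a / 2 by field.
by rewrite (ltW y1) (ltW y2).
Qed.

Lemma tent_lip x a s v y : 0 < a -> `|v.1| <= s -> `|v.2| <= s ->
  `|tent x a (y - v) - tent x a y| <= s / a.
Proof.
move=> a0 v1 v2.
have maxl (b c d e t : R) : `|b - c| <= t -> `|d - e| <= t -> `|Num.max b d - Num.max c e| <= t.
  rewrite !ler_distl => /andP[h1 h2] /andP[h3 h4].
  by case: (leP b d) => bd; case: (leP c e) => ce; apply/andP; split; lra.
have s0 : 0 <= s by exact: le_trans v1.
apply: (maxl); first by rewrite subrr normr0 divr_ge0// ltW.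
set p := Num.max _ _; set q := Num.max _ _.
have pq : `|q - p| <= s.
  apply: (maxl) => /=.
    by apply: le_trans (ler_dist_dist _ _) _; rewrite [X in `|X|](_ : _ = v.1)//; ring.
  by apply: le_trans (ler_dist_dist _ _) _; rewrite [X in `|X|](_ : _ = v.2)//; ring.
have -> : 1 - p / a - (1 - q / a) = (q - p) / a by ring.
by rewrite normrM normfV (gtr0_norm a0) ler_wpM2r ?invr_ge0 ?(ltW a0).
Qed.

Lemma measurable_tent x a : measurable_fun setT (tent x a).
Proof.
apply: measurable_maxr => //; apply: measurable_funB => //.
apply: measurable_funM => //; apply: measurable_maxr.
  apply: measurableT_comp => //; apply: measurable_funB => //.
apply: measurableT_comp => //; apply: measurable_funB => //.
Qed.

Lemma integral_tent_ge x a : 0 < a -> a ^+ 2 / 2 <= \int[area]_(y in box x a) tent x a y.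
Proof.
move=> a0.
have -> : a ^+ 2 / 2 = \int[area]_(y in box x (a / 2)) 2^-1.
  by rewrite Rintegral_box_cst ?divr_ge0 ?(ltW a0)//; field.
have ib (b : R) : area.-integrable (box x b) (EFin \o tent x a).
  apply: (@integrable_box _ _ _ 1); first exact: measurable_tent.
  by move=> y; rewrite ger0_norm ?tent_ge0// tent_le1.
apply: (@le_trans _ _ (\int[area]_(y in box x (a / 2)) tent x a y)).
  apply: le_Rintegral => //; first exact: measurable_box.
    by apply: (@integrable_box _ _ _ 2^-1) => // y; rewrite ger0_norm ?invr_ge0.
  by move=> y; exact: tent_ge_half.
apply: le_Rintegral_subset => //; try exact: measurable_box.
  by apply: box_subset; lra.
by move=> y; exact: tent_ge0.
Qed.

(* Discrete integration by parts: the increment falls on the tent. *)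
Lemma tent_by_parts h x a s v (M : R) : 0 < a -> `|v.1| <= s -> `|v.2| <= s ->
  measurable_fun setT h -> (forall y, `|h y| <= M) ->
  \int[area]_(y in box x a) (tent x a y * (h (y + v) - h y)) <=
  s / a * \int[area]_(y in box x (a + s)) `|h y|.
Proof.
move=> a0 v1 v2 mh hM.
have s0 : 0 <= s by exact: le_trans v1.
have mt := measurable_tent x a.
have tb y : `|tent x a y| <= 1 by rewrite ger0_norm ?tent_ge0// tent_le1.
have it b : area.-integrable (box x b) (EFin \o tent x a) by exact: (integrable_box _ _ mt tb).
have M0 : 0 <= M by exact: le_trans (normr_ge0 _) (hM x).
have itT : area.-integrable setT (EFin \o tent x a).
  have := integrable_patch (measurable_box x a) (it a).
  congr (area.-integrable setT (EFin \o _)); apply/funext => y.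
  rewrite patchE; case: ifPn => // /negP; rewrite inE => yB.
  by rewrite tent_out.
have mhv w : measurable_fun setT (fun y : plane => h (y + w)).
  exact: (measurableT_comp mh (measurable_shift w)).
have i1 : area.-integrable setT (EFin \o (fun y => tent x a y * h (y + v))).
  exact: (integrable_mulb itT (mhv v) (fun y => hM (y + v))).
have i2 : area.-integrable setT (EFin \o (fun y => tent x a y * h y)).
  exact: (integrable_mulb itT mh hM).
have itv : area.-integrable setT (EFin \o (fun y => tent x a (y - v))).
  exact: (integrable_shift (- v) itT).
have i3 : area.-integrable setT (EFin \o (fun y => tent x a (y - v) * h y)).
  exact: (integrable_mulb itv mh hM).
have -> : \int[area]_(y in box x a) (tent x a y * (h (y + v) - h y)) =
   \int[area]_y ((tent x a (y - v) - tent x a y) * h y).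
  transitivity (\int[area]_y (tent x a y * h (y + v) - tent x a y * h y)).
    rewrite Rintegral_mkcond; apply: eq_Rintegral => y _; rewrite patchE.
    case: ifPn => [_|/negP]; first by ring.
    by rewrite inE => yB; rewrite tent_out// !mul0r subrr.
  rewrite RintegralB//.
  have -> : \int[area]_y (tent x a y * h (y + v)) = \int[area]_y (tent x a (y - v) * h y).
    have m3 : measurable_fun setT (EFin \o (fun y => tent x a (y - v) * h y)).
      exact: measurable_int i3.
    rewrite /Rintegral -(integral_shift v m3); congr fine; apply: eq_integral => y _ /=.
    by rewrite addrK.
  rewrite -RintegralB//; apply: eq_Rintegral => y _; ring.
have ih : area.-integrable (box x (a + s)) (EFin \o (fun y => `|h y|)).
  apply: (@integrable_box _ _ _ M); first exact: measurableT_comp.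
  by move=> y; rewrite normr_id.
rewrite -RintegralZl//; last exact: measurable_box.
rewrite [leRHS]Rintegral_mkcond; apply: le_Rintegral => //.
- have := integrableB measurableT i3 i2.
  by congr (area.-integrable setT _); apply/funext => y /=; rewrite -EFinB mulrBl.
- apply: integrable_patch; first exact: measurable_box.
  by have := integrableZl (measurable_box x (a + s)) (s / a) ih.
move=> y _; rewrite patchE; case: ifPn => [_|/negP].
  apply: le_trans (ler_norm _) _; rewrite normrM ler_wpM2r//.
  exact: tent_lip.
rewrite inE => yB; rewrite !tent_out// ?subrr ?mul0r//.
  by move=> yA; apply: yB; apply: box_subset yA; lra.
move=> yA; apply: yB; rewrite -[y](subrK v); exact: box_shift.
Qed.

End BoxIntegrals.

(** * Phase rigidity at small scales *)

Section Core.
Context {R : realType}.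
Local Notation plane := (measurableTypeR R * measurableTypeR R)%type.
Local Notation n := Normc.normc.
Local Notation re := complex.Re.
Local Notation im := complex.Im.
Implicit Types (u v w : plane -> R[i]) (x e : R * R) (a s : R).

Definition cmeas u : Prop := measurable_fun setT (fun y => re (u y)) /\
  measurable_fun setT (fun y => im (u y)).

Lemma cmeas_normc_sqr u : cmeas u -> measurable_fun setT (fun y => n (u y) ^+ 2).
Proof.
move=> [mr mi]; under eq_fun do rewrite normc_sqr.
by apply: measurable_funD; exact: measurable_funX.
Qed.

Lemma cmeas_normc u : cmeas u -> measurable_fun setT (fun y => n (u y)).
Proof.
move=> mu; have -> : (fun y => n (u y)) = (fun y => Num.sqrt (n (u y) ^+ 2)).
  by apply/funext => y; rewrite sqrtr_sqr ger0_norm// normc_ge0.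
exact: (measurableT_comp (continuous_measurable_fun (@sqrt_continuous R)) (cmeas_normc_sqr mu)).
Qed.

Lemma cmeas_shift u (h : R * R) : cmeas u -> cmeas (fun y => u (y + h)).
Proof.
move=> [mr mi]; split.
  exact: (measurableT_comp mr (measurable_shift h)).
exact: (measurableT_comp mi (measurable_shift h)).
Qed.

Lemma cmeasD u w : cmeas u -> cmeas w -> cmeas (fun y => u y + w y).
Proof.
move=> [mr mi] [mr' mi']; split.
  have := measurable_funD mr mr'; congr (measurable_fun setT _).
  by apply/funext => y /=; case: (u y) => ? ?; case: (w y).
have := measurable_funD mi mi'; congr (measurable_fun setT _).
by apply/funext => y /=; case: (u y) => ? ?; case: (w y).
Qed.

Lemma cmeasN u : cmeas u -> cmeas (fun y => - u y).
Proof.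
move=> [mr mi]; split.
  have := measurableT_comp (@oppr_measurable R setT) mr; congr (measurable_fun setT _).
  by apply/funext => y /=; case: (u y).
have := measurableT_comp (@oppr_measurable R setT) mi; congr (measurable_fun setT _).
by apply/funext => y /=; case: (u y).
Qed.

Lemma cmeasB u w : cmeas u -> cmeas w -> cmeas (fun y => u y - w y).
Proof. by move=> mu mw; apply: cmeasD => //; exact: cmeasN. Qed.

Lemma cmeasM u w : cmeas u -> cmeas w -> cmeas (fun y => u y * w y).
Proof.
move=> [mr mi] [mr' mi']; split.
  have := measurable_funB (measurable_funM mr mr') (measurable_funM mi mi').
  congr (measurable_fun setT _).
  by apply/funext => y /=; case: (u y) => ? ?; case: (w y).
have := measurable_funD (measurable_funM mr mi') (measurable_funM mi mr').
congr (measurable_fun setT _).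
by apply/funext => y /=; case: (u y) => ? ?; case: (w y).
Qed.

Lemma cmeas_cst (c : R[i]) : cmeas (fun=> c).
Proof. by split; exact: measurable_cst. Qed.

Lemma cmeas_conj u : cmeas u -> cmeas (fun y => conjc (u y)).
Proof.
move=> [mr mi]; split.
  by move: mr; congr (measurable_fun setT _); apply/funext => y; case: (u y).
have := measurableT_comp (@oppr_measurable R setT) mi; congr (measurable_fun setT _).
by apply/funext => y /=; case: (u y).
Qed.

Lemma cmeas_cis (q : plane -> R) : measurable_fun setT q -> cmeas (fun y => cis (q y)).
Proof.
move=> mq; split => /=.
  exact: (measurableT_comp (continuous_measurable_fun (@continuous_cos R)) mq).
exact: (measurableT_comp (continuous_measurable_fun (@continuous_sin R)) mq).
Qed.

Lemma cmeas_unitc u : cmeas u -> cmeas (fun y => unitc (u y)).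
Proof.
move=> mu; have mn := cmeas_normc mu.
have m0 : measurable (u @^-1` [set 0]).
  rewrite (_ : _ @^-1` _ = (fun y => n (u y)) @^-1` [set 0]).
    by rewrite -[X in measurable X]setTI; exact: mn.
  apply/seteqP; split=> y /=; first by move=> ->; exact: Normc.normc0.
  exact: Normc.eq0_normc.
have mV : measurable_fun setT (fun y => (n (u y))^-1).
  have := measurableT_comp (@measurable_powR R (-1)) mn.
  by congr (measurable_fun setT _); apply/funext => y /=; rewrite powR_inv1// normc_ge0.
have uE y : unitc (u y) = (((n (u y))^-1)%:C)%C * u y + (\1_(u @^-1` [set 0]) y)%:C%C.
  rewrite /unitc indicE; have [u0|u0] := eqVneq (u y) 0.
    by rewrite u0 mulr0 add0r mem_set.
  by rewrite memNset ?addr0//=; exact/eqP.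
have [mr mi] := mu; split.
  have := measurable_funD (measurable_funM mV mr) (measurable_indic m0).
  congr (measurable_fun setT _); apply/funext => y /=; rewrite uE; case: (u y) => p q /=.
  by rewrite mul0r subr0.
have := measurable_funM mV mi; congr (measurable_fun setT _).
by apply/funext => y /=; rewrite uE; case: (u y) => p q /=; rewrite mul0r !addr0.
Qed.

Definition sqi u : Prop :=
  cmeas u /\ area.-integrable setT (EFin \o (fun y => n (u y) ^+ 2)).

Lemma sqi_le u w (c : R) : cmeas u -> sqi w -> (forall y, n (u y) ^+ 2 <= c * n (w y) ^+ 2) -> sqi u.
Proof.
move=> mu [mw iw] H; split=> //.
have icw := integrableZl measurableT c iw.
apply: (le_integrable measurableT _ _ icw).
  by apply/measurable_EFinP; exact: cmeas_normc_sqr.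
move=> y _; rewrite /= lee_fin ger0_norm ?sqr_ge0//.
exact: le_trans (H y) (ler_norm _).
Qed.

Lemma sqi_shift u (h : R * R) : sqi u -> sqi (fun y => u (y + h)).
Proof.
move=> [mu iu]; split; first exact: cmeas_shift.
exact: integrable_shift iu.
Qed.

Lemma sqiD u w : sqi u -> sqi w -> sqi (fun y => u y + w y).
Proof.
move=> [mu iu] [mw iw]; have muw := cmeasD mu mw; split=> //.
have i2 := integrableZl measurableT 2 (integrableD measurableT iu iw).
apply: (le_integrable measurableT _ _ i2).
  by apply/measurable_EFinP; exact: cmeas_normc_sqr.
move=> y _; rewrite /= lee_fin ger0_norm ?sqr_ge0//.
apply: le_trans (ler_norm _).
have := normcD (u y) (w y); have := normc_ge0 (u y + w y); have := normc_ge0 (u y); have := normc_ge0 (w y).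
move: (n _) (n _) (n _) => p q r p0 q0 r0 h.
have h2 : p ^+ 2 <= (q + r) ^+ 2 by rewrite ler_pXn2r ?nnegrE ?addr_ge0.
by have := sqr_ge0 (q - r); nra.
Qed.

Lemma sqiM u w : cmeas u -> (forall y, n (u y) <= 2) -> sqi w -> sqi (fun y => u y * w y).
Proof.
move=> mu u1 sw; apply: (@sqi_le _ w 4) => //; first by apply: cmeasM => //; case: sw.
move=> y; rewrite Normc.normcM exprMn ler_wpM2r ?sqr_ge0//.
have -> : (4 : R) = 2 ^+ 2 by ring.
by rewrite ler_pXn2r ?nnegrE ?normc_ge0.
Qed.

Lemma normc2 : n (2 : R[i]) = 2.
Proof.
have := normc_sqr 2; rewrite /= => h; apply/eqP.
by rewrite -(eqrXn2 (n := 2))// ?normc_ge0// h/=; apply/eqP; ring.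
Qed.

Lemma sqiN u : sqi u -> sqi (fun y => - u y).
Proof.
move=> su; apply: (@sqi_le _ u 1) => //; first by apply: cmeasN; case: su.
by move=> y; rewrite normcN mul1r.
Qed.

Lemma sqiB u w : sqi u -> sqi w -> sqi (fun y => u y - w y).
Proof. by move=> su sw; apply: sqiD => //; exact: sqiN. Qed.

(** * Increments at dyadic scales *)

Section Dyadic.
Variables (w : plane -> R[i]) (e x : R * R).
Hypotheses (sw : sqi w) (e1 : `|e.1| <= 1) (e2 : `|e.2| <= 1).

Definition incr (s : R) (y : plane) : R := n (w (y + s *: e) - w y) ^+ 2.
(* By the parallelogram identity, incr2 s is what the energy at scale 2 s lacks
   compared with the one at scale s. *)
Definition incr2 (s : R) (y : plane) : R :=
  n (w (y + (2 * s) *: e) - 2 * w (y + s *: e) + w y) ^+ 2.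

Lemma incr_integrable s : area.-integrable setT (EFin \o incr s).
Proof. by apply: (sqiB _ sw).2; exact: sqi_shift. Qed.

Lemma incr2_integrable s : area.-integrable setT (EFin \o incr2 s).
Proof.
apply: (sqiD _ sw).2; apply: sqiB; first exact: sqi_shift.
apply: sqiM; [exact: cmeas_cst|by move=> y; rewrite normc2|exact: sqi_shift].
Qed.

Lemma incr_measurable s : measurable_fun setT (incr s).
Proof. by apply/measurable_EFinP; exact: measurable_int (incr_integrable s). Qed.

Lemma incr_ge0 s y : 0 <= incr s y. Proof. exact: sqr_ge0. Qed.
Lemma incr2_ge0 s y : 0 <= incr2 s y. Proof. exact: sqr_ge0. Qed.

Let ib (h : plane -> R) a : area.-integrable setT (EFin \o h) ->
  area.-integrable (box x a) (EFin \o h).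
Proof. by apply: integrableTS; exact: measurable_box. Qed.

Let bound1 s : 0 <= s -> `|(s *: e).1| <= s /\ `|(s *: e).2| <= s.
Proof. by move=> s0; rewrite /= !normrM (ger0_norm s0); split; apply: ler_piMr. Qed.

(** The parallelogram identity with middle point y + s e, integrated. The second half of the
    increment is a translate of the first, and translating it back enlarges the box by s. *)
Lemma dyadic_step s a : 0 <= s ->
  \int[area]_(y in box x a) incr (2 * s) y + \int[area]_(y in box x a) incr2 s y <=
  4 * \int[area]_(y in box x (a + s)) incr s y.
Proof.
move=> s0; have [b1 b2] := bound1 s0.
have mb b := @measurable_box R x b.
have [i1 h1] := Rintegral_box_shift b1 b2 (incr_ge0 s) (incr_measurable s) (ib (a + s) (incr_integrable s)).
have h0 : \int[area]_(y in box x a) incr s y <= \int[area]_(y in box x (a + s)) incr s y.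
  apply: le_Rintegral_subset => //; [by apply: box_subset; rewrite lerDl|exact: incr_ge0|].
  exact: ib (incr_integrable s).
have i0 := ib a (incr_integrable s).
rewrite -RintegralD//; [|exact: ib (incr_integrable _)|exact: ib (incr2_integrable _)].
have -> : \int[area]_(y in box x a) (incr (2 * s) y + incr2 s y) =
    \int[area]_(y in box x a) (2 * (incr s y + incr s (y + s *: e))).
  apply: eq_Rintegral => y _; rewrite /incr /incr2.
  have -> : y + (2 * s) *: e = y + s *: e + s *: e by rewrite mulr_natl mulr2n scalerDl addrA.
  exact: parallelogram.
rewrite RintegralZl//; last by have := integrableD (mb a) i0 i1.
by rewrite RintegralD//; lra.
Qed.

Definition dyad (s0 : R) (k : nat) : R := s0 / 2 ^+ k.

Lemma dyadS s0 k : dyad s0 k = 2 * dyad s0 k.+1.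
Proof. by rewrite /dyad exprS; field; rewrite expf_neq0. Qed.

Lemma dyad_gt0 s0 k : 0 < s0 -> 0 < dyad s0 k.
Proof. by move=> h; rewrite divr_gt0// exprn_gt0. Qed.

Lemma dyad_le s0 k : 0 < s0 -> dyad s0 k <= s0.
Proof.
move=> h; rewrite ler_pdivrMr ?exprn_gt0// ler_peMr ?(ltW h)//.
by rewrite exprn_ege1// ler1n.
Qed.

(** After division by the squared scale, [dyadic_step] says that the energy at one scale plus the
    gap is at most the energy at the next finer scale; the sum telescopes. *)
Lemma dyadic_sum s0 a (N : nat) : 0 < s0 ->
  \sum_(k < N) \int[area]_(y in box x a) incr2 (dyad s0 k.+1) y / dyad s0 k ^+ 2 <=
  \int[area]_(y in box x (a + s0)) incr (dyad s0 N) y / dyad s0 N ^+ 2.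
Proof.
move=> s00.
have mb b := @measurable_box R x b.
(* The induction has to record the exact half-side: the enlargements s0 / 2, s0 / 4, ... add up to
   s0 minus the last scale. *)
suff H : \sum_(k < N) \int[area]_(y in box x a) incr2 (dyad s0 k.+1) y / dyad s0 k ^+ 2 <=
  \int[area]_(y in box x (a + (s0 - dyad s0 N))) incr (dyad s0 N) y / dyad s0 N ^+ 2.
  apply: le_trans H _; rewrite ler_wpM2r ?invr_ge0 ?sqr_ge0//.
  apply: le_Rintegral_subset => //; last 2 first.
  - exact: incr_ge0.
  - exact: ib (incr_integrable _).
  by apply: box_subset; rewrite lerD2l gerBl ltW// dyad_gt0.
elim: N => [|N IH].
  by rewrite big_ord0 divr_ge0 ?sqr_ge0// Rintegral_ge0// => y _; exact: incr_ge0.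
rewrite big_ord_recr/=.
set b := a + (s0 - dyad s0 N) in IH.
have ab : a <= b by rewrite lerDl subr_ge0 dyad_le.
have dN := dyad_gt0 N s00; have dN1 := dyad_gt0 N.+1 s00.
have h1 : \int[area]_(y in box x a) incr2 (dyad s0 N.+1) y <=
    \int[area]_(y in box x b) incr2 (dyad s0 N.+1) y.
  apply: le_Rintegral_subset => //; [exact: box_subset|exact: incr2_ge0|].
  exact: ib (incr2_integrable _).
have := dyadic_step b (ltW dN1); rewrite -dyadS.
have -> : b + dyad s0 N.+1 = a + (s0 - dyad s0 N.+1) by rewrite /b (dyadS s0 N); ring.
move=> h2.
apply: (@le_trans _ _ ((\int[area]_(y in box x b) incr (dyad s0 N) y +
    \int[area]_(y in box x b) incr2 (dyad s0 N.+1) y) / dyad s0 N ^+ 2)).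
  by rewrite mulrDl lerD// ler_wpM2r// invr_ge0 sqr_ge0.
rewrite ler_pdivrMr ?exprn_gt0// {2}(dyadS s0 N) (le_trans h2)//.
rewrite le_eqVlt; apply/orP; left; apply/eqP; field.
by rewrite gt_eqF.
Qed.

End Dyadic.

(** Identifies the deviation of a transported ratio from 1 with an increment of the gauged function,
    to which the energy bounds apply. *)
Lemma ratio_sub1 (p r : R) (a b : R[i]) : n a = 1 ->
  n (ratio (p - r) a b - 1) = n (cis p * b - cis r * a).
Proof.
move=> a1; rewrite -[LHS]mul1r.
have <- : n (cis r * a) = 1 by rewrite Normc.normcM normc_cis a1 mul1r.
rewrite -Normc.normcM; congr n.
have -> : cis p = cis r * cis (p - r) by rewrite -cisD addrC subrK.
rewrite /ratio mulrBr mulr1; congr (_ - _).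
have e := normc_unit_conj a1.
transitivity (cis r * cis (p - r) * b * (conjc a * a)); first by ring.
by rewrite e mulr1.
Qed.

(* Multiplication by exp(i gauge), resp. exp(- i gauge), turns the first, resp. the
   second, component of the covariant gradient into a partial derivative. *)
Definition gauge (Om : R) (y : plane) : R := Om * y.1 * y.2.

Lemma measurable_gauge Om : measurable_fun setT (gauge Om).
Proof. by apply: measurable_funM => //; exact: measurable_funM. Qed.

Definition gauged1 (Om : R) u (y : plane) : R[i] := cis (gauge Om y) * u y.
Definition gauged2 (Om : R) u (y : plane) : R[i] := cis (- gauge Om y) * u y.

Lemma cmeas_gauged1 Om u : cmeas u -> cmeas (gauged1 Om u).
Proof. by move=> mu; apply: cmeasM => //; apply: cmeas_cis; exact: measurable_gauge. Qed.

Lemma cmeas_gauged2 Om u : cmeas u -> cmeas (gauged2 Om u).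
Proof.
move=> mu; apply: cmeasM => //; apply: cmeas_cis.
by apply: measurableT_comp => //; exact: measurable_gauge.
Qed.

Lemma sqi_gauged1 Om u : sqi u -> sqi (gauged1 Om u).
Proof.
move=> su; apply: sqiM => //; first by apply: cmeas_cis; exact: measurable_gauge.
by move=> y; rewrite normc_cis ler1n.
Qed.

Lemma sqi_gauged2 Om u : sqi u -> sqi (gauged2 Om u).
Proof.
move=> su; apply: sqiM => //.
  by apply: cmeas_cis; apply: measurableT_comp => //; exact: measurable_gauge.
by move=> y; rewrite normc_cis ler1n.
Qed.

(** * Averaged holonomy *)

Section PlaquetteIntegral.
Variables (v : plane -> R[i]) (Om : R) (x : R * R) (a s : R).
Hypotheses (mv : cmeas v) (v1 : forall y, n (v y) = 1) (a0 : 0 < a) (s0 : 0 < s).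
Let d1 : R * R := s *: e1.
Let d2 : R * R := s *: e2.
Let q := gauge Om.
Let m1 (y : plane) : R := n (gauged1 Om v (y + d1) - gauged1 Om v y).
Let m2 (y : plane) : R := n (gauged2 Om v (y + d2) - gauged2 Om v y).
Let R1 (y : plane) : R[i] := ratio (q (y + d1) - q y) (v y) (v (y + d1)).
Let R2 (y : plane) : R[i] := ratio (- q (y + d2) - - q y) (v y) (v (y + d2)).

Let R1E y : n (R1 y - 1) = m1 y. Proof. exact: ratio_sub1. Qed.
Let R2E y : n (R2 y - 1) = m2 y. Proof. exact: ratio_sub1. Qed.

Let mshift (h : plane -> R) (w : R * R) : measurable_fun setT h ->
  measurable_fun setT (fun y : plane => h (y + w)).
Proof. by move=> mh; exact: (measurableT_comp mh (measurable_shift w)). Qed.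

Let mR1 : cmeas R1.
Proof.
apply: cmeasM; first exact: cmeas_conj.
apply: cmeasM; last exact: cmeas_shift.
apply: cmeas_cis; apply: measurable_funB; last exact: measurable_gauge.
by apply: mshift; exact: measurable_gauge.
Qed.

Let mR2 : cmeas R2.
Proof.
apply: cmeasM; first exact: cmeas_conj.
apply: cmeasM; last exact: cmeas_shift.
apply: cmeas_cis; apply: measurable_funB; last first.
  by apply: measurableT_comp => //; exact: measurable_gauge.
by apply: measurableT_comp => //; apply: mshift; exact: measurable_gauge.
Qed.

Let mm1 : measurable_fun setT m1.
Proof.
apply: cmeas_normc; apply: cmeasB; last exact: cmeas_gauged1.
by apply: cmeas_shift; exact: cmeas_gauged1.
Qed.

Let mm2 : measurable_fun setT m2.
Proof.
apply: cmeas_normc; apply: cmeasB; last exact: cmeas_gauged2.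
by apply: cmeas_shift; exact: cmeas_gauged2.
Qed.

Let n1 y : n (gauged1 Om v y) = 1.
Proof. by rewrite /gauged1 Normc.normcM normc_cis v1 mul1r. Qed.
Let n2 y : n (gauged2 Om v y) = 1.
Proof. by rewrite /gauged2 Normc.normcM normc_cis v1 mul1r. Qed.

Let m1b y : 0 <= m1 y <= 2.
Proof. by rewrite normc_ge0/= (le_trans (normcD _ _))// normcN !n1. Qed.
Let m2b y : 0 <= m2 y <= 2.
Proof. by rewrite normc_ge0/= (le_trans (normcD _ _))// normcN !n2. Qed.

(** Opposite sides of the square carry the same function [R1] or [R2] at two points that differ by a
    translation. Written in this way, the first order terms can be summed by parts. *)
Let pointwise y : sin (2 * (Om * s ^+ 2)) <=
  (im (R1 (y + d2)) - im (R1 y)) + (- im (R2 (y + d1)) - - im (R2 y)) +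
  8 * (m1 y ^+ 3 + m2 (y + d1) ^+ 3 + m1 (y + d2) ^+ 3 + m2 y ^+ 3).
Proof.
have e12 : y + d2 + d1 = y + d1 + d2 by rewrite addrAC.
have qE : q y + q (y + d1 + d2) - q (y + d1) - q (y + d2) = Om * s ^+ 2.
  by rewrite /q /gauge /d1 /d2 /e1 /e2 /= /GRing.scale /=; ring.
have := @plaquette R (v y) (v (y + d1)) (v (y + d2)) (v (y + d1 + d2))
  (R1 y) (R2 (y + d1)) (R1 (y + d2)) (R2 y) _ _ _ _ _ (v1 _) (v1 _) (v1 _) (v1 _) qE
  erefl.
rewrite /R2 /R1 e12 ![- _ - - _]addrC !opprK => /(_ erefl erefl erefl).
move=> h; apply: le_trans h _.
have r1 := R1E y; have r2 := R1E (y + d2); have r3 := R2E y; have r4 := R2E (y + d1).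
rewrite -r1 -r2 -r3 -r4 /R1 /R2 e12 ![- _ - - _]addrC !opprK.
by rewrite le_eqVlt; apply/orP; left; apply/eqP; ring.
Qed.

(** The pointwise inequality is weighted by [tent] and integrated: [tent_by_parts] leaves a factor s
    / a in front of the first order terms. Each cubic term occurs twice, once translated, which
    gives 16 on the larger box. *)
Lemma plaquette_integral : 0 <= sin (2 * (Om * s ^+ 2)) ->
  sin (2 * (Om * s ^+ 2)) * (a ^+ 2 / 2) <=
  s / a * (\int[area]_(y in box x (a + s)) m1 y + \int[area]_(y in box x (a + s)) m2 y) +
  16 * (\int[area]_(y in box x (a + s)) m1 y ^+ 3 + \int[area]_(y in box x (a + s)) m2 y ^+ 3).
Proof.
move=> sin0.
have b1 : `|d1.1| <= s by rewrite /d1 /= /GRing.scale /= mulr1 ger0_norm// ltW.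
have b2 : `|d1.2| <= s by rewrite /d1 /= /GRing.scale /= mulr0 normr0 ltW.
have b3 : `|d2.1| <= s by rewrite /d2 /= /GRing.scale /= mulr0 normr0 ltW.
have b4 : `|d2.2| <= s by rewrite /d2 /= /GRing.scale /= mulr1 ger0_norm// ltW.
have mb b := @measurable_box R x b.
have nR1 y : n (R1 y) = 1 by exact: normc_ratio.
have nR2 y : n (R2 y) = 1 by exact: normc_ratio.
have iR1 y : `|im (R1 y)| <= 1 by rewrite (le_trans (normc_im _))// nR1.
have iR2 y : `|- im (R2 y)| <= 1 by rewrite normrN (le_trans (normc_im _))// nR2.
have jR1 y : `|im (R1 y)| <= m1 y.
  by rewrite -R1E (le_trans _ (normc_im _))//; case: (R1 y) => p r /=; rewrite subr0.
have jR2 y : `|- im (R2 y)| <= m2 y.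
  by rewrite normrN -R2E (le_trans _ (normc_im _))//; case: (R2 y) => p r /=; rewrite subr0.
have mi1 : measurable_fun setT (fun y => im (R1 y)) := mR1.2.
have mi2 : measurable_fun setT (fun y => - im (R2 y)).
  by apply: measurableT_comp => //; exact: mR2.2.
have ibd (h : plane -> R) b (M : R) : measurable_fun setT h -> (forall y, 0 <= h y <= M) ->
    area.-integrable (box x b) (EFin \o h).
  move=> mh hM; apply: (@integrable_box _ _ _ _ M) => // y.
  by have /andP[h0 h1] := hM y; rewrite ger0_norm.
have T1 := tent_by_parts x a0 b3 b4 mi1 iR1.
have T2 := tent_by_parts x a0 b1 b2 mi2 iR2.
have S1 : \int[area]_(y in box x (a + s)) `|im (R1 y)| <= \int[area]_(y in box x (a + s)) m1 y.
  apply: le_Rintegral => //; last exact: (ibd _ _ 2 mm1).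
  by apply: (ibd _ _ 1) => [|y]; [exact: measurableT_comp|rewrite normr_ge0 iR1].
have S2 : \int[area]_(y in box x (a + s)) `|- im (R2 y)| <= \int[area]_(y in box x (a + s)) m2 y.
  apply: le_Rintegral => //; last exact: (ibd _ _ 2 mm2).
  by apply: (ibd _ _ 1) => [|y]; [exact: measurableT_comp|rewrite normr_ge0 iR2].
have c1 y : 0 <= m1 y ^+ 3 <= 8.
  have /andP[h0 h1] := m1b y; rewrite exprn_ge0//= (_ : 8 = 2 ^+ 3); last by ring.
  by rewrite ler_pXn2r ?nnegrE.
have c2 y : 0 <= m2 y ^+ 3 <= 8.
  have /andP[h0 h1] := m2b y; rewrite exprn_ge0//= (_ : 8 = 2 ^+ 3); last by ring.
  by rewrite ler_pXn2r ?nnegrE.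
have mm13 : measurable_fun setT (fun y => m1 y ^+ 3) by exact: measurable_funX.
have mm23 : measurable_fun setT (fun y => m2 y ^+ 3) by exact: measurable_funX.
have C1p y : 0 <= m1 y ^+ 3 by case/andP: (c1 y).
have C2p y : 0 <= m2 y ^+ 3 by case/andP: (c2 y).
have [iA hA] := Rintegral_box_shift b3 b4 C1p mm13 (ibd _ (a + s) 8 mm13 c1).
have [iB hB] := Rintegral_box_shift b1 b2 C2p mm23 (ibd _ (a + s) 8 mm23 c2).
have iC := ibd _ a 8 mm13 c1; have iD := ibd _ a 8 mm23 c2.
have hC : \int[area]_(y in box x a) m1 y ^+ 3 <= \int[area]_(y in box x (a + s)) m1 y ^+ 3.
  apply: le_Rintegral_subset => //; first by apply: box_subset; rewrite lerDl ltW.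
  exact: (ibd _ _ 8).
have hD : \int[area]_(y in box x a) m2 y ^+ 3 <= \int[area]_(y in box x (a + s)) m2 y ^+ 3.
  apply: le_Rintegral_subset => //; first by apply: box_subset; rewrite lerDl ltW.
  exact: (ibd _ _ 8).
have mt := measurable_tent x a.
have tb y : `|tent x a y| <= 1 by rewrite ger0_norm ?tent_ge0// tent_le1.
have it : area.-integrable (box x a) (EFin \o tent x a) by exact: (integrable_box _ _ mt tb).
have itw (h : plane -> R) (w : R * R) : measurable_fun setT h -> (forall y, `|h y| <= 1) ->
    area.-integrable (box x a) (EFin \o (fun y => tent x a y * (h (y + w) - h y))).
  move=> mh h1; apply: (@integrable_box _ _ _ _ 2).
    by apply: measurable_funM => //; apply: measurable_funB => //; exact: mshift.
  move=> y; rewrite normrM -[leRHS]mul1r ler_pM//.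
  by rewrite (le_trans (ler_normB _ _))// (le_trans (lerD (h1 _) (h1 _))).
have iT1 := itw _ d2 mi1 iR1; have iT2 := itw _ d1 mi2 iR2.
have L : sin (2 * (Om * s ^+ 2)) * \int[area]_(y in box x a) tent x a y <=
  (\int[area]_(y in box x a) (tent x a y * (im (R1 (y + d2)) - im (R1 y))) +
   \int[area]_(y in box x a) (tent x a y * (- im (R2 (y + d1)) - - im (R2 y)))) +
  8 * ((\int[area]_(y in box x a) m1 y ^+ 3 + \int[area]_(y in box x a) m2 (y + d1) ^+ 3) +
   (\int[area]_(y in box x a) m1 (y + d2) ^+ 3 + \int[area]_(y in box x a) m2 y ^+ 3)).
  have iCB := integrableD (mb a) iC iB; have iAD := integrableD (mb a) iA iD.
  have iall := integrableD (mb a) iCB iAD.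
  have iT12 := integrableD (mb a) iT1 iT2.
  have i8 := integrableZl (mb a) 8 iall.
  rewrite -RintegralZl// -!RintegralD// -RintegralZl// -RintegralD//.
  apply: le_Rintegral => //.
  - by have := integrableZl (mb a) (sin (2 * (Om * s ^+ 2))) it.
  - by have := integrableD (mb a) iT12 i8.
  move=> y _.
  have t0 := tent_ge0 x a y; have t1 := tent_le1 x y a0.
  rewrite mulrC; apply: le_trans (ler_wpM2l t0 (pointwise y)) _.
  rewrite !mulrDr -!addrA !lerD2l.
  have h (p : R) : 0 <= p -> tent x a y * (8 * p) <= 8 * p.
    by move=> p0; rewrite ler_piMl// mulr_ge0.
  by rewrite !lerD// h.
have h0 := ler_wpM2l sin0 (integral_tent_ge x a0).
have sa : 0 <= s / a by rewrite divr_ge0// ltW.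
have h1 := ler_wpM2l sa S1; have h2 := ler_wpM2l sa S2.
apply: le_trans h0 _; apply: le_trans L _.
move: T1 T2 h1 h2 hA hB hC hD.
repeat (let I := fresh "I" in set I := Rintegral _ _ _; move: I => I).
by lra.
Qed.

End PlaquetteIntegral.

(** * Choice of a scale with small increments *)

Section MainEstimate.
Variables (u : plane -> R[i]) (Om E X : R) (x : R * R) (a s0 : R).
Hypotheses (su : sqi u) (s00 : 0 < s0) (s0a : s0 <= a).
Hypothesis hE1 : forall s, 0 < s -> s <= s0 ->
  \int[area]_(y in box x (a + 2 * s0)) incr (gauged1 Om u) e1 s y <= s ^+ 2 * E.
Hypothesis hE2 : forall s, 0 < s -> s <= s0 ->
  \int[area]_(y in box x (a + 2 * s0)) incr (gauged2 Om u) e2 s y <= s ^+ 2 * E.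
Let xi (y : plane) : R := `|1 - n (u y) ^+ 2|.
Hypothesis hX : \int[area]_(y in box x (a + 3 * s0)) xi y <= X.

Let a0 : 0 < a. Proof. exact: lt_le_trans s0a. Qed.
Let mb b := @measurable_box R x b.
Let v (y : plane) := unitc (u y).
Let v1 y : n (v y) = 1. Proof. exact: normc_unitc. Qed.
Let mv : cmeas v. Proof. by apply: cmeas_unitc; case: su. Qed.

Let mxi : measurable_fun setT xi.
Proof.
apply: measurableT_comp => //; apply: measurable_funB => //.
by apply: cmeas_normc_sqr; case: su.
Qed.

Let ixi b : area.-integrable (box x b) (EFin \o xi).
Proof.
have i1 : area.-integrable (box x b) (EFin \o (fun=> 1 : R)).
  by apply: (@integrable_box _ _ _ _ 1) => // y; rewrite normr1.
have i2 := integrableD (mb b) i1 (integrableTS (mb b) su.2).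
apply: (le_integrable (mb b) _ _ i2).
  by apply/measurable_EFinP; exact: measurable_funTS.
move=> y _; rewrite /= lee_fin normr_id [leRHS]ger0_norm ?addr_ge0 ?sqr_ge0//.
by rewrite (le_trans (ler_normB _ _))// normr1 ger0_norm// sqr_ge0.
Qed.

Let xi0 y : 0 <= xi y. Proof. exact: normr_ge0. Qed.

Let xi_shift b (w : R * R) : b <= a + s0 -> `|w.1| <= 2 * s0 -> `|w.2| <= 2 * s0 ->
  area.-integrable (box x b) (EFin \o (fun y => xi (y + w))) /\
  \int[area]_(y in box x b) xi (y + w) <= X.
Proof.
move=> ba w1 w2.
have [i1 h1] := Rintegral_box_shift w1 w2 xi0 mxi (ixi (b + 2 * s0)).
split=> //; apply: le_trans h1 _; apply: le_trans hX.
by apply: le_Rintegral_subset => //; apply: box_subset; move: s00 s0a ba; lra.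
Qed.

Section Direction.
Variables (V W : plane -> R[i]) (e : R * R).
Hypotheses (sW : sqi W) (mV : cmeas V) (V1 : forall y, n (V y) = 1).
Hypotheses (e1' : `|e.1| <= 1) (e2' : `|e.2| <= 1).
Hypothesis VW : forall y, n (V y - W y) ^+ 2 <= xi y.
Hypothesis hE : forall s, 0 < s -> s <= s0 ->
  \int[area]_(y in box x (a + 2 * s0)) incr W e s y <= s ^+ 2 * E.

Let vb s t : 0 <= s -> s <= t -> `|(s *: e).1| <= t /\ `|(s *: e).2| <= t.
Proof.
move=> h0 ht; rewrite /= !normrM (ger0_norm h0).
by split; apply: le_trans ht; apply: ler_piMr.
Qed.

(** The bound [E] on the finest energy does not depend on N, so one of N scales has a gap of at most
    E / N. *)
Lemma dyadic_gap N :
  \sum_(k < N) \int[area]_(y in box x (a + s0)) incr2 W e (dyad s0 k.+1) y / dyad s0 k ^+ 2 <= E.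
Proof.
apply: le_trans (dyadic_sum x sW e1' e2' (a + s0) N s00) _.
rewrite -addrA (_ : s0 + s0 = 2 * s0); last by ring.
have d0 := dyad_gt0 N s00.
rewrite ler_pdivrMr ?exprn_gt0// [leRHS]mulrC; apply: hE => //; exact: dyad_le.
Qed.

Let m s (y : plane) : R := n (V (y + s *: e) - V y).

Let mm s : measurable_fun setT (m s).
Proof. by apply: cmeas_normc; apply: cmeasB => //; exact: cmeas_shift. Qed.

Let m02 s y : 0 <= m s y <= 2.
Proof. by rewrite normc_ge0/= (le_trans (normcD _ _))// normcN !V1. Qed.

Let ibm s p b : area.-integrable (box x b) (EFin \o (fun y => m s y ^+ p)).
Proof.
apply: (@integrable_box _ _ _ _ (2 ^+ p)); first exact: measurable_funX.
move=> y; have /andP[h0 h2] := m02 s y.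
by rewrite ger0_norm ?exprn_ge0//; case: p => [|p]; rewrite ?expr0// ler_pXn2r ?nnegrE.
Qed.

Let iincr s b : area.-integrable (box x b) (EFin \o incr W e s).
Proof. by apply: integrableTS => //; exact: incr_integrable. Qed.
Let iincr2 s b : area.-integrable (box x b) (EFin \o incr2 W e s).
Proof. by apply: integrableTS => //; exact: incr2_integrable. Qed.

(** The unit field [V] is compared with [W] at both ends of the increment. Each comparison costs
    [xi], whose integral is at most [X] even after translation. *)
Lemma second_moment s : 0 < s -> s <= s0 ->
  \int[area]_(y in box x (a + s)) m s y ^+ 2 <= 3 * (s ^+ 2 * E + 2 * X).
Proof.
move=> sp ss.
have ba : a + s <= a + s0 by rewrite lerD2l.
have [w1 w2] : `|(s *: e).1| <= 2 * s0 /\ `|(s *: e).2| <= 2 * s0.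
  by apply: vb; [exact: ltW|move: ss s00; lra].
have [i1 h1] := xi_shift ba w1 w2.
have z0 : `|(0 : R * R).1| <= 2 * s0 by rewrite normr0; move: s00; lra.
have [i0 h0] := xi_shift ba z0 z0.
have hI : \int[area]_(y in box x (a + s)) incr W e s y <= s ^+ 2 * E.
  apply: le_trans (hE sp ss); apply: le_Rintegral_subset => //.
    by apply: box_subset; move: ss s00; lra.
  by move=> y; exact: incr_ge0.
have i01 := integrableD (mb (a + s)) i1 i0.
have i2 := integrableD (mb (a + s)) (iincr s (a + s)) i01.
apply: (@le_trans _ _ (\int[area]_(y in box x (a + s)) (3 * (incr W e s y + (xi (y + s *: e) + xi (y + 0)))))).
  apply: le_Rintegral => //.
    by have := integrableZl (mb (a + s)) 3 i2.
  move=> y _; rewrite /m.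
  have -> : V (y + s *: e) - V y = (V (y + s *: e) - W (y + s *: e)) +
    (W (y + s *: e) - W y) + (W y - V y) by ring.
  apply: le_trans (normc_sqr_add3 _ _ _) _; rewrite addr0 (normcB (W y)).
  have := VW y; have := VW (y + s *: e); rewrite /incr.
  by lra.
rewrite RintegralZl// RintegralD// RintegralD//.
by move: h0 h1 hI; lra.
Qed.

(** [strict_convexity] with y + h e as middle point bounds the fourth power by the squared second
    difference of [V]. Passing to that of [W] costs [xi] at the three points with weights 1, 2,
    1. *)
Lemma fourth_moment h : 0 < h -> 2 * h <= s0 ->
  \int[area]_(y in box x (a + 2 * h)) m (2 * h) y ^+ 4 <=
  16 * (2 * \int[area]_(y in box x (a + s0)) incr2 W e h y + 32 * X).
Proof.
move=> hp hs; set s := 2 * h.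
have ba : a + s <= a + s0 by rewrite lerD2l.
have [w1 w2] : `|(s *: e).1| <= 2 * s0 /\ `|(s *: e).2| <= 2 * s0.
  by apply: vb; rewrite /s; move: hp hs s00; lra.
have [w3 w4] : `|(h *: e).1| <= 2 * s0 /\ `|(h *: e).2| <= 2 * s0.
  by apply: vb; move: hp hs s00; lra.
have [i1 h1] := xi_shift ba w1 w2.
have [i3 h3] := xi_shift ba w3 w4.
have z0 : `|(0 : R * R).1| <= 2 * s0 by rewrite normr0; move: s00; lra.
have [i0 h0] := xi_shift ba z0 z0.
have hI : \int[area]_(y in box x (a + s)) incr2 W e h y <=
    \int[area]_(y in box x (a + s0)) incr2 W e h y.
  apply: le_Rintegral_subset => //; first exact: box_subset.
  by move=> y; exact: incr2_ge0.
have mbs := mb (a + s).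
have i22 := integrableZl mbs 2 (iincr2 h (a + s)).
have i33 := integrableZl mbs 2 i3.
have i4 := integrableD mbs i1 i33.
have i5 := integrableD mbs i4 i0.
have i88 := integrableZl mbs 8 i5.
have i6 := integrableD mbs i22 i88.
apply: (@le_trans _ _ (\int[area]_(y in box x (a + s))
    (16 * (2 * incr2 W e h y + 8 * (xi (y + s *: e) + 2 * xi (y + h *: e) + xi (y + 0)))))).
  apply: le_Rintegral => //.
    by have := integrableZl mbs 16 i6.
  move=> y _; rewrite /m addr0.
  apply: le_trans (strict_convexity (V1 y) (V1 (y + s *: e)) (V1 (y + h *: e))) _.
  rewrite ler_wpM2l//.
  have -> : V (y + s *: e) - 2 * V (y + h *: e) + V y =
    (W (y + s *: e) - 2 * W (y + h *: e) + W y) +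
    ((V (y + s *: e) - W (y + s *: e)) - 2 * (V (y + h *: e) - W (y + h *: e)) + (V y - W y)).
    by ring.
  apply: le_trans (normc_sqr_second _ _ _ _) _.
  have := VW y; have := VW (y + s *: e); have := VW (y + h *: e); rewrite /incr2 -/s.
  move: (n _ ^+ 2) (n _ ^+ 2) (n _ ^+ 2) (n _ ^+ 2) => p1 p2 p3 p4.
  move: (xi (y + h *: e)) (xi (y + s *: e)) (xi y) => q1 q2 q3.
  by lra.
rewrite RintegralZl// RintegralD// RintegralZl// RintegralZl// RintegralD// RintegralD// RintegralZl//.
move: h0 h1 h3 hI.
repeat (let I := fresh "I" in set I := Rintegral _ _ _; move: I => I).
by lra.
Qed.

(* AM-GM interpolates the first and third moments between the second and the
   fourth. *)
Lemma moments_am_gm s (kap kap' : R) : 0 < kap -> 0 < kap' -> 0 < s -> s <= s0 ->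
  s / a * \int[area]_(y in box x (a + s)) m s y +
   16 * \int[area]_(y in box x (a + s)) m s y ^+ 3 <=
  (kap' / 2 + 8 * kap) * \int[area]_(y in box x (a + s)) m s y ^+ 2 +
  8 / kap * \int[area]_(y in box x (a + s)) m s y ^+ 4 + 8 * s ^+ 2 / kap'.
Proof.
move=> k0 k0' sp ss; have mbs := mb (a + s).
have ic : area.-integrable (box x (a + s)) (EFin \o (fun=> s ^+ 2 / (2 * a ^+ 2 * kap'))).
  by apply: (@integrable_box _ _ _ _ `|s ^+ 2 / (2 * a ^+ 2 * kap')|).
(* As s <= a, the box has area at most 16 a^2, which cancels the a^2 of the denominator. This term
   therefore has no factor a^2, in contrast to the holonomy. *)
have cI : \int[area]_(y in box x (a + s)) (s ^+ 2 / (2 * a ^+ 2 * kap')) <= 8 * s ^+ 2 / kap'.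
  rewrite Rintegral_box_cst; last by rewrite addr_ge0 ?(ltW a0) ?(ltW sp).
  have -> : 8 * s ^+ 2 / kap' = s ^+ 2 / (2 * a ^+ 2 * kap') * (2 * (a + a)) ^+ 2.
    by field; rewrite !gt_eqF.
  apply: ler_wpM2l; first exact: divr_ge0 (sqr_ge0 _) (mulr_ge0 (mulr_ge0 (ler0n _ 2) (sqr_ge0 _)) (ltW k0')).
  have h1 : 2 * (a + s) <= 2 * (a + a) by move: ss s0a; lra.
  by rewrite ler_pXn2r// nnegrE mulr_ge0// addr_ge0 ?(ltW a0) ?(ltW sp).
have i1 : area.-integrable (box x (a + s)) (EFin \o m s).
  by have := ibm s 1 (a + s).
have i2 := ibm s 2 (a + s); have i3 := ibm s 3 (a + s); have i4 := ibm s 4 (a + s).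
have j1 := integrableZl mbs (s / a) i1; have j3 := integrableZl mbs 16 i3.
have j2 := integrableZl mbs (kap' / 2 + 8 * kap) i2; have j4 := integrableZl mbs (8 / kap) i4.
have j24 := integrableD mbs j2 j4.
apply: (@le_trans _ _ ((kap' / 2 + 8 * kap) * \int[area]_(y in box x (a + s)) m s y ^+ 2 +
  8 / kap * \int[area]_(y in box x (a + s)) m s y ^+ 4 +
  \int[area]_(y in box x (a + s)) (s ^+ 2 / (2 * a ^+ 2 * kap')))); last first.
  by rewrite lerD2l.
rewrite -!RintegralZl// -!RintegralD//.
apply: le_Rintegral => //.
- by have := integrableD mbs j1 j3.
- by have := integrableD mbs j24 ic.
move=> y _; have /andP[+ _] := m02 s y; move: (m s y) => p p0.
have h1 : s / a * p <= kap' / 2 * p ^+ 2 + s ^+ 2 / (2 * a ^+ 2 * kap').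
  rewrite -subr_ge0.
  have -> : kap' / 2 * p ^+ 2 + s ^+ 2 / (2 * a ^+ 2 * kap') - s / a * p =
    (kap' * p - s / a) ^+ 2 / (2 * kap') by field; rewrite !gt_eqF.
  by rewrite divr_ge0 ?sqr_ge0// mulr_ge0// ltW.
have h2 : 16 * p ^+ 3 <= 8 * kap * p ^+ 2 + 8 / kap * p ^+ 4.
  rewrite -subr_ge0.
  have -> : 8 * kap * p ^+ 2 + 8 / kap * p ^+ 4 - 16 * p ^+ 3 =
    8 * (p * (kap - p)) ^+ 2 / kap by field; rewrite gt_eqF.
  by rewrite divr_ge0 ?(ltW k0)// mulr_ge0// sqr_ge0.
by rewrite mulrDl; lra.
Qed.

End Direction.

Let VW1 y : n (gauged1 Om v y - gauged1 Om u y) ^+ 2 <= xi y.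
Proof.
by rewrite /gauged1 -mulrBr Normc.normcM normc_cis mul1r; exact: unitc_sub.
Qed.
Let VW2 y : n (gauged2 Om v y - gauged2 Om u y) ^+ 2 <= xi y.
Proof.
by rewrite /gauged2 -mulrBr Normc.normcM normc_cis mul1r; exact: unitc_sub.
Qed.
Let n1 y : n (gauged1 Om v y) = 1.
Proof. by rewrite /gauged1 Normc.normcM normc_cis v1 mul1r. Qed.
Let n2 y : n (gauged2 Om v y) = 1.
Proof. by rewrite /gauged2 Normc.normcM normc_cis v1 mul1r. Qed.

(** The second moment enters with the small weights [kap] and [kap'], and the fourth moment with the
    large weight 1 / [kap], which the gap of order 1 / N at the chosen scale compensates. *)
Lemma main_estimate (N : nat) (kap kap' : R) : (0 < N)%N -> 0 < kap -> 0 < kap' ->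
  exists k : nat, (k < N)%N /\ let s := dyad s0 k in
   (0 <= sin (2 * (Om * s ^+ 2)) ->
    sin (2 * (Om * s ^+ 2)) * (a ^+ 2 / 2) <=
    (kap' + 16 * kap) * (3 * (s ^+ 2 * E + 2 * X)) + 16 * s ^+ 2 / kap' +
    128 / kap * (4 * s ^+ 2 * E / N%:R + 64 * X)).
Proof.
move=> N0 k0 k0'.
have s1 := sqi_gauged1 Om su; have s2 := sqi_gauged2 Om su.
have b11 : `|(e1 : R * R).1| <= 1 by rewrite normr1.
have b12 : `|(e1 : R * R).2| <= 1 by rewrite normr0.
have b21 : `|(e2 : R * R).1| <= 1 by rewrite normr0.
have b22 : `|(e2 : R * R).2| <= 1 by rewrite normr1.
have G1 := dyadic_gap s1 b11 b12 hE1 N.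
have G2 := dyadic_gap s2 b21 b22 hE2 N.
pose g1 k := \int[area]_(y in box x (a + s0)) incr2 (gauged1 Om u) e1 (dyad s0 k.+1) y.
pose g2 k := \int[area]_(y in box x (a + s0)) incr2 (gauged2 Om u) e2 (dyad s0 k.+1) y.
(* The pigeonhole principle is applied to the sum of the gaps in the two directions, because the
   same scale must serve for both. *)
have [k kN gk] : exists2 k : nat, (k < N)%N & (g1 k + g2 k) / dyad s0 k ^+ 2 <= 2 * E / N%:R.
  apply: contrapT => h.
  have : \sum_(k < N) (2 * E / N%:R) < \sum_(k < N) ((g1 k + g2 k) / dyad s0 k ^+ 2).
    apply: ltr_sum; first by apply/hasP; exists (Ordinal N0) => //; rewrite mem_index_enum.
    move=> i _; rewrite ltNge; apply/negP => hi; apply: h; exists i => //.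
  rewrite sumr_const card_ord -[_ *+ N]mulr_natr divfK ?pnatr_eq0 -?lt0n//.
  under eq_bigr do rewrite mulrDl.
  by rewrite big_split /= ltNge (_ : 2 * E = E + E) ?lerD//; ring.
exists k; split=> // s sin0.
have sp : 0 < s by exact: dyad_gt0.
have ss : s <= s0 by exact: dyad_le.
have d0 : 0 < dyad s0 k.+1 by exact: dyad_gt0.
have sE : s = 2 * dyad s0 k.+1 by exact: dyadS.
have g12 : g1 k + g2 k <= 2 * E / N%:R * s ^+ 2.
  by rewrite -ler_pdivrMr ?exprn_gt0.
have P := plaquette_integral x mv v1 a0 sp sin0.
have A1 := moments_am_gm e1 (cmeas_gauged1 Om mv) n1 k0 k0' sp ss.
have A2 := moments_am_gm e2 (cmeas_gauged2 Om mv) n2 k0 k0' sp ss.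
have B1 := second_moment s1 (cmeas_gauged1 Om mv) n1 b11 b12 VW1 hE1 sp ss.
have B2 := second_moment s2 (cmeas_gauged2 Om mv) n2 b21 b22 VW2 hE2 sp ss.
have hs : 2 * dyad s0 k.+1 <= s0 by rewrite -sE.
have C1 := fourth_moment s1 (cmeas_gauged1 Om mv) n1 b11 b12 VW1 d0 hs.
have C2 := fourth_moment s2 (cmeas_gauged2 Om mv) n2 b21 b22 VW2 d0 hs.
rewrite -sE in C1 C2; rewrite -/(g1 k) in C1; rewrite -/(g2 k) in C2.
apply: le_trans P _.
have c1 : 0 <= kap' / 2 + 8 * kap by rewrite addr_ge0 ?divr_ge0 ?mulr_ge0 ?(ltW k0) ?(ltW k0').
have c2 : 0 <= 8 / kap by rewrite divr_ge0// ltW.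
have D1 := ler_wpM2l c1 (lerD B1 B2).
have D2 := ler_wpM2l c2 (lerD C1 C2).
have D3 := ler_wpM2l c2 (ler_wpM2l (ler0n R 32) g12).
have -> : (kap' + 16 * kap) * (3 * (s ^+ 2 * E + 2 * X)) =
  (kap' / 2 + 8 * kap) * (3 * (s ^+ 2 * E + 2 * X) + 3 * (s ^+ 2 * E + 2 * X)) by field.
have -> : 128 / kap * (4 * s ^+ 2 * E / N%:R + 64 * X) =
  8 / kap * (32 * (2 * E / N%:R * s ^+ 2)) + 8 / kap * (1024 * X) by ring.
have -> : 16 * s ^+ 2 / kap' = 8 * s ^+ 2 / kap' + 8 * s ^+ 2 / kap' by ring.
move: A1 A2 D1 D2 D3; clear.
move: (kap' / 2 + 8 * kap) (8 / kap) (8 * s ^+ 2 / kap') (s / a) => p1 p2 p3 p4.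
move: (2 * E / N%:R * s ^+ 2) (s ^+ 2 * E) (g1 k) (g2 k) => z1 z2 z3 z4.
rewrite !mulrDr.
repeat (let I := fresh "I" in set I := Rintegral _ _ _; move: I => I).
by move=> A1 A2 D1 D2 D3; lra.
Qed.

End MainEstimate.

End Core.

(** * Covariant gradients *)

Section BoundedDomain.
Context {R : realType}.
Local Notation plane := (measurableTypeR R * measurableTypeR R)%type.
Implicit Types (f g c phi : R * R -> R) (v : R * R).
Variable D : set (R * R).
Hypotheses (oD : open D) (bD : bounded_set D).

Let mD : measurable (D : set plane) := open_measurable2 oD.

Lemma bounded_sub_box : exists2 M : R, 0 < M &
  forall y, D y -> `|y.1| < M /\ `|y.2| < M.
Proof.
have [M [_ hM]] := bD; exists (`|M| + 2); first by rewrite ltr_wpDl.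
have lM : M < `|M| + 1 by rewrite (le_lt_trans (ler_norm M))// ltrDl.
move=> y /(hM _ lM); rewrite /= prod_normE ge_max => /andP[h1 h2].
by split; [apply: le_lt_trans h1 _|apply: le_lt_trans h2 _]; rewrite ltrD2l ltr1n.
Qed.

Lemma bounded_area : (area D < +oo)%E.
Proof.
have [M M0 hM] := bounded_sub_box.
apply: le_lt_trans (box_lty 0 M).
apply: le_measure; rewrite ?inE//; first exact: measurable_box.
by move=> y /hM[h1 h2]; apply/boxP; rewrite !subr0.
Qed.

Lemma continuous_bounded (c : R * R -> R) : continuous c ->
  exists2 M : R, 0 <= M & forall y, D y -> `|c y| <= M.
Proof.
move=> cc; have [M M0 hM] := bounded_sub_box.
have cK : compact (`[- M, M]%classic `*` `[- M, M]%classic : set (R * R)).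
  by apply: compact_setX; exact: segment_compact.
have := continuous_compact (continuous_subspaceT cc) cK.
move=> /compact_bounded[B [_ hB]]; exists (`|B| + 1); first by rewrite addr_ge0.
have lB : B < `|B| + 1 by rewrite (le_lt_trans (ler_norm B))// ltrDl.
move=> y /hM[h1 h2]; apply: (hB _ lB); exists y => //.
by split; rewrite /= in_itv/= -ler_norml ltW.
Qed.

Lemma integrable_L2 f : L2 D f -> area.-integrable D (EFin \o f).
Proof.
move=> /(L2_integrable mD bounded_area) i.
by apply/(integrable_mkcond _ mD); rewrite restrict_EFin.
Qed.

Lemma L2_integrableM f c : L2 D f -> continuous c ->
  area.-integrable D (EFin \o (fun y : plane => f y * c y)).
Proof.
move=> /(L2_integrable mD bounded_area) i cc.
have [M M0 hM] := continuous_bounded cc.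
apply/(integrable_mkcond _ mD); rewrite restrict_EFin.
have -> : (fun y : plane => f y * c y) \_ D = (fun y : plane => (f \_ D) y * (c \_ D) y).
  by apply/funext => y; rewrite !patchE; case: ifP => //; rewrite mul0r.
apply: (@integrable_mulb _ _ _ _ _ _ M) => //.
  by apply/(measurable_restrictT _ mD); apply: measurable_funTS; exact: continuous_measurable2.
by move=> y; rewrite patchE; case: ifPn => [|_]; [rewrite inE => /hM|rewrite normr0].
Qed.

Lemma L2M f c : L2 D f -> continuous c -> L2 D (fun y => c y * f y).
Proof.
move=> Lf cc; have [M M0 hM] := continuous_bounded cc.
have mc : measurable_fun setT (c \_ D : plane -> R).
  by apply/(measurable_restrictT _ mD); apply: measurable_funTS; exact: continuous_measurable2.
have E : (fun y : plane => c y * f y) \_ D = (fun y : plane => (c \_ D) y * (f \_ D) y).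
  by apply/funext => y; rewrite !patchE; case: ifP => //; rewrite mul0r.
apply: L2_of_integrable; rewrite E.
  by apply: measurable_funM => //; exact: L2_measurable.
apply: (eq_integrable measurableT (EFin \o (fun y : plane => (f \_ D) y ^+ 2 * (c \_ D) y ^+ 2))).
  by move=> y _; rewrite /= exprMn mulrC.
apply: (@integrable_mulb _ _ _ _ _ _ (M ^+ 2)); first exact: L2_integrable_sqr.
  exact: measurable_funX.
move=> y; rewrite normrX ler_pXn2r ?nnegrE// patchE.
by case: ifPn => [|_]; [rewrite inE => /hM|rewrite normr0].
Qed.

Lemma L2D f g : L2 D f -> L2 D g -> L2 D (fun y => f y + g y).
Proof.
move=> Lf Lg.
have E : (fun y : plane => f y + g y) \_ D = (fun y : plane => (f \_ D) y + (g \_ D) y).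
  by apply/funext => y; rewrite !patchE; case: ifP => //; rewrite addr0.
have mf := L2_measurable Lf; have mg := L2_measurable Lg.
apply: L2_of_integrable; rewrite E; first exact: measurable_funD.
have i := integrableZl measurableT 2 (integrableD measurableT (L2_integrable_sqr Lf) (L2_integrable_sqr Lg)).
apply: (le_integrable measurableT _ _ i).
  by apply/measurable_EFinP; apply: measurable_funX; exact: measurable_funD.
move=> y _; rewrite /= lee_fin !ger0_norm ?sqr_ge0 ?mulr_ge0 ?addr_ge0 ?sqr_ge0//.
have := sqr_ge0 ((f \_ D) y - (g \_ D) y); move: (_ y) (_ y) => p q; nra.
Qed.

Lemma test_functionM c phi : smooth c -> test_function D phi ->
  test_function D (fun y => c y * phi y).
Proof.
move=> sc [sp [K [cK KD K0]]]; split; first by move=> k; exact: class_CM.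
by exists K; split=> // y /K0 ->; rewrite mulr0.
Qed.

(** Product rule: the definition for f is tested with c * phi, which is again a test function since
    c is smooth. *)
Lemma weak_derivM v c f g : smooth c -> L2 D f -> is_weak_deriv D v f g ->
  is_weak_deriv D v (fun y => c y * f y) (fun y => c y * g y + 'D_v c y * f y).
Proof.
move=> sc Lf [Lg fg].
have cc : continuous c by case: (sc 0%N).
have cdc : continuous (fun y => 'D_v c y) by case: (sc 1%N) => _ /(_ v)[_ []].
split; first by apply: L2D; exact: L2M.
move=> phi tphi; have sp := tphi.1.
have cp : continuous phi by case: (sp 0%N).
have cdp : continuous (fun y => 'D_v phi y) by case: (sp 1%N) => _ /(_ v)[_ []].
have := fg _ (test_functionM sc tphi).
have dE y : 'D_v (fun y => c y * phi y) y = c y * 'D_v phi y + phi y * 'D_v c y.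
  have h1 := class_C_derive v y (sc 1%N); have h2 := class_C_derive v y (sp 1%N).
  by have := is_deriveM h1 h2 => -[_ ->].
have i1 : area.-integrable D (EFin \o (fun y : plane => f y * (c y * 'D_v phi y))).
  by apply: L2_integrableM => // y; apply: cvgM; [exact: cc|exact: cdp].
have i2 : area.-integrable D (EFin \o (fun y : plane => f y * (phi y * 'D_v c y))).
  by apply: L2_integrableM => // y; apply: cvgM; [exact: cp|exact: cdc].
have i3 : area.-integrable D (EFin \o (fun y : plane => g y * (c y * phi y))).
  by apply: L2_integrableM => // y; apply: cvgM; [exact: cc|exact: cp].
rewrite (@eq_Rintegral _ _ _ area _ (fun y : plane => f y * (c y * 'D_v phi y) + f y * (phi y * 'D_v c y))); last first.
  by move=> y _; rewrite dE mulrDr.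
rewrite RintegralD// => h.
rewrite (@eq_Rintegral _ _ _ area _ (fun y : plane => f y * (c y * 'D_v phi y))); last first.
  by move=> y _; rewrite mulrCA mulrA.
rewrite [in RHS](@eq_Rintegral _ _ _ area _ (fun y : plane => g y * (c y * phi y) + f y * (phi y * 'D_v c y))); last first.
  by move=> y _; ring.
by rewrite RintegralD//; move: h; set I := Rintegral _ _ _; set J := Rintegral _ _ _;
  set L := Rintegral _ _ _; clear; lra.
Qed.

Lemma weak_derivD v f1 f2 g1 g2 : L2 D f1 -> L2 D f2 ->
  is_weak_deriv D v f1 g1 -> is_weak_deriv D v f2 g2 ->
  is_weak_deriv D v (fun y => f1 y + f2 y) (fun y => g1 y + g2 y).
Proof.
move=> L1 L2' [Lg1 h1] [Lg2 h2]; split; first exact: L2D.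
move=> phi tphi; have sp := tphi.1.
have cp : continuous phi by case: (sp 0%N).
have cdp : continuous (fun y => 'D_v phi y) by case: (sp 1%N) => _ /(_ v)[_ []].
have i1 := L2_integrableM L1 cdp; have i2 := L2_integrableM L2' cdp.
have i3 := L2_integrableM Lg1 cp; have i4 := L2_integrableM Lg2 cp.
rewrite (@eq_Rintegral _ _ _ area _ (fun y : plane => f1 y * 'D_v phi y + f2 y * 'D_v phi y)); last first.
  by move=> y _; rewrite mulrDl.
rewrite [in RHS](@eq_Rintegral _ _ _ area _ (fun y : plane => g1 y * phi y + g2 y * phi y)); last first.
  by move=> y _; rewrite mulrDl.
by rewrite !RintegralD// opprD h1// h2.
Qed.

End BoundedDomain.

(** * Exchange of the two coordinates *)

Section Swap.
Context {R : realType}.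
Local Notation plane := (measurableTypeR R * measurableTypeR R)%type.
Implicit Types (D : set (R * R)) (f g : R * R -> R) (v : R * R).

Lemma pswapK : involutive (@pswap R).
Proof. by case. Qed.

Lemma continuous_pswap : continuous (@pswap R : R * R -> R * R).
Proof. by move=> y; apply: (@cvg_pair _ _ _ _ (nbhs y.2) (nbhs y.1)); [exact: cvg_snd|exact: cvg_fst]. Qed.

Lemma is_derive_pswap f (x v : R * R) df :
  is_derive (pswap x : R * R) v f df -> is_derive x (pswap v : R * R) (f \o @pswap R) df.
Proof. by move=> /is_derive_line h; apply/is_derive_line. Qed.

Lemma class_C_pswap k f : class_C k f -> class_C k (f \o @pswap R).
Proof.
elim: k f => [|k IH] f cf.
  by split=> // y; apply: continuous_comp; [exact: continuous_pswap|case: cf => + _; apply].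
apply: (@class_CS _ _ _ _ (fun v x => 'D_(pswap v : R * R) f (pswap x : R * R))).
- by move=> y; apply: continuous_comp; [exact: continuous_pswap|case: cf => + _; apply].
- by move=> v x; rewrite -{1}(pswapK v); apply: is_derive_pswap; exact: class_C_derive cf.
- by move=> v; apply: (IH (fun x => 'D_(pswap v : R * R) f x)); case: cf => _ /(_ (pswap v))[].
Qed.

Lemma L2_pswap D f : open D -> L2 D f -> L2 (@pswap R @^-1` D) (f \o @pswap R).
Proof.
move=> oD Lf; have mD := open_measurable2 oD.
have E : (f \o @pswap R : plane -> R) \_ (@pswap R @^-1` D) = (f \_ D) \o @pswap R.
  by apply/funext => y; rewrite /= !patchE.
apply: L2_of_integrable; rewrite E.
  exact: measurableT_comp (L2_measurable Lf) (@measurable_pswap R).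
have := integrable_preserving (@measurable_pswap R) (@area_pswap R) measurableT (L2_integrable_sqr Lf).
by rewrite preimage_setT.
Qed.

Lemma test_function_pswap D phi : test_function (@pswap R @^-1` D) phi ->
  test_function D (phi \o @pswap R).
Proof.
move=> [sp [K [cK KD K0]]]; split; first by move=> k; exact: class_C_pswap.
exists (@pswap R @` K); split.
- by apply: continuous_compact => //; apply: continuous_subspaceT; exact: continuous_pswap.
- by move=> _ [y Ky <-]; exact: KD.
- by move=> y yK; apply: K0 => Ky; apply: yK; exists (pswap y) => //; rewrite pswapK.
Qed.

Lemma is_weak_deriv_pswap D v f g : open D ->
  L2 D f -> is_weak_deriv D v f g ->
  is_weak_deriv (@pswap R @^-1` D) (pswap v) (f \o @pswap R) (g \o @pswap R).
Proof.
move=> oD Lf [Lg fg]; split; first exact: L2_pswap.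
have mD := open_measurable2 oD.
have change (h : plane -> R) : measurable_fun D (EFin \o h) ->
    \int[area]_(x in @pswap R @^-1` D) h (pswap x) = \int[area]_(x in D) h x.
  move=> mh; rewrite /Rintegral.
  by rewrite -(integral_preserving (@measurable_pswap R) (@area_pswap R) mD mh).
move=> phi /[dup] tphi /test_function_pswap tp.
have cp : continuous (phi \o @pswap R) by case: (tp.1 0%N).
have cdp : continuous (fun y => 'D_v (phi \o @pswap R) y) by case: (tp.1 1%N) => _ /(_ v)[_ []].
have mM (h c : plane -> R) : L2 D h -> continuous (c : R * R -> R) ->
    measurable_fun D (EFin \o (fun y : plane => h y * c y)).
  move=> Lh cc; apply/measurable_EFinP; apply: measurable_funM.
    exact: ((measurable_restrictT h mD).2 (L2_measurable Lh)).
  by apply: measurable_funTS; exact: continuous_measurable2.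
have := fg _ tp; rewrite -(change _ (mM _ _ Lf cdp)) -(change _ (mM _ _ Lg cp)) => h.
rewrite -[RHS]/(- \int[area]_(x in @pswap R @^-1` D) (g (pswap x) * phi x)).
have <- : (\int[area]_(x in @pswap R @^-1` D) (g (pswap x) * (phi \o @pswap R) (pswap x))) =
  \int[area]_(x in @pswap R @^-1` D) (g (pswap x) * phi x).
  by apply: eq_Rintegral => y _; rewrite /= pswapK.
rewrite -h; apply: eq_Rintegral => y _ /=; congr (_ * _).
have := class_C_derive v (pswap y : R * R) (tp.1 1%N).
move=> h1; have := is_derive_pswap h1.
rewrite (_ : (phi \o _) \o _ = phi); last by apply/funext => z /=; rewrite pswapK.
by move=> [_ <-].
Qed.

End Swap.

Section CovariantGradient.
Context {R : realType}.
Local Notation plane := (measurableTypeR R * measurableTypeR R)%type.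
Local Notation n := Normc.normc.
Local Notation re := complex.Re.
Local Notation im := complex.Im.
Implicit Types (f g c phi th : R * R -> R) (v : R * R) (u : R * R -> R[i]).

Lemma weak_derivP (D : set (R * R)) v f :
  (exists g, is_weak_deriv D v f g) -> is_weak_deriv D v f (weak_deriv D v f).
Proof. by move=> [g h]; exact: (xgetPex _ (ex_intro _ g h)). Qed.

Lemma is_derive_gauge Om (y v : R * R) :
  is_derive y v (gauge Om : R * R -> R) (Om * (v.1 * y.2 + v.2 * y.1)).
Proof.
have h1 : is_derive y v (fun y : R * R => Om * y.1) (Om * v.1).
  have := is_deriveZ Om (is_derive_fst y v).
  by congr (is_derive _ _ _ _).
have := is_deriveM h1 (is_derive_snd y v).
suff -> : (Om * y.1) *: v.2 + y.2 *: (Om * v.1) = Om * (v.1 * y.2 + v.2 * y.1) by [].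
by rewrite /GRing.scale/=; ring.
Qed.

Lemma class_C_gauge Om k : class_C k (gauge Om : R * R -> R).
Proof.
apply: class_CM; last exact: class_C_snd.
by apply: class_CM; [exact: class_C_cst|exact: class_C_fst].
Qed.

Variable D : set (R * R).
Hypotheses (oD : open D) (bD : bounded_set D).
Let mD : measurable (D : set plane) := open_measurable2 oD.
Let Doo := bounded_area oD bD.

(** Real and imaginary parts of the identity for the derivative of exp(i th) w with w = f + i f',
    namely exp(i th) (w' + i th' w). *)
Lemma weak_deriv_cis th dth v f f' p p' :
  smooth th -> (forall y, is_derive y v th (dth y)) -> L2 D f -> L2 D f' ->
  is_weak_deriv D v f p -> is_weak_deriv D v f' p' ->
  is_weak_deriv D v (fun y => cos (th y) * f y - sin (th y) * f' y)
    (fun y => cos (th y) * (p y - dth y * f' y) - sin (th y) * (p' y + dth y * f y)) /\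
  is_weak_deriv D v (fun y => sin (th y) * f y + cos (th y) * f' y)
    (fun y => sin (th y) * (p y - dth y * f' y) + cos (th y) * (p' y + dth y * f y)).
Proof.
move=> sth hth Lf Lf' hp hp'.
have sc : smooth (fun y => cos (th y)).
  by move=> k; apply: (class_C_comp (smooth_sin_cos k).2); exact: sth.
have ss : smooth (fun y => sin (th y)).
  by move=> k; apply: (class_C_comp (smooth_sin_cos k).1); exact: sth.
have sns : smooth (fun y => - sin (th y)) by move=> k; apply: class_CN; exact: ss.
have dc y : is_derive y v (fun y => cos (th y)) (- sin (th y) * dth y).
  exact: is_derive_comp (is_derive_cos _) (hth y).
have ds y : is_derive y v (fun y => sin (th y)) (cos (th y) * dth y).
  exact: is_derive_comp (is_derive_sin _) (hth y).
have dns y : is_derive y v (fun y => - sin (th y)) (- (cos (th y) * dth y)).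
  exact: is_deriveN.
have cc : continuous (fun y => cos (th y)) by case: (sc 0%N).
have cs : continuous (fun y => sin (th y)) by case: (ss 0%N).
have cns : continuous (fun y => - sin (th y)) by case: (sns 0%N).
split.
- have := weak_derivD oD bD (L2M oD bD Lf cc) (L2M oD bD Lf' cns)
    (weak_derivM oD bD sc Lf hp) (weak_derivM oD bD sns Lf' hp').
  congr (is_weak_deriv _ _ _ _); apply/funext => y; first by rewrite mulNr.
  by have [_ ->] := dc y; have [_ ->] := dns y; ring.
- have := weak_derivD oD bD (L2M oD bD Lf cs) (L2M oD bD Lf' cc)
    (weak_derivM oD bD ss Lf hp) (weak_derivM oD bD sc Lf' hp').
  congr (is_weak_deriv _ _ _ _); apply/funext => y.
  by have [_ ->] := ds y; have [_ ->] := dc y; ring.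
Qed.

Lemma weak_difference_sqr1 f g (x : R * R) a s : 0 < s -> L2 D f ->
  is_weak_deriv D e1 f g ->
  (forall y, `|y.1 - x.1| <= a + s -> `|y.2 - x.2| <= a + s -> D y) ->
  (\int[area]_(y in box x a) (((f \_ D) (y + s *: e1) - (f \_ D) y) ^+ 2)%:E <=
   (s ^+ 2)%:E * \int[area]_(y in box x (a + s)) ((g \_ D) y ^+ 2)%:E)%E.
Proof.
move=> s0 Lf hfg xD; apply: le_trans (weak_difference_sqr oD Doo s0 Lf hfg xD).
rewrite le_eqVlt; apply/orP; left; apply/eqP; apply: eq_integral => y _.
suff -> : y + s *: e1 = hshift s y by [].
by rewrite /hshift /e1; congr (_ + _); rewrite /GRing.scale /=; congr (_, _);
  [exact: mulr1|exact: mulr0].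
Qed.

(** Obtained from the direction [e1] by exchanging the coordinates in the domain, the function and
    the box. *)
Lemma weak_difference_sqr2 f g (x : R * R) a s : 0 < s -> L2 D f ->
  is_weak_deriv D e2 f g ->
  (forall y, `|y.1 - x.1| <= a + s -> `|y.2 - x.2| <= a + s -> D y) ->
  (\int[area]_(y in box x a) (((f \_ D) (y + s *: e2) - (f \_ D) y) ^+ 2)%:E <=
   (s ^+ 2)%:E * \int[area]_(y in box x (a + s)) ((g \_ D) y ^+ 2)%:E)%E.
Proof.
move=> s0 Lf hfg xD.
have oD' : open (@pswap R @^-1` D : set (R * R)).
  by apply: open_comp => // y _; exact: continuous_pswap.
have Doo' : (area (@pswap R @^-1` D) < +oo)%E by rewrite area_pswap.
have := @weak_difference_sqr R _ _ _ (pswap x : R * R) a s oD' Doo' s0 (L2_pswap oD Lf)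
  (is_weak_deriv_pswap oD Lf hfg) _.
have boxE b : box (pswap x : R * R) b = @pswap R @^-1` box x b.
  by apply/seteqP; split=> y [].
rewrite !boxE => H.
have mG (h : R * R -> R) b : L2 D h ->
    measurable_fun (box x b) (fun y : plane => ((h \_ D) y ^+ 2)%:E).
  move=> Lh; apply/measurable_EFinP; apply: measurable_funTS; apply: measurable_funX.
  exact: L2_measurable Lh.
have mF : measurable_fun (box x a)
    (fun y : plane => (((f \_ D) (y + s *: e2) - (f \_ D) y) ^+ 2)%:E).
  apply/measurable_EFinP; apply: measurable_funTS; apply: measurable_funX.
  apply: measurable_funB; last exact: L2_measurable Lf.
  exact: (measurableT_comp (L2_measurable Lf) (measurable_shift _)).
rewrite -(ge0_integral_preserving (@measurable_pswap R) (@area_pswap R) (measurable_box x a) mF); last first.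
  by move=> y _; rewrite lee_fin sqr_ge0.
rewrite -(ge0_integral_preserving (@measurable_pswap R) (@area_pswap R) (measurable_box x (a + s)) (mG g _ hfg.1)); last first.
  by move=> y _; rewrite lee_fin sqr_ge0.
apply: le_trans (H _); last by move=> y h1 h2; apply: xD.
rewrite le_eqVlt; apply/orP; left; apply/eqP; apply: eq_integral => y _.
have mp z : (z \in @pswap R @^-1` D) = ((pswap z : R * R) \in D).
  by apply/idP/idP; rewrite !inE.
rewrite /hshift !patchE !mp /=.
suff -> : (pswap (y + (s, 0)) : R * R) = pswap y + s *: e2 by [].
  rewrite /pswap /e2 /= /GRing.add /= /add_pair /GRing.scale /=.
  by congr (_, _); congr (_ + _); [exact/esym/mulr0|exact/esym/mulr1].
Qed.

Variable u : R * R -> R[i].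
Hypothesis uH : csobolev_H1 D u.
Variable Om : R.
Let f y := re (u y).
Let f' y := im (u y).
Let Lf : L2 D f. Proof. by have [[]] := uH. Qed.
Let Lf' : L2 D f'. Proof. by have [_ []] := uH. Qed.

Let q1 : is_weak_deriv D e1 f (weak_deriv D e1 f).
Proof. by apply: weak_derivP; have [[_ h _] _] := uH. Qed.
Let q1' : is_weak_deriv D e1 f' (weak_deriv D e1 f').
Proof. by apply: weak_derivP; have [_ [_ h _]] := uH. Qed.
Let q2 : is_weak_deriv D e2 f (weak_deriv D e2 f).
Proof. by apply: weak_derivP; have [[_ _ h] _] := uH. Qed.
Let q2' : is_weak_deriv D e2 f' (weak_deriv D e2 f').
Proof. by apply: weak_derivP; have [_ [_ _ h]] := uH. Qed.

(** Real and imaginary parts of the two components of the covariant gradient. They have the form of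
    [weak_deriv_cis] with phase [gauge Om] for the first component and its opposite for the
    second. *)
Let a1 y := weak_deriv D e1 f y - Om * y.2 * f' y.
Let b1 y := weak_deriv D e1 f' y + Om * y.2 * f y.
Let a2 y := weak_deriv D e2 f y - - (Om * y.1) * f' y.
Let b2 y := weak_deriv D e2 f' y + - (Om * y.1) * f y.

Let normc_cov (p p' k a b : R) :
  n ((p +i* p')%C - 'i%C * (k%:C)%C * (a +i* b)%C) ^+ 2 = (p + k * b) ^+ 2 + (p' - k * a) ^+ 2.
Proof. by rewrite normc_sqr /=; congr (_ ^+ 2 + _ ^+ 2); ring. Qed.

Lemma sqmod_cov_gradE y : sqmod_cov_grad D Om u y =
  (a1 y ^+ 2 + b1 y ^+ 2) + (a2 y ^+ 2 + b2 y ^+ 2).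
Proof.
have uE : u y = (f y +i* f' y)%C by rewrite /f /f'; case: (u y).
rewrite /sqmod_cov_grad /sqmod /cweak_deriv uE !normc_cov /a1 /b1 /a2 /b2.
by congr (_ ^+ 2 + _ ^+ 2 + (_ ^+ 2 + _ ^+ 2)); rewrite /= ?mulrN ?mulNr ?opprK.
Qed.

Let c1 (k : R) : continuous (fun y : R * R => k * y.1).
Proof. by have [] := class_CM (@class_C_cst _ _ 0 k) (class_C_fst 0). Qed.
Let c2 (k : R) : continuous (fun y : R * R => k * y.2).
Proof. by have [] := class_CM (@class_C_cst _ _ 0 k) (class_C_snd 0). Qed.

Let La1 : L2 D a1.
Proof.
have := L2D q1.1 (L2M oD bD Lf' (@c2 (- Om))).
by congr (L2 _ _); apply/funext => y; rewrite /a1 !mulNr.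
Qed.
Let Lb1 : L2 D b1. Proof. exact: L2D q1'.1 (L2M oD bD Lf (@c2 Om)). Qed.
Let La2 : L2 D a2.
Proof.
have := L2D q2.1 (L2M oD bD Lf' (@c1 Om)).
by congr (L2 _ _); apply/funext => y; rewrite /a2 !mulNr opprK.
Qed.
Let Lb2 : L2 D b2.
Proof.
have := L2D q2'.1 (L2M oD bD Lf (@c1 (- Om))).
by congr (L2 _ _); apply/funext => y; rewrite /b2 !mulNr.
Qed.

Lemma L2_sqr_integrable (D' : set (R * R)) h : open D' -> L2 D' h ->
  area.-integrable D' (EFin \o (fun y : plane => h y ^+ 2)).
Proof.
move=> oD' Lh; have mD' := open_measurable2 oD'; apply/(integrable_mkcond _ mD').
apply: eq_integrable (L2_integrable_sqr Lh) => // y _.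
by rewrite /= restrict_EFin /= !patchE; case: ifP => // _; rewrite expr0n.
Qed.

Lemma sqmod_cov_grad_integrable :
  area.-integrable D (EFin \o (sqmod_cov_grad D Om u : plane -> R)).
Proof.
have := integrableD mD
  (integrableD mD (L2_sqr_integrable oD La1) (L2_sqr_integrable oD Lb1))
  (integrableD mD (L2_sqr_integrable oD La2) (L2_sqr_integrable oD Lb2)).
by apply: eq_integrable => // y _; rewrite /= sqmod_cov_gradE.
Qed.

Lemma sqmod_integrable : area.-integrable D (EFin \o (sqmod u : plane -> R)).
Proof.
have := integrableD mD (L2_sqr_integrable oD Lf) (L2_sqr_integrable oD Lf').
by apply: eq_integrable => // y _; rewrite /= /sqmod normc_sqr.
Qed.

(** Extension by zero makes translates and integrals over the plane available; the boxes on which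
    derivatives are used lie in [D]. *)
Definition ext0 (w : R * R -> R[i]) (y : plane) : R[i] := if y \in D then w y else 0.

Lemma re_ext0 w : (fun y => re (ext0 w y)) = ((fun y : plane => re (w y)) \_ D).
Proof. by apply/funext => y; rewrite /ext0 patchE; case: ifP. Qed.

Lemma im_ext0 w : (fun y => im (ext0 w y)) = ((fun y : plane => im (w y)) \_ D).
Proof. by apply/funext => y; rewrite /ext0 patchE; case: ifP. Qed.

Lemma sqi_ext0 : sqi (ext0 u).
Proof.
split; first by split; [rewrite re_ext0|rewrite im_ext0]; exact: L2_measurable.
have := integrable_patch mD sqmod_integrable.
apply: eq_integrable => // y _.
rewrite /= patchE /ext0; case: ifP => // _.
by rewrite Normc.normc0 expr0n.
Qed.

Let increment (W : R * R -> R[i]) (e : R * R) (g g' : R * R -> R) x a s :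
  0 < s -> L2 D g -> L2 D g' ->
  (forall y, `|y.1 - x.1| <= a + s -> `|y.2 - x.2| <= a + s -> D y) ->
  (\int[area]_(y in box x a) ((((fun y => re (W y)) \_ D) (y + s *: e) - ((fun y => re (W y)) \_ D) y) ^+ 2)%:E <=
   (s ^+ 2)%:E * \int[area]_(y in box x (a + s)) ((g \_ D) y ^+ 2)%:E)%E ->
  (\int[area]_(y in box x a) ((((fun y => im (W y)) \_ D) (y + s *: e) - ((fun y => im (W y)) \_ D) y) ^+ 2)%:E <=
   (s ^+ 2)%:E * \int[area]_(y in box x (a + s)) ((g' \_ D) y ^+ 2)%:E)%E ->
  sqi (ext0 W) ->
  (forall y, g y ^+ 2 + g' y ^+ 2 <= sqmod_cov_grad D Om u y) ->
  \int[area]_(y in box x a) incr (ext0 W) e s y <=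
  s ^+ 2 * \int[area]_(y in box x (a + s)) sqmod_cov_grad D Om u y.
Proof.
move=> s0 Lg Lg' xD h1 h2 sW hg.
have mb b := measurable_box x b.
have bsub : box x (a + s) `<=` D by move=> y /boxP[y1 y2]; apply: xD; exact: ltW.
have iinc := integrableTS (mb a) (incr_integrable e sW s).
have iG : area.-integrable (box x (a + s)) (EFin \o (sqmod_cov_grad D Om u : plane -> R)).
  exact: integrableS sqmod_cov_grad_integrable.
rewrite -lee_fin EFinM -!integral_EFin_Rintegral//.
have mre : measurable_fun setT ((fun y : plane => re (W y)) \_ D).
  by have [[+ _] _] := sW; rewrite re_ext0.
have mim : measurable_fun setT ((fun y : plane => im (W y)) \_ D).
  by have [[_ +] _] := sW; rewrite im_ext0.
have msh (h : plane -> R) b : measurable_fun setT h ->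
    measurable_fun (box x b) (fun y : plane => ((h (y + s *: e) - h y) ^+ 2)%:E).
  move=> mh; apply/measurable_EFinP; apply: measurable_funTS; apply: measurable_funX.
  by apply: measurable_funB => //; exact: (measurableT_comp mh (measurable_shift _)).
have msq (h : R * R -> R) : L2 D h ->
    measurable_fun (box x (a + s)) (fun y : plane => ((h \_ D) y ^+ 2)%:E).
  move=> Lh; apply/measurable_EFinP; apply: measurable_funTS; apply: measurable_funX.
  exact: L2_measurable Lh.
have -> : (\int[area]_(y in box x a) (incr (ext0 W) e s y)%:E =
    \int[area]_(y in box x a) ((((fun y => re (W y)) \_ D) (y + s *: e) - ((fun y => re (W y)) \_ D) y) ^+ 2)%:E +
    \int[area]_(y in box x a) ((((fun y => im (W y)) \_ D) (y + s *: e) - ((fun y => im (W y)) \_ D) y) ^+ 2)%:E)%E.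
  rewrite -ge0_integralD//; first last.
  - exact: msh.
  - by move=> y _; rewrite lee_fin sqr_ge0.
  - exact: msh.
  - by move=> y _; rewrite lee_fin sqr_ge0.
  apply: eq_integral => y _; rewrite -EFinD /incr normc_sqr; congr (_%:E).
  rewrite -re_ext0 -im_ext0.
  by case: (ext0 W (y + _)) => p q; case: (ext0 W y) => p' q' /=.
apply: le_trans (leeD h1 h2) _.
rewrite -muleDr//; last first.
  by apply: ge0_adde_def; rewrite inE; apply: integral_ge0 => y _; rewrite lee_fin sqr_ge0.
rewrite lee_pmul2l// ?lte_fin ?exprn_gt0//.
rewrite -ge0_integralD//; first last.
- exact: msq.
- by move=> y _; rewrite lee_fin sqr_ge0.
- exact: msq.
- by move=> y _; rewrite lee_fin sqr_ge0.
apply: ge0_le_integral => //.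
- by move=> y _; rewrite -EFinD lee_fin addr_ge0 ?sqr_ge0.
- by apply: emeasurable_funD; exact: msq.
- by have /integrableP[] := iG.
move=> y yb; have yD : y \in D by rewrite inE; exact: bsub.
by rewrite -EFinD lee_fin !patchE yD; exact: hg.
Qed.

(** A unit phase rotates the pair of real and imaginary parts and keeps the sum of their squares.
    The weak derivative of the gauged function is therefore controlled by the covariant gradient. *)
Let increment_cis (th dth : R * R -> R) e p p' (x : R * R) a s : 0 < s ->
  smooth th -> (forall y, is_derive y e th (dth y)) ->
  is_weak_deriv D e f p -> is_weak_deriv D e f' p' ->
  (forall g h, L2 D g -> is_weak_deriv D e g h ->
     (\int[area]_(y in box x a) (((g \_ D) (y + s *: e) - (g \_ D) y) ^+ 2)%:E <=
     (s ^+ 2)%:E * \int[area]_(y in box x (a + s)) ((h \_ D) y ^+ 2)%:E)%E) ->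
  (forall y, (p y - dth y * f' y) ^+ 2 + (p' y + dth y * f y) ^+ 2 <= sqmod_cov_grad D Om u y) ->
  (forall y, `|y.1 - x.1| <= a + s -> `|y.2 - x.2| <= a + s -> D y) ->
  \int[area]_(y in box x a) incr (fun y => cis (th y) * ext0 u y) e s y <=
  s ^+ 2 * \int[area]_(y in box x (a + s)) sqmod_cov_grad D Om u y.
Proof.
move=> s0 sg dg hp hp' wd hcov xD.
have [w1 w2] := weak_deriv_cis sg dg Lf Lf' hp hp'.
have gE y : cis (th y) * ext0 u y = ext0 (fun y => cis (th y) * u y) y.
  by rewrite /ext0; case: ifP => //; rewrite mulr0.
have -> : (fun y => cis (th y) * ext0 u y) = ext0 (fun y => cis (th y) * u y).
  exact/funext.
have reE : (fun y : R * R => re (cis (th y) * u y)) =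
    (fun y => cos (th y) * f y - sin (th y) * f' y).
  by apply/funext => y; rewrite /f /f'; case: (u y).
have imE : (fun y : R * R => im (cis (th y) * u y)) =
    (fun y => sin (th y) * f y + cos (th y) * f' y).
  by apply/funext => y; rewrite /f /f'; case: (u y) => r r' /=; rewrite addrC.
have cc : continuous (fun y : R * R => cos (th y)).
  by have [] := class_C_comp (smooth_sin_cos 0).2 (sg 0%N).
have cs : continuous (fun y : R * R => sin (th y)).
  by have [] := class_C_comp (smooth_sin_cos 0).1 (sg 0%N).
have cns : continuous (fun y : R * R => - sin (th y)).
  by move=> y; apply: cvgN; exact: cs.
have Lre : L2 D (fun y : R * R => cos (th y) * f y - sin (th y) * f' y).
  have := L2D (L2M oD bD Lf cc) (L2M oD bD Lf' cns).
  by congr (L2 _ _); apply/funext => y; rewrite mulNr.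
have Lim : L2 D (fun y : R * R => sin (th y) * f y + cos (th y) * f' y).
  exact: L2D (L2M oD bD Lf cs) (L2M oD bD Lf' cc).
apply: (increment s0 w1.1 w2.1 xD).
- by rewrite reE; exact: wd.
- by rewrite imE; exact: wd.
- have mth : measurable_fun setT (th : plane -> R).
    by apply: continuous_measurable2; case: (sg 0%N).
  have := sqiM (cmeas_cis mth) _ sqi_ext0.
  have -> : (fun y : plane => cis (th y) * ext0 u y) = ext0 (fun y => cis (th y) * u y).
    exact/funext.
  by apply=> y; rewrite normc_cis ler1n.
move=> y; apply: le_trans (hcov y).
have := cos2Dsin2 (th y).
move: (cos _) (sin _) (p y - _) (p' y + _) => c s' r r' h.
have -> : (c * r - s' * r') ^+ 2 + (s' * r + c * r') ^+ 2 = (c ^+ 2 + s' ^+ 2) * (r ^+ 2 + r' ^+ 2).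
  by ring.
by rewrite h mul1r.
Qed.

Lemma increment1 (x : R * R) a s : 0 < s ->
  (forall y, `|y.1 - x.1| <= a + s -> `|y.2 - x.2| <= a + s -> D y) ->
  \int[area]_(y in box x a) incr (gauged1 Om (ext0 u)) e1 s y <=
  s ^+ 2 * \int[area]_(y in box x (a + s)) sqmod_cov_grad D Om u y.
Proof.
move=> s0 xD.
apply: (@increment_cis (gauge Om) (fun y => Om * y.2) _ _ _ _ _ _ s0 _ _ q1 q1') => //.
- by move=> k; exact: class_C_gauge.
- by move=> y; have := is_derive_gauge Om y e1; rewrite /e1/= mul1r mul0r addr0.
- by move=> g h Lg hgh; exact: weak_difference_sqr1.
by move=> y; rewrite sqmod_cov_gradE lerDl addr_ge0// sqr_ge0.
Qed.

Lemma increment2 (x : R * R) a s : 0 < s ->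
  (forall y, `|y.1 - x.1| <= a + s -> `|y.2 - x.2| <= a + s -> D y) ->
  \int[area]_(y in box x a) incr (gauged2 Om (ext0 u)) e2 s y <=
  s ^+ 2 * \int[area]_(y in box x (a + s)) sqmod_cov_grad D Om u y.
Proof.
move=> s0 xD.
apply: (@increment_cis (fun y => - gauge Om y) (fun y => - (Om * y.1)) _ _ _ _ _ _ s0 _ _ q2 q2') => //.
- by move=> k; apply: class_CN; exact: class_C_gauge.
- move=> y; have := is_deriveN (is_derive_gauge Om y e2).
  by rewrite /e2/= mul1r mul0r add0r.
- by move=> g h Lg hgh; exact: weak_difference_sqr2.
by move=> y; rewrite sqmod_cov_gradE lerDr addr_ge0// sqr_ge0.
Qed.

End CovariantGradient.

(** * Classical derivatives *)

Section ClassicalDerivatives.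
Context {R : realType}.
Local Notation plane := (measurableTypeR R * measurableTypeR R)%type.
Local Notation re := complex.Re.
Local Notation im := complex.Im.
Implicit Types (f g h phi : R * R -> R) (v : R * R) (D : set (R * R)).

Lemma mean_value_dir h v y (s : R) : class_C 1 h -> 0 < s ->
  exists2 c : R, 0 <= c <= s & h (y + s *: v) - h y = 'D_v h (y + c *: v) * s.
Proof.
move=> ch s0.
have dF (t : R) : is_derive t 1 (fun r : R => h (y + r *: v)) ('D_v h (y + t *: v)).
  have := class_C_derive v (y + t *: v) ch => /is_derive_line H.
  have d1 : is_derive t 1 (fun r : R => r - t) 1.
    by have := is_deriveD (is_derive_id t 1) (is_derive_cst (- t) t 1); rewrite addr0.
  have H' : is_derive (t - t) 1 (fun r : R => h (r *: v + (y + t *: v))) ('D_v h (y + t *: v)).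
    by rewrite subrr.
  have := @is_derive_comp _ _ (fun r : R => h (r *: v + (y + t *: v))) (fun r : R => r - t) t 1 _ _ H' d1; rewrite mulr1; congr (is_derive _ _ _ _).
  by apply/funext => r /=; rewrite addrCA -scalerDl subrK.
have cF : {within `[0, s], continuous (fun r : R => h (y + r *: v))}.
  by apply: continuous_subspaceT; exact: is_derive_continuous1 dF.
have [c + e] := MVT_segment (ltW s0) (fun t _ => dF t) cF.
by rewrite in_itv/= => cs; exists c => //; move: e; rewrite scale0r addr0 subr0.
Qed.

Lemma bounded_ball (B : R) : bounded_set [set y : R * R | `|y| <= B].
Proof.
exists B; split; first exact: num_real.
by move=> M BM y /= /le_trans; apply; exact: ltW.
Qed.

Lemma L2_continuous D f : open D -> bounded_set D -> continuous f -> L2 D f.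
Proof.
move=> oD bD cf; have mD := open_measurable2 oD.
have L1 : L2 D (fun=> 1).
  have E : (fun=> 1 : R) \_ D = (\1_D : plane -> R).
    by apply/funext => y; rewrite patchE indicE; case: ifP.
  apply: L2_of_integrable; rewrite E; first exact: measurable_indic.
  apply: (eq_integrable measurableT (EFin \o (\1_D : plane -> R))).
    by move=> y _; rewrite /= indicE; case: (_ \in _); rewrite ?expr1n ?expr0n.
  have iD : area.-integrable D (EFin \o (fun=> 1 : R)).
    have [M _ hM] := bounded_sub_box bD.
    apply: (integrableS (measurable_box 0 M)) => //.
      by move=> y /hM[y1 y2]; apply/boxP; rewrite !subr0.
    by apply: (@integrable_box _ _ _ _ 1) => // y; rewrite normr1.
  have := integrable_patch mD iD; congr (_.-integrable _ _).
  by apply/funext => y; rewrite /= patchE indicE; case: ifP.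
have := L2M oD bD L1 cf; congr (L2 _ _); apply/funext => y; exact: mulr1.
Qed.

Lemma open_box (r : R) : 0 < r -> open (box 0 r : set (R * R)).
Proof.
move=> r0; apply: openI; apply: open_comp => [y _|]; try exact: ball_open.
  exact: cvg_fst.
exact: cvg_snd.
Qed.

Lemma bounded_box (r : R) : bounded_set (box 0 r : set (R * R)).
Proof.
exists r; split; first exact: num_real.
move=> M rM y /boxP; rewrite !subr0 /= prod_normE ge_max => -[y1 y2].
by rewrite !ltW// (lt_trans _ rM).
Qed.

(* The difference quotients of h have integral zero, by translation
   invariance. *)
Lemma Rintegral_derive0 h v (K : set (R * R)) : class_C 1 h -> compact K ->
  (forall y, ~ K y -> h y = 0) -> \int[area]_y 'D_v h y = 0.
Proof.
move=> ch cK hK.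
have cdh : continuous (fun y => 'D_v h y) by case: ch => _ /(_ v)[_ []].
have ch0 : continuous h by case: ch.
have [B0 [_ hB]] := compact_bounded cK.
(* The steps [c k] are at most 1, so all quotients vanish outside the box of half-side B + 1, and
   the mean value points attached to this box stay in the ball of radius B + 1 + |v|, where [M]
   bounds the derivative. *)
pose B := `|B0| + 1 + `|v|.
have KB y : K y -> `|y| <= `|B0| + 1.
  by apply: hB; rewrite (le_lt_trans (ler_norm B0))// ltrDl.
have [M M0 hM] := continuous_bounded (bounded_ball (B + 1 + `|v|)) cdh.
pose c (k : nat) : R := k.+1%:R^-1.
have c0 k : 0 < c k by rewrite invr_gt0.
have c1 k : c k <= 1 by rewrite invf_le1// ler1n.
pose q k (y : plane) : R := (c k)^-1 * (h (y + c k *: v) - h y).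
have qE k y : exists2 r : R, 0 <= r <= c k & q k y = 'D_v h (y + r *: v).
  have [r rc e] := mean_value_dir v y ch (c0 k); exists r => //.
  by rewrite /q e mulrCA mulVf ?mulr1// gt_eqF.
have nv r : 0 <= r <= 1 -> `|r *: v| <= `|v|.
  by move=> /andP[r0 r1]; rewrite normrZ ger0_norm// ler_piMl.
have mh : measurable_fun setT (h : plane -> R) by exact: continuous_measurable2.
have bh y : `|h y| <= 1 + `|h y| by rewrite lerDr.
have B1 : 0 < B + 1 by rewrite /B addrAC ltr_wpDr// ltr_wpDl.
have ih : area.-integrable setT (EFin \o (h : plane -> R)).
  have -> : (h : plane -> R) = (h : plane -> R) \_ (box 0 (B + 1)).
    apply/funext => y; rewrite patchE; case: ifPn => // /negP yb.
    apply: hK => /KB yB; apply: yb; rewrite inE; apply/boxP; rewrite !subr0.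
    have : `|y| < B + 1.
      by apply: le_lt_trans yB _; rewrite /B -!addrA ltrD2l ltr_pwDr.
    by rewrite prod_normE gt_max => /andP.
  apply: integrable_patch; first exact: measurable_box.
  apply: integrable_L2; [exact: open_box|exact: bounded_box|].
  by apply: L2_continuous => //; [exact: open_box|exact: bounded_box].
have iq k : \int[area]_y q k y = 0.
  rewrite RintegralZl//; last first.
    by have := integrableB measurableT (integrable_shift (c k *: v) ih) ih.
  rewrite RintegralB//; last exact: integrable_shift.
  rewrite /Rintegral (integral_shift (c k *: v) (f := EFin \o (h : plane -> R))).
    by rewrite subrr mulr0.
  exact/measurable_EFinP.
have cvq : (\int[area]_y (q k y)%:E @[k --> \oo] --> \int[area]_y ('D_v h y)%:E)%E.
  apply: (@dominated_cvg _ _ _ _ _ _ _ _ (fun y => (M * \1_(box 0 (B + 1)) y)%:E)) => //.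
  - move=> k; apply/measurable_EFinP; apply: measurable_funM => //.
    by apply: measurable_funB => //; exact: (measurableT_comp mh (measurable_shift _)).
  - move=> y _; apply: cvg_EFin; first by near=> k.
    apply/cvgrPdist_lt => e e0.
    have /cvgrPdist_lt/(_ e e0) := cdh y.
    move=> /nbhs_ballP[d /= d0 hd].
    near=> k; have [r /andP[r0 rc] ->] := qE k y; apply: hd.
    rewrite -ball_normE /ball_/= opprD addNKr normrN normrZ ger0_norm//.
    apply: le_lt_trans (_ : c k * (`|v| + 1) < d).
      by rewrite ler_pM// lerDl.
    rewrite -ltr_pdivlMr ?ltr_wpDl//; near: k.
    have e1 : 0 < d / (`|v| + 1) by rewrite divr_gt0// ltr_wpDl.
    exact: (near_infty_natSinv_lt (PosNum e1)).
  - have iD : area.-integrable (box 0 (B + 1)) (EFin \o (fun=> M : R)).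
      by apply: (@integrable_box _ _ _ _ `|M|).
    have := integrable_patch (measurable_box _ _) iD; congr (_.-integrable _ _).
    by apply/funext => y; rewrite /= patchE indicE; case: ifP; rewrite ?mulr1 ?mulr0.
  - move=> k y _; rewrite /= lee_fin indicE; have [yb|/negP yb] := boolP (y \in _).
      have [r /andP[r0 rc] ->] := qE k y; rewrite mulr1; apply: hM.
      rewrite /= (le_trans (ler_normD _ _))// lerD//; last first.
        by apply: nv; rewrite r0 (le_trans rc).
      move: yb; rewrite inE => /boxP; rewrite !subr0 prod_normE ge_max => -[? ?].
      by rewrite !ltW.
    have yB : B + 1 <= `|y|.
      rewrite leNgt; apply/negP => yB; apply: yb; rewrite inE; apply/boxP.
      by move: yB; rewrite !subr0 prod_normE gt_max => /andP.
    rewrite mulr0 /q !hK ?subrr ?mulr0 ?normr0//.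
      by move=> /KB; move: yB (normr_ge0 v); rewrite /B; lra.
    move=> /KB; have := nv (c k); rewrite c1 ltW// => /(_ isT).
    have := ler_normB (y + c k *: v) (c k *: v); rewrite addrK.
    by move: yB; rewrite /B; lra.
have : (\int[area]_y (q k y)%:E @[k --> \oo] --> 0)%E.
  rewrite (_ : (fun k => _) = cst 0%E); first exact: cvg_cst.
  apply/funext => k; rewrite integral_EFin_Rintegral//; first by rewrite iq.
  have := integrableZl measurableT (c k)^-1
    (integrableB measurableT (integrable_shift (c k *: v) ih) ih).
  exact: eq_integrable.
move=> /(cvg_unique _ cvq) => H.
by rewrite /Rintegral H.
Unshelve. all: by end_near. Qed.

Lemma derive_out phi v (K : set (R * R)) y : compact K ->
  (forall y, ~ K y -> phi y = 0) -> ~ K y -> 'D_v phi y = 0.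
Proof.
move=> cK K0 yK; rewrite (@near_eq_derive _ _ _ phi (cst 0)) ?derive_cst//.
have oK : open (~` K) by apply: closed_openC; exact: compact_closed.
by near=> z; apply: K0; near: z; exact: (open_nbhs_nbhs (conj oK yK)).
Unshelve. all: by end_near. Qed.

(** The product of f and a test function has compact support in [D], so its derivative has integral
    zero; the product rule gives the claim. *)
Lemma class_C1_weak_deriv D f v : open D -> bounded_set D -> class_C 1 f ->
  is_weak_deriv D v f (fun y => 'D_v f y).
Proof.
move=> oD bD cf; have mD := open_measurable2 oD.
have cdf : continuous (fun y => 'D_v f y) by case: cf => _ /(_ v)[_ []].
have Lf : L2 D f by apply: L2_continuous => //; case: cf.
have Ldf : L2 D (fun y => 'D_v f y) by exact: L2_continuous.
split=> // phi [sp [K [cK KD K0]]].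
have cp : continuous phi by case: (sp 0%N).
have cdp : continuous (fun y => 'D_v phi y) by case: (sp 1%N) => _ /(_ v)[_ []].
have dE y : 'D_v (fun y => f y * phi y) y = f y * 'D_v phi y + 'D_v f y * phi y.
  have := is_deriveM (class_C_derive v y cf) (class_C_derive v y (sp 1%N)) => -[_ ->].
  by congr (_ + _); rewrite /GRing.scale/= mulrC.
have := @Rintegral_derive0 (fun y => f y * phi y) v K (class_CM cf (sp 1%N)) cK _.
have -> : \int[area]_y 'D_v (fun y => f y * phi y) y =
    \int[area]_(y in D) (f y * 'D_v phi y + 'D_v f y * phi y).
  rewrite [RHS]Rintegral_mkcond; apply: eq_Rintegral => y _.
  rewrite patchE; case: ifPn => [yD|/negP yD]; first exact: dE.
  have yK : ~ K y by move=> /KD h; apply: yD; rewrite inE.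
  by rewrite dE K0// (@derive_out phi v K y cK K0 yK) !mulr0 addr0.
rewrite RintegralD//; [|exact: L2_integrableM|exact: L2_integrableM].
move=> H; apply/eqP; rewrite -addr_eq0; apply/eqP; apply: H => y /K0 ->.
exact: mulr0.
Qed.

(** Counterpart of [sqmod_cov_grad] for f + i f', with classical derivatives. *)
Definition cov_grad (Om : R) f f' (y : R * R) : R :=
  (('D_e1 f y - Om * y.2 * f' y) ^+ 2 + ('D_e1 f' y + Om * y.2 * f y) ^+ 2) +
  (('D_e2 f y - - (Om * y.1) * f' y) ^+ 2 + ('D_e2 f' y + - (Om * y.1) * f y) ^+ 2).

Lemma class_C1_H1 D f : open D -> bounded_set D -> class_C 1 f -> sobolev_H1 D f.
Proof.
move=> oD bD cf; split; first by apply: L2_continuous => //; case: cf.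
  by exists (fun y => 'D_e1 f y); exact: class_C1_weak_deriv.
by exists (fun y => 'D_e2 f y); exact: class_C1_weak_deriv.
Qed.

(** [weak_deriv] is an arbitrary choice among the weak derivatives, so it is compared with the
    classical one only up to a null set. *)
Lemma ae_weak_deriv D f v : open D -> bounded_set D -> class_C 1 f ->
  {ae area, forall y, D y -> weak_deriv D v f y = 'D_v f y}.
Proof.
move=> oD bD cf; have w := class_C1_weak_deriv v oD bD cf.
apply: (weak_deriv_unique oD (bounded_area oD bD) _ w).
by apply: weak_derivP; exists (fun y => 'D_v f y).
Qed.

Lemma ae_cov_grad D (Om : R) f f' (u : R * R -> R[i]) : open D -> bounded_set D ->
  class_C 1 f -> class_C 1 f' -> (forall y, u y = (f y +i* f' y)%C) ->
  {ae area, forall y, D y -> sqmod_cov_grad D Om u y = cov_grad Om f f' y}.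
Proof.
move=> oD bD cf cf' uE.
have h1 := ae_weak_deriv e1 oD bD cf; have h2 := ae_weak_deriv e1 oD bD cf'.
have h3 := ae_weak_deriv e2 oD bD cf; have h4 := ae_weak_deriv e2 oD bD cf'.
have F : Filter (nbhs (almost_everywhere (@area R))) := ae_filter_ringOfSetsType (@area R).
have h := @filterI _ _ F _ _ (@filterI _ _ F _ _ h1 h2) (@filterI _ _ F _ _ h3 h4).
apply: (@filterS _ _ F _ _ _ h) => y /= [] [k1 k2] [k3 k4] Dy; rewrite sqmod_cov_gradE /cov_grad.
have -> : (fun y => re (u y)) = f by apply/funext => z; rewrite uE.
have -> : (fun y => im (u y)) = f' by apply/funext => z; rewrite uE.
by rewrite uE /= k1// k2// k3// k4.
Qed.

End ClassicalDerivatives.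

(** * Striped competitors *)

Section Stripes.
Context {R : realType}.
Local Notation plane := (measurableTypeR R * measurableTypeR R)%type.
Local Notation re := complex.Re.
Local Notation im := complex.Im.

Lemma derive0_constant (P h : R -> R) (a b : R) : a <= b ->
  (forall z : R, is_derive z 1 P (h z)) -> (forall z, a <= z <= b -> h z = 0) -> P a = P b.
Proof.
move=> ab dP h0.
have [c + e] := MVT_segment ab (fun z _ => dP z) (continuous_subspaceT (is_derive_continuous1 dP)).
by rewrite in_itv/= => /h0 hc; move: e; rewrite hc mul0r => /eqP; rewrite subr_eq0 => /eqP.
Qed.

(** The normalized primitive of a bump on [0, 1/2]. The sine and cosine of one angle will be the
    moduli of the two components, so that the constraint |u1|^2 + |u2|^2 = 1 holds exactly through
    the transitions. *)
Lemma exists_angle : exists th dth : R -> R, exists L : R,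
  [/\ 0 <= L, forall z : R, is_derive z 1 th (dth z), continuous dth &
   [/\ forall z, z <= 0 -> th z = 0 /\ dth z = 0,
       forall z, 2^-1 <= z -> th z = pi / 2 /\ dth z = 0 &
       forall z, `|dth z| <= L]].
Proof.
pose h : R -> R := bump 0 2^-1 1.
have ch : continuous h by have [] := smooth_bump (0 : R) 2^-1 1 0.
have h1 z : 0 <= h z <= 1 by exact: bump_itv01.
have hl z : z <= 0 -> h z = 0 by move=> z0; apply: bump_out; rewrite ltNge z0.
have hr z : 2^-1 <= z -> h z = 0.
  by move=> z0; apply: bump_out; rewrite [z < _]ltNge z0 andbF.
have [P dP] := exists_primitive ch hl.
have Pl z : z <= 0 -> P z = P 0.
  by move=> z0; apply: (derive0_constant z0 dP) => y /andP[_ /hl].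
have Pr z : 2^-1 <= z -> P z = P 2^-1.
  by move=> z0; apply/esym/(derive0_constant z0 dP) => y /andP[/hr].
have dpos : 0 < P 2^-1 - P 0.
  have [c] := MVT (ltac:(by rewrite invr_gt0) : (0 : R) < 2^-1) (fun z _ => dP z)
    (continuous_subspaceT (is_derive_continuous1 dP)).
  rewrite in_itv/= => /andP[c0 c1] ->; rewrite subr0 mulr_gt0 ?invr_gt0//.
  rewrite /h /bump subr_gt0 expR_lt1 oppr_lt0 mul1r mulr_gt0// /flat !subr_gt0.
    by rewrite c0 expr0 mul1r expR_gt0.
  by rewrite c1 expr0 mul1r expR_gt0.
(* Normalization to a total variation of pi / 2; it also bounds the derivative, as the bump takes
   values in [0, 1]. *)
pose k := pi / 2 / (P 2^-1 - P 0).
have k0 : 0 <= k by rewrite !divr_ge0 ?pi_ge0// ltW.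
exists (fun z => k * (P z - P 0)), (fun z => k * h z), k; split=> //.
- move=> z; have := is_deriveZ k (is_deriveB (dP z) (is_derive_cst (P 0) z 1)).
  by rewrite subr0.
- by move=> z; apply: cvgM; [exact: cvg_cst|exact: ch].
split=> z.
- by move=> z0; rewrite Pl// hl// subrr !mulr0.
- by move=> z0; rewrite Pr// hr// mulr0 /k divfK// gt_eqF.
have /andP[z0 z1] := h1 z.
by rewrite normrM (ger0_norm k0) (ger0_norm z0) ler_piMr.
Qed.

Variables (th dth : R -> R) (L : R).
Hypothesis L0 : 0 <= L.
Hypothesis dthE : forall z : R, is_derive z 1 th (dth z).
Hypothesis cdth : continuous dth.
Hypothesis thl : forall z, z <= 0 -> th z = 0 /\ dth z = 0.
Hypothesis thr : forall z, 2^-1 <= z -> th z = pi / 2 /\ dth z = 0.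
Hypothesis dthL : forall z, `|dth z| <= L.

Let class_th : class_C 1 th.
Proof. by apply: (class_CS1 dthE); split. Qed.

(* The modulus of the first component between two slots at distance M, and that
   of the second one in a slot. *)
Definition profile1 (M z : R) : R := sin (th z) * sin (th (M - z)).
Definition dprofile1 (M z : R) : R :=
  cos (th z) * dth z * sin (th (M - z)) - sin (th z) * (cos (th (M - z)) * dth (M - z)).
Definition profile2 (z : R) : R := cos (th z) * cos (th (- z)).
Definition dprofile2 (z : R) : R :=
  - sin (th z) * dth z * cos (th (- z)) + cos (th z) * (sin (th (- z)) * dth (- z)).

Let d_refl (c z : R) : is_derive z 1 (fun z : R => th (c - z)) (- dth (c - z)).
Proof.
have d1 : is_derive z 1 (fun z : R => c - z) (-1).
  have := is_deriveB (is_derive_cst c z 1) (is_derive_id z 1).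
  by rewrite sub0r.
by have := @is_derive_comp _ _ th (fun z : R => c - z) z 1 _ _ (dthE (c - z)) d1; rewrite mulrN1.
Qed.

Let class_refl c : class_C 1 (fun z : R => th (c - z)).
Proof.
apply: (class_C_comp class_th); apply: class_CD; first exact: class_C_cst.
by apply: class_CN; exact: class_C_id.
Qed.

Lemma is_derive_profile1 M (z : R) : is_derive z 1 (profile1 M) (dprofile1 M z).
Proof.
have h1 := is_derive_comp (is_derive_sin (th z)) (dthE z).
have h2 := is_derive_comp (is_derive_sin (th (M - z))) (d_refl M z).
have := is_deriveM h1 h2; rewrite /profile1 /dprofile1 => h.
apply: is_derive_eq h _; rewrite /GRing.scale /=; ring.
Qed.

Lemma is_derive_profile2 (z : R) : is_derive z 1 profile2 (dprofile2 z).
Proof.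
have h1 := is_derive_comp (is_derive_cos (th z)) (dthE z).
have h2 := is_derive_comp (is_derive_cos (th (0 - z))) (d_refl 0 z).
have := is_deriveM h1 h2; rewrite /profile2 /dprofile2 => h.
have -> : (fun z => cos (th z) * cos (th (- z))) = (fun z => cos (th z) * cos (th (0 - z))).
  by apply/funext => y; rewrite sub0r.
by apply: is_derive_eq h _; rewrite /GRing.scale /= sub0r; ring.
Qed.

Lemma class_profile1 M : class_C 1 (profile1 M).
Proof.
by apply: class_CM; apply: (class_C_comp (smooth_sin_cos 1).1).
Qed.

Lemma class_profile2 : class_C 1 profile2.
Proof.
apply: class_CM; apply: (class_C_comp (smooth_sin_cos 1).2) => //.
by have := class_refl 0; congr (class_C _ _); apply/funext => z; rewrite sub0r.
Qed.

Let sin_th0 z : z <= 0 -> sin (th z) = 0.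
Proof. by move=> /thl[-> _]; rewrite sin0. Qed.
Let sin_th1 z : 2^-1 <= z -> sin (th z) = 1.
Proof. by move=> /thr[-> _]; rewrite sin_pihalf. Qed.
Let cos_th0 z : z <= 0 -> cos (th z) = 1.
Proof. by move=> /thl[-> _]; rewrite cos0. Qed.
Let cos_th1 z : 2^-1 <= z -> cos (th z) = 0.
Proof. by move=> /thr[-> _]; rewrite cos_pihalf. Qed.

Lemma profile1_out M z : z <= 0 \/ M <= z -> profile1 M z = 0 /\ dprofile1 M z = 0.
Proof.
rewrite /profile1 /dprofile1; case=> h.
  by rewrite sin_th0// (thl h).2 !(mul0r, mulr0, subr0).
have h' : M - z <= 0 by rewrite subr_le0.
by rewrite (sin_th0 h') (thl h').2 !(mul0r, mulr0, subr0).
Qed.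

Lemma profile2_out z : 2^-1 <= `|z| -> profile2 z = 0 /\ dprofile2 z = 0.
Proof.
rewrite /profile2 /dprofile2 ler_normr => /orP[h|h].
  by rewrite cos_th1// (thr h).2 !(mul0r, mulr0, subr0, addr0).
by rewrite (cos_th1 h) (thr h).2 !(mul0r, mulr0, subr0, addr0).
Qed.

Let sin1 (q : R) : `|sin q| <= 1. Proof. by rewrite ler_norml sin_geN1 sin_le1. Qed.
Let cos1 (q : R) : `|cos q| <= 1. Proof. by rewrite ler_norml cos_geN1 cos_le1. Qed.

Let prod_le (a b c : R) : `|a| <= 1 -> `|b| <= L -> `|c| <= 1 -> `|a * b * c| <= L.
Proof.
move=> ha hb hc; rewrite !normrM -[leRHS]mulr1 -[leRHS]mul1r mulrA.
by rewrite !ler_pM// mulr_ge0.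
Qed.

Lemma profile1_bounds M z : `|profile1 M z| <= 1 /\ `|dprofile1 M z| <= 2 * L.
Proof.
split; first by rewrite /profile1 normrM mulr_ile1.
rewrite mulr_natl mulr2n (le_trans (ler_normB _ _))// lerD//; first exact: prod_le.
by rewrite mulrC; exact: prod_le.
Qed.

Lemma profile2_bounds z : `|profile2 z| <= 1 /\ `|dprofile2 z| <= 2 * L.
Proof.
split; first by rewrite /profile2 normrM mulr_ile1.
rewrite mulr_natl mulr2n (le_trans (ler_normD _ _))// lerD//.
  by apply: prod_le => //; rewrite normrN.
by rewrite mulrA mulrAC; exact: prod_le.
Qed.

(** As M >= 1, the transitions at the two ends of a cell, each of width 1/2, do not overlap: at each
    z one of the two factors of [profile1] equals 1, and the nearer slot supplies the complementary
    cosine. *)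
Lemma profile_sqr (M z : R) : 1 <= M -> 0 <= z <= M ->
  (z <= M - 2^-1 -> profile1 M z ^+ 2 + profile2 z ^+ 2 = 1) /\
  (M - 2^-1 <= z -> profile1 M z ^+ 2 + profile2 (z - M) ^+ 2 = 1).
Proof.
move=> M1 /andP[z0 zM]; split=> h; rewrite /profile1 /profile2.
  rewrite (sin_th1 (z := M - z)); last by lra.
  rewrite (cos_th0 (z := - z)); last by lra.
  by rewrite !mulr1 addrC cos2Dsin2.
rewrite (sin_th1 (z := z)); last by lra.
rewrite (cos_th0 (z := z - M)); last by lra.
by rewrite !mul1r opprB addrC cos2Dsin2.
Qed.

End Stripes.

(** * Sums of stripes with adapted phases *)

Section Cells.
Context {R : realType}.
Local Notation plane := (measurableTypeR R * measurableTypeR R)%type.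
Local Notation re := complex.Re.
Local Notation im := complex.Im.
Implicit Types (y v : R * R).

Lemma class_C_sum k (N : nat) (F : nat -> R * R -> R) :
  (forall i, class_C k (F i)) -> class_C k (fun y => \sum_(i < N) F i y).
Proof.
move=> cF; elim: N => [|N IH].
  have -> : (fun y => \sum_(i < 0) F i y) = (fun=> 0) by apply/funext => y; rewrite big_ord0.
  exact: class_C_cst.
have -> : (fun y => \sum_(i < N.+1) F i y) = (fun y => \sum_(i < N) F i y + F N y).
  by apply/funext => y; rewrite big_ord_recr.
exact: class_CD.
Qed.

Lemma derive_sum_single (N k0 : nat) (F : nat -> R * R -> R) v y : (k0 < N)%N ->
  (forall i, class_C 1 (F i)) ->
  (forall i, (i < N)%N -> i != k0 -> F i y = 0 /\ 'D_v (F i) y = 0) ->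
  \sum_(i < N) F i y = F k0 y /\ 'D_v (fun y => \sum_(i < N) F i y) y = 'D_v (F k0) y.
Proof.
move=> kN cF F0.
have one (G : nat -> R) : (forall i, (i < N)%N -> i != k0 -> G i = 0) ->
    \sum_(i < N) G i = G k0.
  move=> G0; rewrite (bigD1 (Ordinal kN))//= big1 ?addr0// => i ik.
  by apply: G0 => //; apply: contra ik => /eqP e; apply/eqP/val_inj.
split; first by apply: (one (fun i => F i y)) => i /F0 h /h[].
have -> : (fun y => \sum_(i < N) F i y) = \sum_(i < N) F i by rewrite fct_sumE.
rewrite derive_sum; last by move=> i; have [] := class_C_derive v y (cF i).
by apply: (one (fun i => 'D_v (F i) y)) => i /F0 h /h[].
Qed.

Variables (t Om : R).
Hypothesis t0 : 0 < t.

(* The covariant derivative of exp(i phase a) vanishes along e1 and is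
   - 2 i Om (y.1 - a t) times it along e2. *)
Definition phase (a : R) y : R := 2 * Om * t * a * y.2 - gauge Om y.

Definition cell_re (p : R -> R) (a : R) y : R := p (y.1 / t - a) * cos (phase a y).
Definition cell_im (p : R -> R) (a : R) y : R := p (y.1 / t - a) * sin (phase a y).

Let class_phase k a : class_C k (phase a).
Proof.
apply: class_CD; last by apply: class_CN; exact: class_C_gauge.
by apply: class_CM; [exact: class_C_cst|exact: class_C_snd].
Qed.

Let class_arg k a : class_C k (fun y : R * R => y.1 / t - a).
Proof.
apply: class_CD; last exact: class_C_cst.
by apply: class_CM; [exact: class_C_fst|exact: class_C_cst].
Qed.

Let is_derive_phase a y v :
  is_derive y v (phase a) (2 * Om * t * a * v.2 - Om * (v.1 * y.2 + v.2 * y.1)).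
Proof. by have := is_deriveB (is_deriveZ (2 * Om * t * a) (is_derive_snd y v)) (is_derive_gauge Om y v). Qed.

Let is_derive_arg a y v : is_derive y v (fun y : R * R => y.1 / t - a) (v.1 / t).
Proof.
have := is_deriveB (is_deriveZ t^-1 (is_derive_fst y v)) (is_derive_cst a y v).
rewrite subr0 /GRing.scale /= mulrC; congr (is_derive _ _ _ _).
by apply/funext => z; rewrite /= mulrC.
Qed.

Section Profile.
Variables (p dp : R -> R).
Hypotheses (dpE : forall z : R, is_derive z 1 p (dp z)) (cp : class_C 1 p).

Lemma class_cell a : class_C 1 (cell_re p a) /\ class_C 1 (cell_im p a).
Proof.
by split; apply: class_CM; (apply: (class_C_comp cp) || apply: class_C_comp) => //;
  [exact: (smooth_sin_cos 1).2|exact: (smooth_sin_cos 1).1].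
Qed.

Lemma derive_cell a y v : let dph := 2 * Om * t * a * v.2 - Om * (v.1 * y.2 + v.2 * y.1) in
  'D_v (cell_re p a) y = dp (y.1 / t - a) * (v.1 / t) * cos (phase a y) -
     p (y.1 / t - a) * sin (phase a y) * dph /\
  'D_v (cell_im p a) y = dp (y.1 / t - a) * (v.1 / t) * sin (phase a y) +
     p (y.1 / t - a) * cos (phase a y) * dph.
Proof.
move=> dph; have hp := @is_derive_comp _ _ p (fun y => y.1 / t - a) y v _ _ (dpE (y.1 / t - a)) (is_derive_arg a y v).
have hc := is_derive_comp (is_derive_cos (phase a y)) (is_derive_phase a y v).
have hs := is_derive_comp (is_derive_sin (phase a y)) (is_derive_phase a y v).
by split; [have [_ ->] := is_deriveM hp hc|have [_ ->] := is_deriveM hp hs];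
  rewrite /GRing.scale /= -/dph; ring.
Qed.

Variables (a : nat -> R) (N : nat).

Definition stripes_re y : R := \sum_(k < N) cell_re p (a k) y.
Definition stripes_im y : R := \sum_(k < N) cell_im p (a k) y.

Lemma class_stripes : class_C 1 stripes_re /\ class_C 1 stripes_im.
Proof.
split.
  by apply: (@class_C_sum _ _ (fun k => cell_re p (a k))) => i; have [] := class_cell (a i).
by apply: (@class_C_sum _ _ (fun k => cell_im p (a k))) => i; have [] := class_cell (a i).
Qed.

Variables (y : R * R) (k0 : nat).
Hypothesis kN : (k0 < N)%N.
Hypothesis single : forall k, (k < N)%N -> k != k0 ->
  p (y.1 / t - a k) = 0 /\ dp (y.1 / t - a k) = 0.

Let q := y.1 / t - a k0.

Let sre v : stripes_re y = cell_re p (a k0) y /\ 'D_v stripes_re y = 'D_v (cell_re p (a k0)) y.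
Proof.
apply: (@derive_sum_single N k0 (fun k => cell_re p (a k))) => // i.
  by have [] := class_cell (a i).
move=> iN ik; have [h1 h2] := single iN ik; have [-> _] := derive_cell (a i) y v.
by rewrite /cell_re h1 h2 !mul0r subr0.
Qed.

Let sim v : stripes_im y = cell_im p (a k0) y /\ 'D_v stripes_im y = 'D_v (cell_im p (a k0)) y.
Proof.
apply: (@derive_sum_single N k0 (fun k => cell_im p (a k))) => // i.
  by have [] := class_cell (a i).
move=> iN ik; have [h1 h2] := single iN ik; have [_ ->] := derive_cell (a i) y v.
by rewrite /cell_im h1 h2 !mul0r addr0.
Qed.

Lemma stripes_sqr : stripes_re y ^+ 2 + stripes_im y ^+ 2 = p q ^+ 2.
Proof.
rewrite (sre e1).1 (sim e1).1 /cell_re /cell_im !exprMn -mulrDr cos2Dsin2.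
exact: mulr1.
Qed.

(** Only one cell is active at y. The phase cancels the potential along e1, where the derivative of
    the modulus remains; along e2 there remains 2 Om times the distance from the axis of the
    cell. *)
Lemma stripes_cov_grad : cov_grad Om stripes_re stripes_im y =
  (dp q / t) ^+ 2 + (2 * Om * t) ^+ 2 * (q * p q) ^+ 2.
Proof.
rewrite /cov_grad (sre e1).1 (sim e1).1 (sre e1).2 (sim e1).2 (sre e2).2 (sim e2).2.
rewrite !(derive_cell _ _ _).1 !(derive_cell _ _ _).2 /cell_re /cell_im -/q.
have := cos2Dsin2 (phase (a k0) y); move: (cos _) (sin _) => c s cs.
have y1E : y.1 = t * (q + a k0) by rewrite /q; field; rewrite gt_eqF.
have -> : dp q * ((e1 : R * R).1 / t) * c - p q * s *
    (2 * Om * t * a k0 * (e1 : R * R).2 - Om * ((e1 : R * R).1 * y.2 + (e1 : R * R).2 * y.1)) -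
    Om * y.2 * (p q * s) = dp q / t * c by rewrite /e1 /=; ring.
have -> : dp q * ((e1 : R * R).1 / t) * s + p q * c *
    (2 * Om * t * a k0 * (e1 : R * R).2 - Om * ((e1 : R * R).1 * y.2 + (e1 : R * R).2 * y.1)) +
    Om * y.2 * (p q * c) = dp q / t * s by rewrite /e1 /=; ring.
have -> : dp q * ((e2 : R * R).1 / t) * c - p q * s *
    (2 * Om * t * a k0 * (e2 : R * R).2 - Om * ((e2 : R * R).1 * y.2 + (e2 : R * R).2 * y.1)) -
    - (Om * y.1) * (p q * s) = 2 * Om * t * (q * p q) * s by rewrite /e2 /= y1E; ring.
have -> : dp q * ((e2 : R * R).1 / t) * s + p q * c *
    (2 * Om * t * a k0 * (e2 : R * R).2 - Om * ((e2 : R * R).1 * y.2 + (e2 : R * R).2 * y.1)) +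
    - (Om * y.1) * (p q * c) = - (2 * Om * t * (q * p q)) * c by rewrite /e2 /= y1E; ring.
transitivity ((c ^+ 2 + s ^+ 2) * ((dp q / t) ^+ 2 + (2 * Om * t) ^+ 2 * (q * p q) ^+ 2)).
  by ring.
by rewrite cs mul1r.
Qed.

End Profile.

End Cells.

(** * A competitor with prescribed masses *)

Section Competitor.
Context {R : realType}.
Local Notation plane := (measurableTypeR R * measurableTypeR R)%type.

Lemma exists_slot (M j : nat) (w : R) : (0 < M)%N -> j%:R <= w ->
  exists k : nat, (k * M + j)%:R <= w < (k.+1 * M + j)%:R.
Proof.
move=> M0 jw; have M0' : 0 < M%:R :> R by rewrite ltr0n.
have h : 0 <= (w - j%:R) / M%:R by rewrite divr_ge0 ?subr_ge0// ltW.
exists (Num.truncn ((w - j%:R) / M%:R)).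
have /andP[h1 h2] := truncn_itv h.
move: h1 h2; rewrite ler_pdivlMr// ltr_pdivrMr// => h1 h2.
by rewrite !natrD !natrM; apply/andP; split; lra.
Qed.

Section Slots.
Variables (th dth : R -> R) (L : R).
Hypothesis L0 : 0 <= L.
Hypothesis dthE : forall z : R, is_derive z 1 th (dth z).
Hypothesis cdth : continuous dth.
Hypothesis thl : forall z, z <= 0 -> th z = 0 /\ dth z = 0.
Hypothesis thr : forall z, 2^-1 <= z -> th z = pi / 2 /\ dth z = 0.
Hypothesis dthL : forall z, `|dth z| <= L.
Variables (t Om : R) (M N c : nat).
Hypotheses (t0 : 0 < t) (M0 : (0 < M)%N).

(** Slots in units of t: they have period M and residue j, still to be chosen. The offset c allows
    all positions over the bounded domain to be indexed by natural numbers. *)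
Let a (j k : nat) : R := (k * M + j)%:R - c%:R.
Definition u1_re j := stripes_re t Om (profile1 th M%:R) (a j) N.
Definition u1_im j := stripes_im t Om (profile1 th M%:R) (a j) N.
Definition u2_re j := stripes_re t Om (profile2 th) (a j) N.
Definition u2_im j := stripes_im t Om (profile2 th) (a j) N.

Lemma class_u1 j : class_C 1 (u1_re j) /\ class_C 1 (u1_im j).
Proof. by apply: class_stripes; apply: class_profile1. Qed.

Lemma class_u2 j : class_C 1 (u2_re j) /\ class_C 1 (u2_im j).
Proof. by apply: class_stripes; apply: class_profile2. Qed.

Let nat_le (k k' : nat) : (k < k')%N -> (k%:R + 1) * M%:R <= k'%:R * M%:R :> R.
Proof. by move=> h; rewrite ler_wpM2r// natr1 ler_nat. Qed.

Let M1 : 1 <= M%:R :> R. Proof. by rewrite ler1n. Qed.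

Let aE j k (y : R * R) : y.1 / t - a j k = y.1 / t + c%:R - (k%:R * M%:R + j%:R).
Proof. by rewrite /a natrD natrM; ring. Qed.

(** The first component is active in the cell of index [k0] that contains y. The second one is
    active near the slot at the left end of this cell or near the next one, which is why k is not
    determined by the cell. *)
Lemma slots_at j (y : R * R) : (j < M)%N ->
  M%:R <= y.1 / t + c%:R -> y.1 / t + c%:R + 1 < N%:R ->
  exists z : R, exists k : nat, let z2 := y.1 / t + c%:R - (k * M + j)%:R in
  [/\ `|z| <= M%:R, profile1 th M%:R z ^+ 2 + profile2 th z2 ^+ 2 = 1,
   u1_re j y ^+ 2 + u1_im j y ^+ 2 = profile1 th M%:R z ^+ 2,
   u2_re j y ^+ 2 + u2_im j y ^+ 2 = profile2 th z2 ^+ 2 &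
   cov_grad Om (u1_re j) (u1_im j) y =
     (dprofile1 th dth M%:R z / t) ^+ 2 + (2 * Om * t) ^+ 2 * (z * profile1 th M%:R z) ^+ 2 /\
   cov_grad Om (u2_re j) (u2_im j) y =
     (dprofile2 th dth z2 / t) ^+ 2 + (2 * Om * t) ^+ 2 * (z2 * profile2 th z2) ^+ 2].
Proof.
move=> jM; set w := _ / t + _ => wM wN.
have jw : j%:R <= w by apply: le_trans wM; rewrite ler_nat ltnW.
have [k0 /andP[]] := exists_slot M0 jw; rewrite !natrD !natrM -natr1 => k1 k2.
have kw (k : nat) : k%:R <= k%:R * M%:R :> R by rewrite ler_peMr.
(* The slot at the right end of the cell must also be among the N slots, whence the margin 1 in the
   hypothesis. *)
have kN : (k0.+1 < N)%N.
  by rewrite -(ltr_nat R) -natr1; move: (kw k0) k1 wN (ler0n R j); lra.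
pose z := w - (k0%:R * M%:R + j%:R).
have s1 k : (k < N)%N -> k != k0 ->
    profile1 th M%:R (y.1 / t - a j k) = 0 /\ dprofile1 th dth M%:R (y.1 / t - a j k) = 0.
  move=> _ kk; apply: profile1_out => //; rewrite aE -/w.
  have [/nat_le h|/nat_le h|e] := ltngtP k k0; last by rewrite e eqxx in kk.
    by right; move: h k1; lra.
  by left; move: h k2; lra.
have zM : 0 <= z <= M%:R by rewrite /z; apply/andP; split; move: k1 k2; lra.
have [p1 p2] := profile_sqr thl thr M1 zM.
have q0E : y.1 / t - a j k0 = z by rewrite aE.
have d1 z := is_derive_profile1 dthE M%:R z.
have d2 z := is_derive_profile2 dthE z.
have c1 := class_profile1 dthE cdth M%:R.
have c2 := class_profile2 dthE cdth.
have main k : (k < N)%N -> (forall k', (k' < N)%N -> k' != k ->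
      2^-1 <= `|w - (k'%:R * M%:R + j%:R)|) ->
    profile1 th M%:R z ^+ 2 + profile2 th (w - (k * M + j)%:R) ^+ 2 = 1 ->
  exists z : R, exists k : nat, let z2 := w - (k * M + j)%:R in
  [/\ `|z| <= M%:R, profile1 th M%:R z ^+ 2 + profile2 th z2 ^+ 2 = 1,
   u1_re j y ^+ 2 + u1_im j y ^+ 2 = profile1 th M%:R z ^+ 2,
   u2_re j y ^+ 2 + u2_im j y ^+ 2 = profile2 th z2 ^+ 2 &
   cov_grad Om (u1_re j) (u1_im j) y =
     (dprofile1 th dth M%:R z / t) ^+ 2 + (2 * Om * t) ^+ 2 * (z * profile1 th M%:R z) ^+ 2 /\
   cov_grad Om (u2_re j) (u2_im j) y =
     (dprofile2 th dth z2 / t) ^+ 2 + (2 * Om * t) ^+ 2 * (z2 * profile2 th z2) ^+ 2].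
  move=> kN' s2' hp; exists z, k => z2.
  have s2 k' : (k' < N)%N -> k' != k ->
      profile2 th (y.1 / t - a j k') = 0 /\ dprofile2 th dth (y.1 / t - a j k') = 0.
    by move=> h1 h2; apply: (profile2_out thr); rewrite aE; exact: s2'.
  have q2E : y.1 / t - a j k = z2 by rewrite aE /z2 natrD natrM.
  split=> //; first by case/andP: zM => z0 z1; rewrite ger0_norm.
  - by rewrite /u1_re /u1_im (stripes_sqr Om d1 c1 (ltnW kN) s1) q0E.
  - by rewrite /u2_re /u2_im (stripes_sqr Om d2 c2 kN' s2) q2E.
  split.
  - by rewrite /u1_re /u1_im (stripes_cov_grad Om t0 d1 c1 (ltnW kN) s1) q0E.
  - by rewrite /u2_re /u2_im (stripes_cov_grad Om t0 d2 c2 kN' s2) q2E.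
(* Beyond M - 1/2 the slot that matters is the next one; before, it is the left one. *)
have [zh|zh] := leP z (M%:R - 2^-1).
  apply: (main k0 (ltnW kN)); last by rewrite natrD natrM; exact: p1.
  move=> k _ kk; rewrite ler_normr.
  have [/nat_le h|/nat_le h|e] := ltngtP k k0; last by rewrite e eqxx in kk.
    by apply/orP; left; move: h k1 M1; lra.
  by apply/orP; right; move: h k2 M1 zh; rewrite /z; lra.
apply: (main k0.+1 kN); last first.
  rewrite natrD natrM -natr1.
  have -> : w - ((k0%:R + 1) * M%:R + j%:R) = z - M%:R by rewrite /z; ring.
  by apply: p2; exact: ltW.
move=> k _ kk; rewrite ler_normr.
have [/nat_le h|/nat_le h|e] := ltngtP k k0.+1; last by rewrite e eqxx in kk.
  by apply/orP; left; move: h M1 zh; rewrite -natr1 /z; lra.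
by apply/orP; right; move: h k2 M1 zh; rewrite -natr1 /z; lra.
Qed.

Let K := (2 * L / t) ^+ 2 + (2 * Om * t) ^+ 2 * M%:R ^+ 2.

Let bound (p dp z : R) : `|p| <= 1 -> `|dp| <= 2 * L -> (p = 0 \/ `|z| <= M%:R) ->
  (dp / t) ^+ 2 + (2 * Om * t) ^+ 2 * (z * p) ^+ 2 <= K.
Proof.
move=> hp hdp hz; apply: lerD.
  rewrite -[leLHS]real_normK ?num_real// ler_pXn2r ?nnegrE ?divr_ge0 ?mulr_ge0 ?(ltW t0)//.
  by rewrite normrM normfV (gtr0_norm t0) ler_pM2r ?invr_gt0.
apply: ler_wpM2l; first exact: sqr_ge0.
case: hz => [->|hz]; first by rewrite mulr0 expr0n sqr_ge0.
rewrite -[leLHS]real_normK ?num_real// ler_pXn2r ?nnegrE// normrM -[leRHS]mulr1.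
exact: ler_pM.
Qed.

Lemma slots_cov_grad j (y : R * R) : (j < M)%N ->
  M%:R <= y.1 / t + c%:R -> y.1 / t + c%:R + 1 < N%:R ->
  cov_grad Om (u1_re j) (u1_im j) y <= K /\ cov_grad Om (u2_re j) (u2_im j) y <= K.
Proof.
move=> jM h1 h2; have [z [k [zM _ _ _ [-> ->]]]] := slots_at jM h1 h2.
have [p1 p2] := profile1_bounds th dthL M%:R z.
set z2 := _ - _; have [p3 p4] := profile2_bounds th dthL z2.
split; apply: bound => //; first by right.
have [h|h] := leP 2^-1 `|z2|; first by left; have [] := profile2_out thr h.
right; rewrite (le_trans (ltW h))// (le_trans _ M1)//.
by rewrite invf_le1// ler1n.
Qed.

Lemma slots_unit j (y : R * R) : (j < M)%N ->
  M%:R <= y.1 / t + c%:R -> y.1 / t + c%:R + 1 < N%:R ->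
  (u1_re j y ^+ 2 + u1_im j y ^+ 2) + (u2_re j y ^+ 2 + u2_im j y ^+ 2) = 1.
Proof. by move=> jM h1 h2; have [z [k [_ e -> -> _]]] := slots_at jM h1 h2. Qed.

(** Slots of different residues are at different integers, and the second component is supported at
    distance less than 1/2 from its slots. Hence at most one residue contributes at a given
    point. *)
Lemma slots_sum (y : R * R) :
  M%:R <= y.1 / t + c%:R -> y.1 / t + c%:R + 1 < N%:R ->
  \sum_(j < M) (u2_re j y ^+ 2 + u2_im j y ^+ 2) <= 1.
Proof.
move=> h1 h2; set S := fun j : nat => u2_re j y ^+ 2 + u2_im j y ^+ 2.
have Sz j : (j < M)%N -> exists k : nat,
    S j = profile2 th (y.1 / t + c%:R - (k * M + j)%:R) ^+ 2.
  by move=> jM; have [z [k [_ _ _ h _]]] := slots_at jM h1 h2; exists k.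
have Sn j : (j < M)%N -> S j != 0 -> exists k : nat,
    `|y.1 / t + c%:R - (k * M + j)%:R| < 2^-1.
  move=> jM; have [k ->] := Sz _ jM => Sj; exists k; rewrite ltNge; apply/negP => h.
  by move: Sj; have [-> _] := profile2_out thr h; rewrite expr0n eqxx.
have [[j0 Sj]|no] := pselect (exists j : 'I_M, S j != 0); last first.
  rewrite big1 ?ler01// => j _; apply/eqP/negPn/negP => h.
  by apply: no; exists j.
rewrite (bigD1 j0)//= big1 ?addr0.
  have [k e] := Sz _ (ltn_ord j0); rewrite -/(S j0) e.
  have [h _] := profile2_bounds th dthL (y.1 / t + c%:R - (k * M + j0)%:R).
  by rewrite -[leLHS]real_normK ?num_real// expr_le1.
move=> j jj; apply/eqP/negPn/negP => Sj'.
have [k hk] := Sn _ (ltn_ord j) Sj'; have [k' hk'] := Sn _ (ltn_ord j0) Sj.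
have lt_int (m m' : nat) : `|y.1 / t + c%:R - m%:R| < 2^-1 ->
    `|y.1 / t + c%:R - m'%:R| < 2^-1 -> (m < m'.+1)%N.
  rewrite !ltr_norml -(ltr_nat R) -[m'.+1%:R]natr1 => /andP[? ?] /andP[? ?]; lra.
have e : (k * M + j = k' * M + j0)%N.
  by apply/eqP; rewrite eqn_leq -ltnS lt_int//= -ltnS lt_int.
have : (k * M + j = k' * M + j0 %[mod M])%N by rewrite e.
rewrite !modnMDl !modn_small// => /val_inj ej.
by rewrite ej eqxx in jj.
Qed.

End Slots.

(** The covariant gradient is linear in the function; the rest is the Cauchy-Schwarz inequality with
    (a, b) of norm 1. *)
Lemma cov_grad_rotation (Om a b : R) f f' g g' y : a ^+ 2 + b ^+ 2 = 1 ->
  class_C 1 f -> class_C 1 f' -> class_C 1 g -> class_C 1 g' ->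
  cov_grad Om (fun y => a * f y + b * g y) (fun y => a * f' y + b * g' y) y <=
  cov_grad Om f f' y + cov_grad Om g g' y.
Proof.
move=> ab cf cf' cg cg'.
have dE h k v : class_C 1 h -> class_C 1 k ->
    'D_v (fun y => a * h y + b * k y) y = a * 'D_v h y + b * 'D_v k y.
  move=> ch ck; have := is_deriveD (is_deriveZ a (class_C_derive v y ch))
    (is_deriveZ b (class_C_derive v y ck)).
  by case=> _ <-.
rewrite /cov_grad !dE//.
have CS (p q : R) : (a * p + b * q) ^+ 2 <= p ^+ 2 + q ^+ 2.
  rewrite -[leRHS]mul1r -ab -subr_ge0.
  have -> : (a ^+ 2 + b ^+ 2) * (p ^+ 2 + q ^+ 2) - (a * p + b * q) ^+ 2 = (a * q - b * p) ^+ 2.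
    by ring.
  exact: sqr_ge0.
move: ('D_e1 f y) ('D_e1 f' y) ('D_e1 g y) ('D_e1 g' y) => p1 p1' q1 q1'.
move: ('D_e2 f y) ('D_e2 f' y) ('D_e2 g y) ('D_e2 g' y) => p2 p2' q2 q2'.
move: (Om * y.2) (- (Om * y.1)) => o1 o2.
have := CS (p1 - o1 * f' y) (q1 - o1 * g' y); have := CS (p1' + o1 * f y) (q1' + o1 * g y).
have := CS (p2 - o2 * f' y) (q2 - o2 * g' y); have := CS (p2' + o2 * f y) (q2' + o2 * g y).
have -> : a * (p1 - o1 * f' y) + b * (q1 - o1 * g' y) = a * p1 + b * q1 - o1 * (a * f' y + b * g' y) by ring.
have -> : a * (p1' + o1 * f y) + b * (q1' + o1 * g y) = a * p1' + b * q1' + o1 * (a * f y + b * g y) by ring.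
have -> : a * (p2 - o2 * f' y) + b * (q2 - o2 * g' y) = a * p2 + b * q2 - o2 * (a * f' y + b * g' y) by ring.
have -> : a * (p2' + o2 * f y) + b * (q2' + o2 * g y) = a * p2' + b * q2' + o2 * (a * f y + b * g y) by ring.
by clear; lra.
Qed.

Lemma pigeonhole_le (M : nat) (S : nat -> R) (A : R) : (0 < M)%N ->
  \sum_(j < M) S j <= A -> exists2 j : nat, (j < M)%N & S j <= A / M%:R.
Proof.
move=> M0 hS; apply: contrapT => h.
have : \sum_(j < M) (A / M%:R) < \sum_(j < M) S j.
  apply: ltr_sum; first by apply/hasP; exists (Ordinal M0) => //; rewrite mem_index_enum.
  by move=> j _; rewrite ltNge; apply/negP => hj; apply: h; exists j.
rewrite sumr_const card_ord -[_ *+ M]mulr_natr divfK ?pnatr_eq0 -?lt0n//.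
by rewrite ltNge hS.
Qed.

(** Intermediate value theorem: rotating by an angle from 0 to pi / 2 moves the mass of the first
    component from m1 to m2, c being the integral of the cross term. *)
Lemma rotation_mass (m1 m2 c m : R) : m2 <= m <= m1 ->
  exists g : R, cos g ^+ 2 * m1 + sin g ^+ 2 * m2 + 2 * (cos g * sin g) * c = m.
Proof.
move=> /andP[h2 h1].
pose F (g : R) := cos g ^+ 2 * m1 + sin g ^+ 2 * m2 + 2 * (cos g * sin g) * c.
have cF : continuous F.
  move=> g; apply: cvgD; first apply: cvgD.
  - by apply: cvgM; [apply: cvgM; exact: continuous_cos|exact: cvg_cst].
  - by apply: cvgM; [apply: cvgM; exact: continuous_sin|exact: cvg_cst].
  - apply: cvgM; last exact: cvg_cst.
    apply: cvgM; first exact: cvg_cst.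
    by apply: cvgM; [exact: continuous_cos|exact: continuous_sin].
have pi0 : 0 <= pi / 2 :> R by rewrite divr_ge0// pi_ge0.
have F0 : F 0 = m1 by rewrite /F cos0 sin0 expr1n expr0n /= mul1r mul0r mulr0 mulr0 mul0r !addr0.
have F1 : F (pi / 2) = m2.
  by rewrite /F cos_pihalf sin_pihalf expr1n expr0n /= mul1r !mul0r mulr0 mul0r addr0 add0r.
have [|g _ Fg] := @IVT R F 0 (pi / 2) m pi0 (continuous_subspaceT cF).
  by rewrite F0 F1 ge_min le_max h1 h2 orbT.
by exists g.
Qed.

Variables (D : set (R * R)) (alpha lambda : R).
Hypotheses (oD : open D) (bD : bounded_set D) (Dn0 : D !=set0).
Hypotheses (alpha01 : 0 < alpha < 1) (lambda0 : 0 < lambda).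
Let mD : measurable (D : set plane) := open_measurable2 oD.

Lemma area_fin : (fine (area D))%:E = area D.
Proof. by rewrite fineK// ge0_fin_numE// ?measure_ge0//; exact: bounded_area. Qed.

Lemma area_gt0 : 0 < fine (area D).
Proof.
have [y Dy] := Dn0; have [q [h1 h2 hq]] := open_rat_box oD Dy.
pose r : R := q.2.+1%:R^-1.
have r0 : 0 < r by rewrite invr_gt0.
have sub : box (ratr q.1.1, ratr q.1.2) r `<=` D.
  by move=> z /boxP[/= z1 z2]; apply: hq; exact: ltW.
have e := area_box (ratr q.1.1, ratr q.1.2) (ltW r0).
rewrite -lte_fin area_fin.
apply: (@lt_le_trans _ _ (area (box (ratr q.1.1, ratr q.1.2) r))).
  by rewrite e lte_fin exprn_gt0// mulr_gt0.
by apply: le_measure sub; rewrite inE//; exact: measurable_box.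
Qed.

Lemma continuous_integrable (f : R * R -> R) : continuous f ->
  area.-integrable D (EFin \o (f : plane -> R)).
Proof. by move=> cf; apply: integrable_L2 => //; exact: L2_continuous. Qed.

Lemma Rintegral_cst_area (c : R) : \int[area]_(y in D) c = c * fine (area D).
Proof.
by rewrite /Rintegral integral_cst//= fineM// fin_numE -area_fin.
Qed.

Lemma Rintegral_sum (M : nat) (S : nat -> plane -> R) :
  (forall j, area.-integrable D (EFin \o S j)) ->
  \sum_(j < M) \int[area]_(y in D) S j y = \int[area]_(y in D) \sum_(j < M) S j y.
Proof.
move=> iS; suff : area.-integrable D (EFin \o (fun y : plane => \sum_(j < M) S j y)) /\
  \sum_(j < M) \int[area]_(y in D) S j y = \int[area]_(y in D) \sum_(j < M) S j y by case.
elim: M => [|M [i e]].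
  have -> : (fun y : plane => \sum_(j < 0) S j y) = fun=> 0.
    by apply/funext => y; rewrite big_ord0.
  by rewrite big_ord0 Rintegral_cst_area mul0r; split=> //; exact: integrable0.
have -> : (fun y : plane => \sum_(j < M.+1) S j y) = (fun y => \sum_(j < M) S j y + S M y).
  by apply/funext => y; rewrite big_ord_recr.
by rewrite big_ord_recr /= e RintegralD//; split=> //; have := integrableD mD i (iS M).
Qed.

(* The position j of the slots is chosen so that the second component has little
   mass; then the pair is rotated in C^2 to adjust the masses. *)
Lemma exists_competitor : exists2 C : R, 0 < C & forall t Om : R, 0 < t -> Om = lambda / t ^+ 2 ->
  exists f f' g g' : R * R -> R,
  [/\ [/\ class_C 1 f, class_C 1 f', class_C 1 g & class_C 1 g'],
    forall y, D y -> (f y ^+ 2 + f' y ^+ 2) + (g y ^+ 2 + g' y ^+ 2) = 1,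
    forall y, D y -> cov_grad Om f f' y <= C / t ^+ 2,
    forall y, D y -> cov_grad Om g g' y <= C / t ^+ 2 &
    \int[area]_(y in D) (f y ^+ 2 + f' y ^+ 2) = alpha * fine (area D)].
Proof.
have [th [dth [L [L0 dthE cdth [thl thr dthL]]]]] := @exists_angle R.
have A0 := area_gt0; set A := fine _ in A0 *.
have /andP[al0 al1] := alpha01.
pose mu := Num.min alpha (1 - alpha).
have mu0 : 0 < mu by rewrite lt_min al0 subr_gt0.
(* M > 1 / mu, so that the average over the M residues leaves the second component a mass of at most
   mu A, below both prescribed masses. *)
pose M := (Num.truncn mu^-1).+1.
have M0 : (0 < M)%N by [].
have M0' : 0 < M%:R :> R by rewrite ltr0n.
have Mmu : A / M%:R <= mu * A.
  rewrite mulrC ler_wpM2r ?(ltW A0)// invf_ple ?posrE//.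
  by have /andP[_ /ltW] := truncn_itv (ltW (ltac:(by rewrite invr_gt0) : 0 < mu^-1)).
exists (2 * ((2 * L) ^+ 2 + (2 * lambda * M%:R) ^+ 2)).
  rewrite mulr_gt0// ltr_wpDl ?sqr_ge0// exprn_gt0// !mulr_gt0//.
move=> t Om t0 OmE.
have [B B0 hB] := bounded_sub_box bD.
(* Large enough for y.1 / t + c to exceed M on [D]; N = 2 c + 1 then leaves the margin required on
   the right. *)
pose c := (Num.truncn (B / t) + M).+1.
pose N := (c + c + 1)%N.
have cB : B / t + M%:R < c%:R.
  rewrite /c -natr1 natrD addrAC ltrD2r natr1.
  by have /andP[] := truncn_itv (divr_ge0 (ltW B0) (ltW t0)).
have hD y : D y -> M%:R <= y.1 / t + c%:R /\ y.1 / t + c%:R + 1 < N%:R.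
  move=> /hB[y1 _]; have : `|y.1 / t| < B / t.
    by rewrite normrM normfV (gtr0_norm t0) ltr_pM2r// invr_gt0.
  by rewrite ltr_norml /N !natrD => /andP[? ?]; move: cB M0'; split; lra.
pose f1 j := u1_re th t Om M N c j; pose f1' j := u1_im th t Om M N c j.
pose f2 j := u2_re th t Om M N c j; pose f2' j := u2_im th t Om M N c j.
have C1 j : class_C 1 (f1 j) /\ class_C 1 (f1' j) by apply: class_u1.
have C2 j : class_C 1 (f2 j) /\ class_C 1 (f2' j) by apply: class_u2.
have cont (f : R * R -> R) : class_C 1 f -> continuous f by case.
have csq (f f' : R * R -> R) : class_C 1 f -> class_C 1 f' ->
    continuous (fun y => f y * f' y).
  by move=> cf cf'; apply: cont; exact: class_CM.
have csq2 (f f' : R * R -> R) : class_C 1 f -> class_C 1 f' ->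
    continuous (fun y => f y ^+ 2 + f' y ^+ 2).
  move=> cf cf' y; apply: cvgD; exact: csq.
pose S j y := f2 j y ^+ 2 + f2' j y ^+ 2.
have iS j : area.-integrable D (EFin \o (S j : plane -> R)).
  by apply: continuous_integrable; apply: csq2; case: (C2 j).
have [j jM Sj] : exists2 j : nat, (j < M)%N & \int[area]_(y in D) S j y <= A / M%:R.
  apply: pigeonhole_le => //.
  have cS : continuous (fun y => \sum_(j < M) S j y).
    apply: cont; apply: (@class_C_sum _ _ _ S) => i.
    by apply: class_CD; apply: class_CM; case: (C2 i).
  have -> : \sum_(j < M) \int[area]_(y in D) S j y = \int[area]_(y in D) \sum_(j < M) S j y.
    by apply: Rintegral_sum.
  rewrite -[A]mul1r -Rintegral_cst_area; apply: le_Rintegral => //.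
  - exact: continuous_integrable.
  - by apply: continuous_integrable => y; exact: cvg_cst.
  - by move=> y /hD[h1 h2]; apply: slots_sum.
pose m2 := \int[area]_(y in D) S j y.
pose T y := f1 j y ^+ 2 + f1' j y ^+ 2.
have iT : area.-integrable D (EFin \o (T : plane -> R)).
  by apply: continuous_integrable; apply: csq2; case: (C1 j).
pose m1 := \int[area]_(y in D) T y.
have unit y : D y -> T y + S j y = 1.
  by move=> /hD[h1 h2]; exact: (slots_unit dthE cdth thl thr).
have m12 : m1 + m2 = A.
  rewrite -RintegralD// -[A]mul1r -Rintegral_cst_area.
  by apply: eq_Rintegral => y; rewrite inE => /unit.
pose X y := f1 j y * f2 j y + f1' j y * f2' j y.
have cX : continuous X.
  move=> y; apply: cvgD; apply: csq; by [case: (C1 j)|case: (C2 j)].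
have iX := continuous_integrable cX.
have mumin : mu <= alpha /\ mu <= 1 - alpha by rewrite !ge_min !lexx orbT.
(* The second component has mass at most min(alpha, 1 - alpha) A and the first the rest, so the
   prescribed mass lies between the two. *)
have range : m2 <= alpha * A <= m1.
  have [h1 h2] := mumin.
  have h3 := ler_wpM2r (ltW A0) h1; have h4 := ler_wpM2r (ltW A0) h2.
  have hS : m2 <= mu * A := le_trans Sj Mmu.
  by move: m12 hS h3 h4; rewrite mulrBl mul1r => ? ? ? ?; apply/andP; split; lra.
have [g hg] := rotation_mass (\int[area]_(y in D) X y) range.
have cs := cos2Dsin2 g.
exists (fun y => cos g * f1 j y + sin g * f2 j y), (fun y => cos g * f1' j y + sin g * f2' j y).
exists (fun y => - sin g * f1 j y + cos g * f2 j y), (fun y => - sin g * f1' j y + cos g * f2' j y).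
have lin (a b : R) (h k : R * R -> R) : class_C 1 h -> class_C 1 k ->
    class_C 1 (fun y => a * h y + b * k y).
  by move=> ch ck; apply: class_CD; apply: class_CM => //; exact: class_C_cst.
have [D1 D1'] := C1 j; have [D2 D2'] := C2 j.
have bnd (a b : R) y : a ^+ 2 + b ^+ 2 = 1 -> D y ->
   cov_grad Om (fun y => a * f1 j y + b * f2 j y) (fun y => a * f1' j y + b * f2' j y) y <=
   2 * ((2 * L) ^+ 2 + (2 * lambda * M%:R) ^+ 2) / t ^+ 2.
  move=> ab /hD[h1 h2]; apply: le_trans (cov_grad_rotation Om y ab D1 D1' D2 D2') _.
  have [k1 k2] := slots_cov_grad L0 dthE cdth thl thr dthL Om t0 M0 jM h1 h2.
  apply: le_trans (lerD k1 k2) _; rewrite le_eqVlt; apply/orP; left; apply/eqP.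
  by rewrite OmE; field; rewrite gt_eqF.
split.
- by split; exact: lin.
- move=> y /unit <-; rewrite /T /S; move: cs (f1 j y) (f2 j y) (f1' j y) (f2' j y).
  move: (cos g) (sin g) => a b ab p q p' q'.
  transitivity ((a ^+ 2 + b ^+ 2) * ((p ^+ 2 + p' ^+ 2) + (q ^+ 2 + q' ^+ 2))); first by ring.
  by rewrite ab mul1r.
- by move=> y; exact: bnd.
- by move=> y; apply: bnd; rewrite sqrrN addrC.
rewrite -hg /m1 /m2.
have -> : \int[area]_(y in D) ((cos g * f1 j y + sin g * f2 j y) ^+ 2 +
      (cos g * f1' j y + sin g * f2' j y) ^+ 2) =
    \int[area]_(y in D) (cos g ^+ 2 * T y + sin g ^+ 2 * S j y + 2 * (cos g * sin g) * X y).
  by apply: eq_Rintegral => y _; rewrite /T /S /X; ring.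
have j1 := integrableZl mD (cos g ^+ 2) iT; have j2 := integrableZl mD (sin g ^+ 2) (iS j).
have j3 := integrableZl mD (2 * (cos g * sin g)) iX; have j12 := integrableD mD j1 j2.
by rewrite RintegralD// RintegralD// !RintegralZl.
Qed.

End Competitor.

(** * Energy bounds for minimizers *)

Section MinimizerBounds.
Context {R : realType}.
Local Notation plane := (measurableTypeR R * measurableTypeR R)%type.
Local Notation re := complex.Re.
Local Notation im := complex.Im.
Variables (D : set (R * R)) (alpha lambda : R).
Hypotheses (oD : open D) (bD : bounded_set D) (Dn0 : D !=set0).
Hypotheses (alpha01 : 0 < alpha < 1) (lambda0 : 0 < lambda).
Let mD : measurable (D : set plane) := open_measurable2 oD.
Let A := fine (area D).
Let A0 : 0 < A := area_gt0 oD bD Dn0.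

Lemma sqmod_ge0 (u : R * R -> R[i]) y : 0 <= sqmod u y.
Proof. exact: sqr_ge0. Qed.

Lemma sqmod_cov_grad_ge0 (u : R * R -> R[i]) Om y : 0 <= sqmod_cov_grad D Om u y.
Proof. by apply: addr_ge0; exact: sqmod_ge0. Qed.

Lemma energy_bound_C1 (C t Om : R) f f' : 0 < t -> class_C 1 f -> class_C 1 f' ->
  (forall y, D y -> cov_grad Om f f' y <= C / t ^+ 2) ->
  (\int[area]_(y in D) (2^-1 * sqmod_cov_grad D Om (fun y => (f y +i* f' y)%C) y)%:E <=
   (2^-1 * (C / t ^+ 2) * A)%:E)%E.
Proof.
move=> t0 cf cf' hC.
have h := ae_cov_grad Om oD bD cf cf' (fun y => erefl).
have H1 : csobolev_H1 D (fun y => (f y +i* f' y)%C).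
  by split; exact: class_C1_H1.
have mcov : measurable_fun D (sqmod_cov_grad D Om (fun y => (f y +i* f' y)%C) : plane -> R).
  by have /integrableP[/measurable_EFinP] := sqmod_cov_grad_integrable oD bD H1 Om.
have [y0 Dy0] := Dn0.
have C0 : 0 <= C / t ^+ 2.
  apply: le_trans (hC _ Dy0).
  by rewrite /cov_grad !addr_ge0// sqr_ge0.
apply: (@le_trans _ _ (\int[area]_(y in D) (2^-1 * (C / t ^+ 2))%:E)%E); last first.
  by rewrite integral_cst//= [leRHS]EFinM /A area_fin.
apply: ae_ge0_le_integral => //.
- by move=> y _; rewrite lee_fin mulr_ge0// sqmod_cov_grad_ge0.
- by apply/measurable_EFinP; apply: measurable_funM.
- by move=> y _; rewrite lee_fin mulr_ge0.
have F : Filter (nbhs (almost_everywhere (@area R))) := ae_filter_ringOfSetsType (@area R).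
apply: (@filterS _ _ F _ _ _ h) => y /= hy Dy.
by rewrite lee_fin hy// ler_wpM2l// hC.
Qed.

(** All terms of the energy are nonnegative, so each of them is at most the energy of the
    competitor, which is of order 1 / t^2. Multiplying the penalty by 4 eps^2 gives the last
    bound. *)
Lemma minimizer_bounds : exists2 C : R, 0 < C &
  forall eps delta t Om (u1 u2 : R * R -> R[i]), 0 < eps -> 1 < delta ->
  t = eps / Num.sqrt (delta - 1) -> Om = lambda / t ^+ 2 ->
  minimizer D alpha eps delta Om u1 u2 ->
  [/\ (\int[area]_(y in D) (sqmod_cov_grad D Om u1 y)%:E <= (C / t ^+ 2)%:E)%E,
      (\int[area]_(y in D) (sqmod_cov_grad D Om u2 y)%:E <= (C / t ^+ 2)%:E)%E &
      (\int[area]_(y in D) ((1 - sqmod u1 y - sqmod u2 y) ^+ 2)%:E <=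
       (C * (eps ^+ 2 / t ^+ 2))%:E)%E].
Proof.
have [C C0 hC] := exists_competitor oD bD Dn0 alpha01 lambda0.
(* The factor 4 comes from 1 / (4 eps^2) in the penalty; the gradient terms need only 2. *)
exists (4 * ((C + 1) * A)); first by rewrite !mulr_gt0// addr_gt0.
move=> eps delta t Om u1 u2 e0 d1 tE OmE [[H1 H2 _ _] umin].
have d0 : 0 < delta - 1 by rewrite subr_gt0.
have t0 : 0 < t by rewrite tE divr_gt0// sqrtr_gt0.
have t2E : t ^+ 2 = eps ^+ 2 / (delta - 1).
  by rewrite tE expr_div_n sqr_sqrtr// ltW.
(* By the definition of t the coupling coefficient is 1 / (2 t^2), of the same order as the gradient
   terms of the competitor. *)
have dE : (delta - 1) / (2 * eps ^+ 2) = (2 * t ^+ 2)^-1.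
  by rewrite t2E; field; rewrite !gt_eqF.
have [f [f' [g [g' [[cf cf' cg cg'] unit hf hg mass]]]]] := hC t Om t0 OmE.
pose v1 y := (f y +i* f' y)%C; pose v2 y := (g y +i* g' y)%C.
have v1E y : sqmod v1 y = f y ^+ 2 + f' y ^+ 2 by rewrite /sqmod normc_sqr.
have v2E y : sqmod v2 y = g y ^+ 2 + g' y ^+ 2 by rewrite /sqmod normc_sqr.
have H1' : csobolev_H1 D v1 by split; exact: class_C1_H1.
have H2' : csobolev_H1 D v2 by split; exact: class_C1_H1.
have I1 : \int[area]_(y in D) sqmod v1 y = alpha * A.
  by rewrite -mass; apply: eq_Rintegral => y _; rewrite v1E.
have adm : admissible D alpha v1 v2.
  split=> //; rewrite /average; first by rewrite I1 mulfK// gt_eqF.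
  have : \int[area]_(y in D) sqmod v1 y + \int[area]_(y in D) sqmod v2 y = A.
    rewrite -RintegralD//; [|exact: sqmod_integrable|exact: sqmod_integrable].
    rewrite -[A]mul1r -(Rintegral_cst_area oD bD).
    by apply: eq_Rintegral => y; rewrite inE => /unit; rewrite v1E v2E.
  rewrite I1 => h; apply: (@mulIf _ A); first by rewrite gt_eqF.
  rewrite divfK ?gt_eqF//; move: h; set J := Rintegral _ _ _.
  by rewrite mulrBl mul1r => h; apply/esym/eqP; rewrite subr_eq addrC; apply/eqP/esym.
have := umin _ _ adm; set E0 := energy _ _ _ _ v1 v2 => hu.
have E0b : (E0 <= ((C + 1) * A / t ^+ 2)%:E)%E.
  have k1 := energy_bound_C1 t0 cf cf' hf; have k2 := energy_bound_C1 t0 cg cg' hg.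
  have k3 : (\int[area]_(x in D)
     ((4 * eps ^+ 2)^-1 * (1 - sqmod v1 x - sqmod v2 x) ^+ 2 +
      (delta - 1) / (2 * eps ^+ 2) * (sqmod v1 x * sqmod v2 x))%:E <=
      ((2 * t ^+ 2)^-1 * A)%:E)%E.
    apply: (@le_trans _ _ (\int[area]_(y in D) ((2 * t ^+ 2)^-1)%:E)%E); last first.
      by rewrite integral_cst//= [leRHS]EFinM /A area_fin.
    have ms1 : measurable_fun D (sqmod v1 : plane -> R).
      by have /integrableP[/measurable_EFinP] := sqmod_integrable oD H1'.
    have ms2 : measurable_fun D (sqmod v2 : plane -> R).
      by have /integrableP[/measurable_EFinP] := sqmod_integrable oD H2'.
    have i0 : 0 <= (2 * t ^+ 2)^-1 by rewrite invr_ge0 mulr_ge0// sqr_ge0.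
    apply: ge0_le_integral => //.
    - move=> y _; rewrite lee_fin dE addr_ge0// mulr_ge0//.
        by rewrite invr_ge0 mulr_ge0// sqr_ge0.
        exact: sqr_ge0.
      by apply: mulr_ge0; exact: sqmod_ge0.
    - apply/measurable_EFinP; apply: measurable_funD; apply: measurable_funM => //.
        by apply: measurable_funX; apply: measurable_funB => //; apply: measurable_funB.
      exact: measurable_funM.
    (* For the competitor the penalty vanishes, and the product of two nonnegative numbers with sum
       1 is at most 1. *)
    move=> y Dy; rewrite lee_fin dE; have := unit y Dy; rewrite -v1E -v2E => u.
    have -> : 1 - sqmod v1 y - sqmod v2 y = 0 by rewrite -u; ring.
    rewrite expr0n mulr0 add0r ler_piMr//.
    by have := sqmod_ge0 v1 y; have := sqmod_ge0 v2 y; move: u; nra.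
  apply: le_trans (leeD (leeD k1 k2) k3) _; rewrite -!EFinD lee_fin.
  have -> : 2^-1 * (C / t ^+ 2) * A + 2^-1 * (C / t ^+ 2) * A + (2 * t ^+ 2)^-1 * A =
     (C + 2^-1) * A / t ^+ 2 by field; rewrite gt_eqF.
  rewrite ler_wpM2r ?invr_ge0 ?sqr_ge0// ler_wpM2r ?(ltW A0)// lerD2l.
  by rewrite invf_le1// ler1n.
have {E0b} hu : (energy D eps delta Om u1 u2 <= ((C + 1) * A / t ^+ 2)%:E)%E := le_trans hu E0b.
set P1 := (\int[area]_(x in D) (2^-1 * sqmod_cov_grad D Om u1 x)%:E)%E.
set P2 := (\int[area]_(x in D) (2^-1 * sqmod_cov_grad D Om u2 x)%:E)%E.
set P3 := (\int[area]_(x in D) ((4 * eps ^+ 2)^-1 * (1 - sqmod u1 x - sqmod u2 x) ^+ 2 +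
      (delta - 1) / (2 * eps ^+ 2) * (sqmod u1 x * sqmod u2 x))%:E)%E.
have e40 : 0 <= (4 * eps ^+ 2)^-1 by rewrite invr_ge0 mulr_ge0// sqr_ge0.
have i20 : 0 <= (delta - 1) / (2 * eps ^+ 2).
  by rewrite divr_ge0 ?mulr_ge0 ?sqr_ge0// ltW.
have P10 : (0 <= P1)%E.
  by apply: integral_ge0 => y _; rewrite lee_fin mulr_ge0// sqmod_cov_grad_ge0.
have P20 : (0 <= P2)%E.
  by apply: integral_ge0 => y _; rewrite lee_fin mulr_ge0// sqmod_cov_grad_ge0.
have P3p y : 0 <= (4 * eps ^+ 2)^-1 * (1 - sqmod u1 y - sqmod u2 y) ^+ 2 <=
    (4 * eps ^+ 2)^-1 * (1 - sqmod u1 y - sqmod u2 y) ^+ 2 +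
      (delta - 1) / (2 * eps ^+ 2) * (sqmod u1 y * sqmod u2 y).
  rewrite mulr_ge0 ?sqr_ge0//= lerDl mulr_ge0//.
  by apply: mulr_ge0; exact: sqmod_ge0.
have P30 : (0 <= P3)%E.
  apply: integral_ge0 => y _; rewrite lee_fin.
  by have /andP[h1 h2] := P3p y; exact: le_trans h2.
have hP : (P1 + P2 + P3 <= ((C + 1) * A / t ^+ 2)%:E)%E by [].
have q1 : (P1 <= ((C + 1) * A / t ^+ 2)%:E)%E.
  by apply: le_trans hP; rewrite -addeA leeDl// adde_ge0.
have q2 : (P2 <= ((C + 1) * A / t ^+ 2)%:E)%E.
  by apply: le_trans hP; rewrite addeAC leeDr// adde_ge0.
have q3 : (P3 <= ((C + 1) * A / t ^+ 2)%:E)%E.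
  by apply: le_trans hP; rewrite leeDr// adde_ge0.
have half (u : R * R -> R[i]) : csobolev_H1 D u ->
    (\int[area]_(x in D) (2^-1 * sqmod_cov_grad D Om u x)%:E <= ((C + 1) * A / t ^+ 2)%:E)%E ->
    (\int[area]_(y in D) (sqmod_cov_grad D Om u y)%:E <= (4 * ((C + 1) * A) / t ^+ 2)%:E)%E.
  move=> Hu; have ii := sqmod_cov_grad_integrable oD bD Hu Om.
  have jj := integrableZl mD 2^-1 ii.
  rewrite !integral_EFin_Rintegral// RintegralZl// !lee_fin => h.
  have J0 : 0 <= \int[area]_(y in D) sqmod_cov_grad D Om u y.
    by apply: Rintegral_ge0 => y _; exact: sqmod_cov_grad_ge0.
  have -> : 4 * ((C + 1) * A) / t ^+ 2 = 4 * ((C + 1) * A / t ^+ 2) by rewrite [RHS]mulrA.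
  by move: h J0; move: ((C + 1) * A / t ^+ 2) (Rintegral _ _ _) => z J; lra.
split; [exact: half|exact: half|].
have ms1 : measurable_fun D (sqmod u1 : plane -> R).
  by have /integrableP[/measurable_EFinP] := sqmod_integrable oD H1.
have ms2 : measurable_fun D (sqmod u2 : plane -> R).
  by have /integrableP[/measurable_EFinP] := sqmod_integrable oD H2.
have mpot : measurable_fun D (fun y : plane => (1 - sqmod u1 y - sqmod u2 y) ^+ 2).
  by apply: measurable_funX; apply: measurable_funB => //; apply: measurable_funB.
have hpot : ((4 * eps ^+ 2)^-1%:E * \int[area]_(y in D) ((1 - sqmod u1 y - sqmod u2 y) ^+ 2)%:E <= P3)%E.
  rewrite -ge0_integralZl//; last first.
    by move=> y _; rewrite lee_fin sqr_ge0.
    by apply/measurable_EFinP.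
  apply: ge0_le_integral => //.
  - by move=> y _; rewrite -EFinM lee_fin mulr_ge0// sqr_ge0.
  - by apply: emeasurable_funM => //; apply/measurable_EFinP.
  - apply/measurable_EFinP; apply: measurable_funD; apply: measurable_funM => //.
    exact: measurable_funM.
  - by move=> y _; rewrite -EFinM lee_fin; have /andP[] := P3p y.
have := le_trans hpot q3; rewrite lee_pdivrMl ?mulr_gt0 ?exprn_gt0//.
rewrite -EFinM => h; apply: le_trans h _; rewrite lee_fin.
rewrite le_eqVlt; apply/orP; left; apply/eqP; ring.
Qed.

End MinimizerBounds.

(** * Local averages *)

Section LocalIntegrals.
Context {R : realType}.
Local Notation plane := (measurableTypeR R * measurableTypeR R)%type.

Section Slices.
Variables (Q : set (plane * plane)) (h : plane -> R).
Hypotheses (mQ : measurable Q) (mh : measurable_fun setT h) (h0 : forall y, 0 <= h y).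

Let k (z : plane * plane) : \bar R := (\1_Q z * h z.2)%:E.

Let mk : measurable_fun setT k.
Proof.
apply/measurable_EFinP; apply: measurable_funM; first exact: measurable_indic.
exact: measurableT_comp.
Qed.

Let k0 z : (0 <= k z)%E.
Proof. by rewrite lee_fin mulr_ge0// indicE; case: (_ \in _). Qed.

Let kE x : (\int[area]_(y in [set y | Q (x, y)]) (h y)%:E = \int[@sarea R]_y k (x, y))%E.
Proof.
rewrite integral_mkcond; apply: eq_integral => y _; rewrite patchE /k indicE.
have -> : (y \in [set y | Q (x, y)]) = ((x, y) \in Q) by apply/idP/idP; rewrite !inE.
by case: (_ \in Q); rewrite ?mul1r ?mul0r.
Qed.

Lemma measurable_slice_integral : measurable_fun setT
  (fun x : plane => (\int[area]_(y in [set y | Q (x, y)]) (h y)%:E)%E).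
Proof.
rewrite (_ : (fun x : plane => _) = fun x => (\int[@sarea R]_y k (x, y))%E); last exact/funext.
exact: (@measurable_fun_fubini_tonelli_F _ _ _ _ R (@sarea R) k mk k0).
Qed.

(** After the exchange of the integrals, each y is counted with the area of the set of those x whose
    slice contains it. *)
Lemma tonelli_slice (c : R) : (forall y, (area [set x | Q (x, y)] <= c%:E)%E) ->
  (\int[area]_x \int[area]_(y in [set y | Q (x, y)]) (h y)%:E <=
   c%:E * \int[area]_y (h y)%:E)%E.
Proof.
move=> hc; under eq_integral do rewrite kE.
have -> : (\int[area]_x \int[@sarea R]_y k (x, y) = \int[@sarea R]_y \int[@sarea R]_x k (x, y))%E.
  exact: (@fubini_tonelli _ _ _ _ R (@sarea R) (@sarea R) k mk k0).
have c0 : 0 <= c by rewrite -lee_fin (le_trans _ (hc point)).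
rewrite -ge0_integralZl//; first last.
- by move=> y _; rewrite lee_fin.
- exact/measurable_EFinP.
apply: ge0_le_integral => //.
- by move=> y _; exact: integral_ge0.
- exact: (@measurable_fun_fubini_tonelli_G _ _ _ _ R (@sarea R) k).
- by apply: emeasurable_funM => //; exact/measurable_EFinP.
move=> y _.
have ms : measurable [set x | Q (x, y)].
  by have := measurable_ysection y mQ; congr measurable; apply/seteqP; split=> x;
    rewrite /ysection /= inE.
have -> : (\int[@sarea R]_x k (x, y) = \int[area]_x ((h y)%:E * (\1_[set x | Q (x, y)] x)%:E))%E.
  apply: eq_integral => x _; rewrite -EFinM /k mulrC !indicE /=.
  suff -> : ((x, y) \in Q) = (x \in [set x | Q (x, y)]) by [].
  by apply/idP/idP; rewrite !inE.
rewrite ge0_integralZl//; last 2 first.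
- by apply/measurable_EFinP; exact: measurable_indic.
- by rewrite lee_fin.
rewrite integral_indic// setIT muleC.
by apply: lee_wpmul2r => //; rewrite lee_fin.
Qed.

End Slices.

Lemma markov_measure (F : plane -> \bar R) (c m : R) : measurable_fun setT F ->
  (forall x, 0 <= F x)%E -> 0 < c -> (\int[area]_x F x <= m%:E)%E ->
  measurable [set x | (c%:E < F x)%E] /\ (area [set x | (c%:E < F x)%E] <= (m / c)%:E)%E.
Proof.
move=> mF F0 c0 hm.
have mB : measurable [set x | (c%:E < F x)%E].
  have := mF measurableT _ (emeasurable_itv `]c%:E, +oo[); rewrite setTI.
  congr measurable; apply/seteqP; split=> x /=; rewrite in_itv/= andbT//.
split=> //.
have : (\int[area]_(x in [set x | (c%:E < F x)%E]) c%:E <= m%:E)%E.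
  apply: le_trans hm; apply: (@le_trans _ _ (\int[area]_(x in [set x | (c%:E < F x)%E]) F x)%E).
    apply: ge0_le_integral => //.
    - by move=> x _; rewrite lee_fin ltW.
    - exact: measurable_funTS.
    - by move=> x /= /ltW.
  by apply: ge0_subset_integral => //.
rewrite integral_cst//= => h.
by rewrite [m / c]mulrC EFinM lee_pdivlMl.
Qed.

Definition near_disk (r : R) : set (plane * plane) :=
  [set z | (z.2.1 - z.1.1) ^+ 2 + (z.2.2 - z.1.2) ^+ 2 < r ^+ 2].
Definition near_box (r : R) : set (plane * plane) :=
  [set z | `|z.2.1 - z.1.1| < r /\ `|z.2.2 - z.1.2| < r].

Lemma measurable_near_disk r : measurable (near_disk r).
Proof.
pose g (z : plane * plane) : R := (z.2.1 - z.1.1) ^+ 2 + (z.2.2 - z.1.2) ^+ 2.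
have mg : measurable_fun setT g.
  apply: measurable_funD; apply: measurable_funX; apply: measurable_funB;
    by [exact: (measurableT_comp measurable_fst measurable_snd)|
        exact: (measurableT_comp measurable_fst measurable_fst)|
        exact: (measurableT_comp measurable_snd measurable_snd)|
        exact: (measurableT_comp measurable_snd measurable_fst)].
have := mg measurableT _ (measurable_itv `]-oo, (r ^+ 2)[); rewrite setTI.
by congr measurable; apply/seteqP; split=> z /=; rewrite in_itv.
Qed.

Lemma measurable_near_box r : measurable (near_box r).
Proof.
pose g1 (z : plane * plane) : R := `|z.2.1 - z.1.1|.
pose g2 (z : plane * plane) : R := `|z.2.2 - z.1.2|.
have mg1 : measurable_fun setT g1.
  apply: measurableT_comp => //; apply: measurable_funB.
    exact: (measurableT_comp measurable_fst measurable_snd).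
  exact: (measurableT_comp measurable_fst measurable_fst).
have mg2 : measurable_fun setT g2.
  apply: measurableT_comp => //; apply: measurable_funB.
    exact: (measurableT_comp measurable_snd measurable_snd).
  exact: (measurableT_comp measurable_snd measurable_fst).
have m1 := mg1 measurableT _ (measurable_itv `]-oo, r[).
have m2 := mg2 measurableT _ (measurable_itv `]-oo, r[).
have := measurableI _ _ m1 m2; rewrite !setTI.
by congr measurable; apply/seteqP; split=> z /=; rewrite !in_itv.
Qed.

Definition inner (D : set (R * R)) (c : R) : set plane :=
  [set x | forall y, `|y.1 - x.1| < c -> `|y.2 - x.2| < c -> D y].

(** The complement is the union of the open boxes of half-side c centred outside [D], hence open. *)
Lemma measurable_inner D c : measurable (inner D c).
Proof.
rewrite -[inner D c]setCK; apply: measurableC; apply: open_measurable2.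
rewrite (_ : ~` inner D c = \bigcup_(y in ~` D) (box y c : set (R * R))).
  apply: bigcup_open => y _; apply: openI; apply: open_comp => [z _|]; try exact: ball_open.
    exact: cvg_fst.
  exact: cvg_snd.
apply/seteqP; split=> x /=.
  move=> /existsNP[y] /not_implyP[h1 /not_implyP[h2 h3]].
  by exists y => //; apply/boxP; rewrite ![_ - y.1]distrC distrC.
move=> [y yD /boxP[h1 h2]] H; apply: yD.
by apply: H; rewrite distrC.
Qed.

(** The layers decrease to the empty set because [D] is open, and they have finite area: continuity
    from above. *)
Lemma area_boundary_layer (D : set (R * R)) (e : R) : open D -> bounded_set D -> 0 < e ->
  exists2 c : R, 0 < c & (area (D `\` inner D c) < e%:E)%E.
Proof.
move=> oD bD e0; have mD := open_measurable2 oD.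
pose F (k : nat) : set plane := D `\` inner D k.+1%:R^-1.
have mF k : measurable (F k) by apply: measurableD => //; exact: measurable_inner.
have F0 : \bigcap_k F k = set0.
  apply/seteqP; split=> // x Fx; have [Dx _] := Fx 0%N I.
  have /nbhs_ballP[d /= d0 hd] := open_nbhs_nbhs (conj oD Dx).
  pose k := Num.truncn d^-1; have [_] := Fx k I; apply=> y h1 h2; apply: hd.
  have kd : k.+1%:R^-1 < d.
    rewrite invf_plt ?posrE//.
    by have /andP[] := truncn_itv (ltW (ltac:(by rewrite invr_gt0) : 0 < d^-1)).
  by split; rewrite /ball /= distrC (lt_trans _ kd).
have dF : nonincreasing_seq F.
  apply/nonincreasing_seqP => k; apply/subsetPset => x [Dx nx]; split=> // H; apply: nx => y h1 h2.
  apply: H; [apply: lt_le_trans h1 _|apply: lt_le_trans h2 _];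
    by rewrite lef_pV2 ?posrE// ler_nat.
have Foo : (area (F 0%N) < +oo)%E.
  by apply: le_lt_trans (bounded_area oD bD); apply: le_measure; rewrite ?inE// => x [].
have mcap : measurable (\bigcap_k F k) by rewrite F0.
have := nonincreasing_cvg_mu Foo mF mcap dF; rewrite F0 measure0.
have e0' : (0 < e%:E)%E by rewrite lte_fin.
move=> /(_ _ (open_ereal_lt' e0'))[k _ hk].
by exists k.+1%:R^-1; [rewrite invr_gt0|exact: (hk k (leqnn k))].
Qed.

End LocalIntegrals.

(** * Density at points of low energy *)

Section GoodPoints.
Context {R : realType}.
Local Notation plane := (measurableTypeR R * measurableTypeR R)%type.
Local Notation n := Normc.normc.

(** By the mean value theorem sin x = x cos c with c in [0, 1], and cos c = 1 - 2 sin(c / 2)^2 >= 1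
    - c^2 / 2 >= 1/2. *)
Lemma sin_ge_half (x : R) : 0 <= x <= 1 -> x / 2 <= sin x.
Proof.
have mvt (y : R) : 0 <= y -> exists2 c : R, 0 <= c <= y & sin y = cos c * y.
  move=> y0; have [c + e] := MVT_segment y0 (fun z _ => is_derive_sin z)
    (continuous_subspaceT (@continuous_sin R)).
  by rewrite in_itv/= => hc; exists c => //; move: e; rewrite sin0 !subr0.
move=> /andP[x0 x1]; have [c /andP[c0 cx] ->] := mvt _ x0.
rewrite mulrC ler_wpM2r//.
have c2 : 0 <= c / 2 by rewrite divr_ge0.
have [d /andP[d0 dc] e] := mvt _ c2.
have sd : `|sin (c / 2)| <= c / 2.
  rewrite e normrM (ger0_norm c2) ler_piMl//.
  by rewrite ler_norml cos_geN1 cos_le1.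
have s2 : sin (c / 2) ^+ 2 <= (c / 2) ^+ 2.
  by rewrite -[leLHS]real_normK ?num_real// ler_pXn2r ?nnegrE.
have -> : cos c = 1 - 2 * sin (c / 2) ^+ 2.
  have cE : cos c = cos ((c / 2) *+ 2) by rewrite -mulr_natr divfK.
  by rewrite cE cos_mulr2n cos2sin2 mulrnBl; ring.
have c21 : c ^+ 2 <= 1 by rewrite expr_le1// (le_trans cx).
have ce : (c / 2) ^+ 2 = c ^+ 2 / 4 by field.
move: s2; rewrite ce; move: (sin _ ^+ 2) => S.
by move: c21; lra.
Qed.

Lemma measurable_disk (x : R * R) r : measurable (disk x r : set plane).
Proof.
have := measurable_xsection (x : plane) (measurable_near_disk r).
by congr measurable; apply/seteqP; split=> y; rewrite /xsection /= inE.
Qed.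

Lemma disk_sub_box (x : R * R) r : 0 <= r -> disk x r `<=` box x r.
Proof.
move=> r0 y h; apply/boxP; rewrite /disk/= in h.
have aux (p q : R) : p ^+ 2 + q ^+ 2 < r ^+ 2 -> `|p| < r.
  move=> pq; rewrite -(ltr_pXn2r (n := 2))// ?nnegrE// real_normK ?num_real//.
  by apply: le_lt_trans pq; rewrite lerDl sqr_ge0.
by split; [exact: aux h|apply: (aux _ (y.1 - x.1)); rewrite addrC].
Qed.

Lemma box_sub_disk (x : R * R) b r : 2 * b ^+ 2 <= r ^+ 2 -> box x b `<=` disk x r.
Proof.
move=> br y /boxP[h1 h2]; rewrite /disk/=.
have aux (p : R) : `|p| < b -> p ^+ 2 < b ^+ 2.
  move=> pb; rewrite -[ltLHS]real_normK ?num_real// ltr_pXn2r ?nnegrE//.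
  exact: ltW (le_lt_trans (normr_ge0 p) pb).
by move: br (aux _ h1) (aux _ h2); lra.
Qed.

Section Estimate.
Variables (D : set (R * R)) (u : R * R -> R[i]) (x : R * R) (lambda t r sg K Y Om : R).
Hypotheses (oD : open D) (bD : bounded_set D).
Hypothesis uH : csobolev_H1 D u.
Hypotheses (lambda0 : 0 < lambda) (t0 : 0 < t) (r0 : 0 < r) (sg0 : 0 < sg).
Hypotheses (sgr : 15 * sg <= r) (sgl : 2 * (lambda * sg ^+ 2) <= 1).
Hypothesis OmE : Om = lambda / t ^+ 2.
Hypothesis xD : box x (r * t) `<=` D.
Hypothesis hK : \int[area]_(y in box x (r * t)) sqmod_cov_grad D Om u y <= K * r ^+ 2.
Hypothesis hY : \int[area]_(y in disk x (r * t)) `|1 - sqmod u y| <= Y * t ^+ 2.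

Let mD : measurable (D : set plane) := open_measurable2 oD.
Let rt0 : 0 < r * t. Proof. exact: mulr_gt0. Qed.

Lemma deficit_integrable : area.-integrable D (EFin \o (fun y : plane => `|1 - sqmod u y|)).
Proof.
have i1 : area.-integrable D (EFin \o (fun=> 1 : R)).
  by apply: (continuous_integrable oD bD) => y; exact: cvg_cst.
have i2 := integrableB mD i1 (sqmod_integrable oD uH).
have := integrable_abse i2.
by apply: eq_integrable => // y _.
Qed.

(** This is [main_estimate] with a = r t / 2 and s0 = sg t, after division by t^2; [th] stands for
    (s / t)^2. On the left, sin x >= x / 2 yields lambda th, and a^2 / 2 = r^2 t^2 / 8. *)
Lemma scale_estimate (N : nat) (kap kap' : R) : (0 < N)%N -> 0 < kap -> 0 < kap' ->
  exists2 k : nat, (k < N)%N & let th := sg ^+ 2 / 4 ^+ k in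
  lambda * th * r ^+ 2 / 8 <= (kap' + 16 * kap) * (3 * (th * (K * r ^+ 2) + 2 * Y)) +
    16 * th / kap' + 128 / kap * (4 * th * (K * r ^+ 2) / N%:R + 64 * Y).
Proof.
move=> N0 k0 k0'; pose s0 := sg * t; pose a := r * t / 2.
have s00 : 0 < s0 by exact: mulr_gt0.
have st : s0 * 15 <= r * t by rewrite mulrAC ler_pM2r// mulrC.
have s0a : s0 <= a by rewrite /a; move: st s00; lra.
have ar : a + 3 * s0 < r * t by rewrite /a; move: st rt0; lra.
have mb b := measurable_box x b.
have icov : area.-integrable (box x (r * t)) (EFin \o (sqmod_cov_grad D Om u : plane -> R)).
  by apply: (integrableS mD (mb _) xD); exact: sqmod_cov_grad_integrable.
have inD s : s <= s0 -> forall y, `|y.1 - x.1| <= a + 2 * s0 + s ->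
    `|y.2 - x.2| <= a + 2 * s0 + s -> D y.
  move=> ss y h1 h2; apply: xD; apply/boxP.
  by split; [move: h1|move: h2] => /le_lt_trans; apply; move: ar ss; lra.
have cov_le s : s <= s0 ->
    \int[area]_(y in box x (a + 2 * s0 + s)) sqmod_cov_grad D Om u y <= K * r ^+ 2.
  move=> ss; apply: le_trans hK; apply: le_Rintegral_subset => //.
    by apply: box_subset; move: ar ss; lra.
  by move=> y; exact: sqmod_cov_grad_ge0.
have hE1 s : 0 < s -> s <= s0 ->
    \int[area]_(y in box x (a + 2 * s0)) incr (gauged1 Om (ext0 D u)) e1 s y <= s ^+ 2 * (K * r ^+ 2).
  move=> s_0 ss; apply: le_trans (increment1 oD bD uH Om s_0 (inD _ ss)) _.
  by rewrite ler_wpM2l ?sqr_ge0// cov_le.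
have hE2 s : 0 < s -> s <= s0 ->
    \int[area]_(y in box x (a + 2 * s0)) incr (gauged2 Om (ext0 D u)) e2 s y <= s ^+ 2 * (K * r ^+ 2).
  move=> s_0 ss; apply: le_trans (increment2 oD bD uH Om s_0 (inD _ ss)) _.
  by rewrite ler_wpM2l ?sqr_ge0// cov_le.
have hX : \int[area]_(y in box x (a + 3 * s0)) `|1 - n (ext0 D u y) ^+ 2| <= Y * t ^+ 2.
  have bd : box x (a + 3 * s0) `<=` disk x (r * t).
    apply: box_sub_disk.
    (* This is where 15 sg <= r is used to the full; 2 (7/10)^2 < 1 then puts the box inside the
       disk. *)
    have h1 : a + 3 * s0 <= 7 / 10 * (r * t) by rewrite /a; move: st; lra.
    have h2 : 0 <= a + 3 * s0 by rewrite addr_ge0 ?divr_ge0 ?mulr_ge0 ?ltW.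
    by move: h1 h2 rt0; move: (a + 3 * s0) (r * t) => p q; nra.
  apply: le_trans hY.
  have dsub : disk x (r * t) `<=` D by apply: subset_trans xD; apply: disk_sub_box; exact: ltW.
  rewrite (@eq_Rintegral _ _ _ area _ (fun y : plane => `|1 - sqmod u y|)); last first.
    move=> y; rewrite inE => yb; rewrite /ext0 ifT// inE.
    by apply: dsub; exact: bd.
  apply: le_Rintegral_subset => //; first exact: measurable_disk.
  by apply: (integrableS mD) => //; [exact: measurable_disk|exact: deficit_integrable].
have [k [kN hk]] := main_estimate (sqi_ext0 oD uH) s00 s0a hE1 hE2 hX N0 k0 k0'.
exists k => // th.
have th0 : 0 <= th by rewrite divr_ge0 ?sqr_ge0// exprn_ge0.
have sE : dyad s0 k ^+ 2 = th * t ^+ 2.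
  rewrite /dyad /th /s0 !expr_div_n exprMn -!exprM mulnC exprM.
  have -> : (2 : R) ^+ 2 = 4 by rewrite expr2 -natrM.
  by rewrite mulrAC.
(* The flux is free of t, and thus of eps: this is the role of Om = lambda / t^2. *)
have omE : Om * dyad s0 k ^+ 2 = lambda * th.
  by rewrite sE OmE; field; rewrite gt_eqF.
have thle : th <= sg ^+ 2.
  by rewrite ler_pdivrMr ?exprn_gt0// ler_peMr ?sqr_ge0// exprn_ege1// ler1n.
have om1 : 0 <= 2 * (lambda * th) <= 1.
  rewrite mulr_ge0 ?(mulr_ge0 (ltW lambda0))//=; apply: le_trans sgl.
  by rewrite ler_wpM2l// ler_wpM2l// ltW.
move: hk; rewrite /= omE sE => hk.
have h1 := sin_ge_half om1; have /andP[om0 _] := om1.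
have {}hk := hk (le_trans (divr_ge0 om0 (ler0n _ 2)) h1).
have aa : 0 <= a ^+ 2 / 2 by rewrite divr_ge0 ?sqr_ge0.
have := le_trans (ler_wpM2r aa h1) hk.
have -> : 2 * (lambda * th) / 2 * (a ^+ 2 / 2) = (lambda * th * r ^+ 2 / 8) * t ^+ 2.
  by rewrite /a; field.
have -> : (kap' + 16 * kap) * (3 * (th * t ^+ 2 * (K * r ^+ 2) + 2 * (Y * t ^+ 2))) +
    16 * (th * t ^+ 2) / kap' +
    128 / kap * (4 * (th * t ^+ 2) * (K * r ^+ 2) / N%:R + 64 * (Y * t ^+ 2)) =
  ((kap' + 16 * kap) * (3 * (th * (K * r ^+ 2) + 2 * Y)) +
    16 * th / kap' + 128 / kap * (4 * th * (K * r ^+ 2) / N%:R + 64 * Y)) * t ^+ 2.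
  by field; rewrite !gt_eqF// ltr0n.
by rewrite ler_pM2r// exprn_gt0.
Qed.

End Estimate.

(** |1 - |u|^2| is at most |w|^2 plus |1 - |u|^2 - |w|^2|, and z <= beta / 2 + z^2 / (2 beta) makes
    the latter accessible to the penalty. As the disk has area at most 4 rho^2, the three
    contributions are 4, 2 and 1 times beta rho^2. *)
Lemma deficit_bound (D : set (R * R)) (u w : R * R -> R[i]) (x : R * R) (rho beta P : R) :
  open D -> bounded_set D -> csobolev_H1 D u -> csobolev_H1 D w ->
  0 < rho -> 0 < beta -> box x rho `<=` D ->
  (\int[area]_(y in D) ((1 - sqmod u y - sqmod w y) ^+ 2)%:E <= P%:E)%E ->
  P <= 2 * beta ^+ 2 * rho ^+ 2 ->
  average (disk x rho `&` D) (sqmod w) < beta ->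
  \int[area]_(y in disk x rho) `|1 - sqmod u y| <= 7 * beta * rho ^+ 2.
Proof.
move=> oD bD uH wH rho0 beta0 xD hP Ple.
have mD := open_measurable2 oD; have md := measurable_disk x rho.
have dbox := disk_sub_box (ltW rho0) (x := x).
have dsub : disk x rho `<=` D by exact: subset_trans xD.
rewrite (setIidl dsub) /average => avg.
have mb b := measurable_box x b.
have aup : (area (disk x rho) <= (4 * rho ^+ 2)%:E)%E.
  have := area_box x (ltW rho0); have -> : (2 * rho) ^+ 2 = 4 * rho ^+ 2 by ring.
  by move=> <-; apply: le_measure; rewrite ?inE.
have afin : area (disk x rho) \is a fin_num.
  by rewrite ge0_fin_numE ?measure_ge0// (le_lt_trans aup)// ltry.
have alow : 0 < fine (area (disk x rho)).
  have bsub : box x (rho / 2) `<=` disk x rho.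
    by apply: box_sub_disk; move: (sqr_ge0 rho); rewrite expr_div_n; lra.
  have h : 0 <= rho / 2 by rewrite divr_ge0// ltW.
  have e := area_box x h.
  rewrite -lte_fin fineK//; apply: (@lt_le_trans _ _ (area (box x (rho / 2)))).
    by rewrite e lte_fin exprn_gt0// mulr_gt0// divr_gt0.
  by apply: le_measure; rewrite ?inE.
have aup' : fine (area (disk x rho)) <= 4 * rho ^+ 2 by rewrite -lee_fin fineK.
have hw : \int[area]_(y in disk x rho) sqmod w y <= 4 * beta * rho ^+ 2.
  move: avg; rewrite ltr_pdivrMr// => /ltW h; apply: le_trans h _.
  have -> : 4 * beta * rho ^+ 2 = beta * (4 * rho ^+ 2) by ring.
  exact: (ler_wpM2l (ltW beta0)).
have iw : area.-integrable (disk x rho) (EFin \o (sqmod w : plane -> R)).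
  by apply: (integrableS mD) => //; exact: sqmod_integrable.
have mu' : measurable_fun D (sqmod u : plane -> R).
  by have /integrableP[/measurable_EFinP] := sqmod_integrable oD uH.
have mw' : measurable_fun D (sqmod w : plane -> R).
  by have /integrableP[/measurable_EFinP] := sqmod_integrable oD wH.
pose q y := (1 - sqmod u y - sqmod w y) ^+ 2.
have mq : measurable_fun D (q : plane -> R).
  by apply: measurable_funX; apply: measurable_funB => //; apply: measurable_funB.
have iqD : area.-integrable D (EFin \o (q : plane -> R)).
  apply/integrableP; split; first exact/measurable_EFinP.
  apply: le_lt_trans (ltry P); apply: le_trans hP.
  rewrite le_eqVlt; apply/orP; left; apply/eqP; apply: eq_integral => y _.
  by rewrite /= ger0_norm// sqr_ge0.
have iq : area.-integrable (disk x rho) (EFin \o (q : plane -> R)) by exact: (integrableS mD).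
have hq : \int[area]_(y in disk x rho) q y <= P.
  apply: (@le_trans _ _ (\int[area]_(y in D) q y)).
    by apply: le_Rintegral_subset => // y; exact: sqr_ge0.
  by rewrite -lee_fin -integral_EFin_Rintegral.
have ic : area.-integrable (disk x rho) (EFin \o (fun=> beta / 2)).
  apply: (integrableS (mb rho)) => //.
  by apply: (@integrable_box _ _ _ _ `|beta / 2|).
have hc : \int[area]_(y in disk x rho) (beta / 2) <= 2 * beta * rho ^+ 2.
  rewrite /Rintegral integral_cst//= fineM//=.
  apply: le_trans (ler_wpM2l _ aup') _; first by rewrite divr_ge0// ltW.
  by rewrite le_eqVlt; apply/orP; left; apply/eqP; field.
have i2 := integrableZl md (2 * beta)^-1 iq.
have i12 := integrableD md ic i2; have iall := integrableD md iw i12.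
apply: (@le_trans _ _ (\int[area]_(y in disk x rho) (sqmod w y + (beta / 2 + (2 * beta)^-1 * q y)))).
  apply: le_Rintegral => //.
    by apply: (integrableS mD) => //; exact: deficit_integrable.
  move=> y _; rewrite /q.
  have e : 1 - sqmod u y = sqmod w y + (1 - sqmod u y - sqmod w y) by ring.
  rewrite [X in `|X| <= _]e.
  apply: le_trans (ler_normD _ _) _; rewrite ger0_norm ?sqmod_ge0// lerD2l.
  rewrite -[X in _ <= _ + _ * X]real_normK ?num_real//.
  move: `|_| => z; rewrite -subr_ge0.
  have -> : beta / 2 + (2 * beta)^-1 * z ^+ 2 - z = (beta - z) ^+ 2 / (2 * beta).
    by field; rewrite gt_eqF.
  by rewrite divr_ge0 ?sqr_ge0// mulr_ge0// ltW.
have e3 : \int[area]_(y in disk x rho) ((2 * beta)^-1 * q y) =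
  (2 * beta)^-1 * \int[area]_(y in disk x rho) q y by rewrite RintegralZl.
rewrite RintegralD// RintegralD// e3.
have h3 : (2 * beta)^-1 * \int[area]_(y in disk x rho) q y <= beta * rho ^+ 2.
  rewrite mulrC ler_pdivrMr ?mulr_gt0//; apply: le_trans hq _; apply: le_trans Ple _.
  by rewrite le_eqVlt; apply/orP; left; apply/eqP; ring.
by apply: le_trans (lerD hw (lerD hc h3)) _; rewrite le_eqVlt; apply/orP; left; apply/eqP; ring.
Qed.

(** With Z = lambda th r^2, the right-hand side is made at most Z / 32 + 3 Z / 64, which is less
    than Z / 8: the second moments give Z / 32, and the boundary term, the gap and the deficit Z /
    64 each. *)
Lemma exists_constants (lambda K : R) : 0 < lambda -> 0 < K ->
  exists sg beta R0 : R, [/\ 0 < sg, 2 * (lambda * sg ^+ 2) <= 1, 0 < beta &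
   [/\ 0 < R0, 15 * sg <= R0 &
   exists N : nat, exists kap kap' : R, [/\ (0 < N)%N, 0 < kap, 0 < kap' &
   forall (r : R) (k : nat), R0 < r -> (k < N)%N -> let th := sg ^+ 2 / 4 ^+ k in
   let Y := 7 * beta * r ^+ 2 in
   ~ (lambda * th * r ^+ 2 / 8 <= (kap' + 16 * kap) * (3 * (th * (K * r ^+ 2) + 2 * Y)) +
    16 * th / kap' + 128 / kap * (4 * th * (K * r ^+ 2) / N%:R + 64 * Y))]]].
Proof.
move=> l0 K0.
pose sg := Num.min 1 (2 * lambda)^-1.
have sg0 : 0 < sg by rewrite lt_min ltr01 invr_gt0 mulr_gt0.
have sg1 : sg <= 1 by rewrite ge_min lexx.
have sgl : 2 * (lambda * sg ^+ 2) <= 1.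
  have : sg <= (2 * lambda)^-1 by rewrite ge_min lexx orbT.
  rewrite -(ler_pM2l (_ : 0 < 2 * lambda)) ?mulr_gt0// divff ?gt_eqF ?mulr_gt0// => h.
  apply: le_trans h; rewrite mulrA ler_wpM2l ?mulr_ge0 ?(ltW l0)//.
  by rewrite expr2 ler_piMl// ltW.
(* 6 K kap' and 96 K kap both equal lambda / 64, the deficit 2 Y being absorbed in the energy at the
   cost of a factor 2. The equations are kept as hypotheses so that the constants stay opaque. *)
have [kap' kE'] : exists z : R, z = lambda / (64 * 6 * K) by eexists.
have [kap kE] : exists z : R, z = lambda / (64 * 96 * K) by eexists.
have k0' : 0 < kap' by rewrite kE' divr_gt0// mulr_gt0.
have k0 : 0 < kap by rewrite kE divr_gt0// mulr_gt0.
pose N := (Num.truncn (64 * 128 * 4 * K / (kap * lambda))).+1.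
have N0 : (0 < N)%N by [].
have NK : 64 * 128 * 4 * K / (kap * lambda) <= N%:R.
  have h : 0 <= 64 * 128 * 4 * K / (kap * lambda).
    have n0 : 0 < 64 * 128 * 4 * K by rewrite !mulr_gt0.
    exact/ltW/(divr_gt0 n0 (mulr_gt0 k0 l0)).
  by have /andP[_ /ltW] := truncn_itv h.
(* A lower bound for th at all admissible scales. As it depends on N, [beta] must be chosen after
   N. *)
pose thm := sg ^+ 2 / 4 ^+ N.
have thm0 : 0 < thm by rewrite divr_gt0 ?exprn_gt0.
pose beta := Num.min (kap * lambda * thm / (64 * (128 * 64 * 7))) (thm * K / 14).
have c70 : 0 < 64 * (128 * 64 * 7) :> R by rewrite !mulr_gt0.
have b0 : 0 < beta.
  by rewrite lt_min (divr_gt0 (mulr_gt0 (mulr_gt0 k0 l0) thm0) c70)/= divr_gt0// mulr_gt0.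
have b1 : 64 * (128 * 64 * 7) * beta <= kap * lambda * thm.
  by rewrite mulrC -ler_pdivlMr// ge_min lexx.
have b2 : 14 * beta <= thm * K by rewrite mulrC -ler_pdivlMr// ge_min lexx orbT.
(* The second summand makes the boundary term small; 15 gives 15 sg <= R0, because sg <= 1, and also
   r <= r^2. *)
pose R0 := 15 + 16 * 64 / (kap' * lambda).
have q0 : 0 < 16 * 64 / (kap' * lambda).
  by rewrite (divr_gt0 _ (mulr_gt0 k0' l0))// mulr_gt0.
exists sg, beta, R0; split=> //; split; [by rewrite addr_gt0| |].
  by rewrite /R0; move: sg1 q0; lra.
exists N, kap, kap'; split=> // r k rR kN th Y.
have r0 : 0 < r by apply: lt_trans rR; rewrite addr_gt0.
have r2 : 16 * 64 / (kap' * lambda) <= r ^+ 2.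
  by move: rR q0; rewrite /R0; move: (16 * 64 / _) => z h1 h2; nra.
have thl : thm <= th.
  by rewrite ler_wpM2l ?sqr_ge0// lef_pV2 ?posrE ?exprn_gt0// ler_weXn2l ?ler1n// ltnW.
have th0 : 0 < th := lt_le_trans thm0 thl.
have rr : 0 < r ^+ 2 by rewrite exprn_gt0.
pose Z := lambda * th * r ^+ 2.
have Z0 : 0 < Z by rewrite !mulr_gt0.
have Y1 : 2 * Y <= th * (K * r ^+ 2).
  rewrite /Y; have -> : 2 * (7 * beta * r ^+ 2) = 14 * beta * r ^+ 2 by ring.
  rewrite mulrA ler_wpM2r ?(ltW rr)//; apply: le_trans b2 _.
  by rewrite ler_wpM2r// ltW.
have t1 : (kap' + 16 * kap) * (3 * (th * (K * r ^+ 2) + 2 * Y)) <= Z / 32.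
  apply: (@le_trans _ _ ((kap' + 16 * kap) * (3 * (th * (K * r ^+ 2) + th * (K * r ^+ 2))))).
    rewrite ler_wpM2l ?addr_ge0 ?mulr_ge0 ?(ltW k0) ?(ltW k0')//.
    by rewrite ler_wpM2l// lerD2l.
  rewrite le_eqVlt; apply/orP; left; apply/eqP.
  by rewrite kE kE' /Z; field; rewrite gt_eqF.
have t2 : 16 * th / kap' <= Z / 64.
  rewrite ler_pdivrMr//; move: r2; rewrite ler_pdivrMr ?mulr_gt0// => h.
  have -> : Z / 64 * kap' = th / 64 * (r ^+ 2 * (kap' * lambda)) by rewrite /Z; ring.
  have := ler_wpM2l (_ : 0 <= th / 64) h; rewrite divr_ge0 ?(ltW th0)// => /(_ isT).
  by apply: le_trans; rewrite le_eqVlt; apply/orP; left; apply/eqP; field.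
have t3 : 128 / kap * (4 * th * (K * r ^+ 2) / N%:R) <= Z / 64.
  have N0' : 0 < N%:R :> R by rewrite ltr0n.
  have -> : 128 / kap * (4 * th * (K * r ^+ 2) / N%:R) =
    128 * 4 * th * r ^+ 2 * K / kap / N%:R by ring.
  rewrite ler_pdivrMr// ler_pdivrMr//.
  move: NK; rewrite ler_pdivrMr ?(mulr_gt0 k0 l0)// => h.
  have -> : Z / 64 * N%:R * kap = th * r ^+ 2 / 64 * (N%:R * (kap * lambda)) by rewrite /Z; ring.
  have thr0 : 0 <= th * r ^+ 2 / 64 := divr_ge0 (mulr_ge0 (ltW th0) (ltW rr)) (ler0n _ 64).
  have := ler_wpM2l thr0 h.
  by apply: le_trans; rewrite le_eqVlt; apply/orP; left; apply/eqP; field.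
have t4 : 128 / kap * (64 * Y) <= Z / 64.
  have -> : 128 / kap * (64 * Y) = 128 * 64 * 7 * beta * r ^+ 2 / kap by rewrite /Y; ring.
  rewrite ler_pdivrMr//.
  have -> : Z / 64 * kap = (kap * lambda * th / 64) * r ^+ 2 by rewrite /Z; ring.
  rewrite ler_wpM2r ?(ltW rr)//.
  have := ler_wpM2l (_ : 0 <= kap * lambda) thl; rewrite mulr_ge0 ?(ltW k0) ?(ltW l0)// => /(_ isT).
  by move: b1; lra.
rewrite mulrDr => h.
by move: h t1 t2 t3 t4 Z0; rewrite -/Z; lra.
Qed.

End GoodPoints.

(** * Measure of the low density set *)

Section LowDensity.
Context {R : realType}.
Local Notation plane := (measurableTypeR R * measurableTypeR R)%type.
Variables (D : set (R * R)) (u : R * R -> R[i]).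
Hypotheses (oD : open D) (bD : bounded_set D) (uH : csobolev_H1 D u).
Let mD : measurable (D : set plane) := open_measurable2 oD.

(** The average is a quotient of two slice integrals over the set of pairs (x, y) with y in [D] and
    in the disk around x, each measurable in x by Tonelli's theorem. *)
Lemma measurable_average rho :
  measurable_fun setT (fun x : plane => average (disk x rho `&` D) (sqmod u)).
Proof.
pose Q : set (plane * plane) := near_disk rho `&` [set z | D z.2].
have mQ : measurable Q.
  apply: measurableI; first exact: measurable_near_disk.
  by have := @measurable_snd _ _ plane plane measurableT _ mD; rewrite setTI.
pose h : plane -> R := (sqmod u : plane -> R) \_ D.
have mh : measurable_fun setT h.
  apply/(measurable_restrictT _ mD).
  by have /integrableP[/measurable_EFinP] := sqmod_integrable oD uH.
have h0 y : 0 <= h y by rewrite /h patchE; case: ifP => // _; exact: sqmod_ge0.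
have m1 := measurable_slice_integral mQ mh h0.
have mc : measurable_fun setT ((fun=> 1) : plane -> R) by exact: measurable_cst.
have m2 := measurable_slice_integral mQ mc (fun=> ler01).
have E x : disk x rho `&` D = [set y | Q (x, y)] by [].
have mE x : measurable ([set y | Q (x, y)] : set plane).
  by apply: measurableI => //; exact: measurable_disk.
rewrite (_ : (fun x => _) = fun x : plane =>
    fine (\int[area]_(y in [set y | Q (x, y)]) (h y)%:E)%E *
    (fine (\int[area]_(y in [set y | Q (x, y)]) 1%:E)%E)^-1); last first.
  apply/funext => x; rewrite /average E /Rintegral; congr (fine _ / fine _).
    by apply: eq_integral => y; rewrite inE => -[_ Dy]; rewrite /h patchE ifT// inE.
  by rewrite integral_cst//= mul1e.
apply: measurable_funM; first exact: measurableT_comp m1.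
have mf2 : measurable_fun setT
    (fun x : plane => fine (\int[area]_(y in [set y | Q (x, y)]) 1%:E)%E).
  exact: measurableT_comp m2.
have := measurableT_comp (@measurable_powR R (-1)) mf2.
congr (measurable_fun setT _); apply/funext => x /=; rewrite powR_inv1//.
by rewrite fine_ge0//; apply: integral_ge0 => y _; rewrite lee_fin.
Qed.

Let h (Om : R) : plane -> R := (sqmod_cov_grad D Om u : plane -> R) \_ D.

(** By Tonelli's theorem the integral over x of the energy in the box around x is at most 4 (r t)^2
    C / t^2 = 4 C r^2. Markov's inequality at the level K r^2 gives 4 C / K, whatever r and t. *)
Lemma bad_energy_set (C K r t Om : R) : 0 < C -> 0 < K -> 0 < r -> 0 < t ->
  (\int[area]_(y in D) (sqmod_cov_grad D Om u y)%:E <= (C / t ^+ 2)%:E)%E ->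
  exists B : set plane, [/\ measurable B, (area B <= (4 * C / K)%:E)%E &
    forall x, ~ B x -> box x (r * t) `<=` D ->
      \int[area]_(y in box x (r * t)) sqmod_cov_grad D Om u y <= K * r ^+ 2].
Proof.
move=> C0 K0 r0 t0 hC.
have rt0 : 0 < r * t by exact: mulr_gt0.
have icov := sqmod_cov_grad_integrable oD bD uH Om.
have mh : measurable_fun setT (h Om).
  by apply/(measurable_restrictT _ mD); have /integrableP[/measurable_EFinP] := icov.
have h0 y : 0 <= h Om y.
  by rewrite /h patchE; case: ifP => // _; exact: sqmod_cov_grad_ge0.
have mQ := measurable_near_box (r * t).
have mF := measurable_slice_integral mQ mh h0.
pose F (x : plane) : \bar R := (\int[area]_(y in [set y | near_box (r * t) (x, y)]) (h Om y)%:E)%E.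
have F0 x : (0 <= F x)%E by apply: integral_ge0 => y _; rewrite lee_fin.
have hF : (\int[area]_x F x <= (4 * (r * t) ^+ 2 * (C / t ^+ 2))%:E)%E.
  have sl y : (area [set x | near_box (r * t) (x, y)] <= (4 * (r * t) ^+ 2)%:E)%E.
    have := area_box y (ltW rt0); have -> : (2 * (r * t)) ^+ 2 = 4 * (r * t) ^+ 2 by ring.
    move=> <-; suff -> : [set x | near_box (r * t) (x, y)] = box y (r * t) by [].
    apply/seteqP; split=> x; first by move=> [h1 h2]; apply/boxP; split; rewrite distrC.
    by move=> /boxP[h1 h2]; split; rewrite /= distrC.
  apply: le_trans (tonelli_slice mQ mh h0 sl) _.
  rewrite [leRHS]EFinM lee_pmul2l//; last by rewrite lte_fin mulr_gt0// exprn_gt0.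
  apply: le_trans hC; rewrite [leRHS]integral_mkcond.
  rewrite le_eqVlt; apply/orP; left; apply/eqP; apply: eq_integral => y _.
  by rewrite /h !patchE; case: ifP.
have Kr : 0 < K * r ^+ 2 by rewrite mulr_gt0// exprn_gt0.
have [mB aB] := markov_measure mF F0 Kr hF.
exists [set x | ((K * r ^+ 2)%:E < F x)%E]; split=> //.
  apply: le_trans aB _; rewrite lee_fin le_eqVlt; apply/orP; left; apply/eqP.
  by field; rewrite !gt_eqF.
move=> x /negP; rewrite -leNgt => hx xD.
have mb := measurable_box x (r * t).
have ib : area.-integrable (box x (r * t)) (EFin \o (sqmod_cov_grad D Om u : plane -> R)).
  exact: (integrableS mD mb xD).
rewrite -lee_fin -integral_EFin_Rintegral//; apply: le_trans hx.
have -> : box x (r * t) = [set y | near_box (r * t) (x, y)].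
  by apply/seteqP; split=> y; [move=> /boxP|move=> h1; apply/boxP].
rewrite le_eqVlt; apply/orP; left; apply/eqP; apply: eq_integral => y.
rewrite inE => yb; rewrite /h patchE ifT// inE; apply: xD; apply/boxP; exact: yb.
Qed.

End LowDensity.

Section LowDensitySet.
Context {R : realType}.
Local Notation plane := (measurableTypeR R * measurableTypeR R)%type.
Variables (D : set (R * R)).
Hypotheses (oD : open D) (bD : bounded_set D).
Let mD : measurable (D : set plane) := open_measurable2 oD.

(** Every low density point lies in the boundary layer or in one of the two sets of high energy. The
    value of K makes each of the latter of area at most eta / 6, for a total below 2 eta / 3. *)
Lemma low_density_lt (u1 u2 : R * R -> R[i]) (lambda C eta c sg beta t r Om P kap kap' : R) (N : nat) :
  csobolev_H1 D u1 -> csobolev_H1 D u2 ->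
  0 < lambda -> 0 < C -> 0 < eta -> 0 < sg -> 0 < beta -> 0 < t -> 0 < r ->
  15 * sg <= r -> 2 * (lambda * sg ^+ 2) <= 1 -> Om = lambda / t ^+ 2 ->
  (0 < N)%N -> 0 < kap -> 0 < kap' ->
  let K := 24 * C / eta in
  (forall k : nat, (k < N)%N -> let th := sg ^+ 2 / 4 ^+ k in
   let Y := 7 * beta * r ^+ 2 in
   ~ (lambda * th * r ^+ 2 / 8 <= (kap' + 16 * kap) * (3 * (th * (K * r ^+ 2) + 2 * Y)) +
    16 * th / kap' + 128 / kap * (4 * th * (K * r ^+ 2) / N%:R + 64 * Y))) ->
  r * t < c -> (area (D `\` inner D c) < (eta / 3)%:E)%E ->
  (\int[area]_(y in D) (sqmod_cov_grad D Om u1 y)%:E <= (C / t ^+ 2)%:E)%E ->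
  (\int[area]_(y in D) (sqmod_cov_grad D Om u2 y)%:E <= (C / t ^+ 2)%:E)%E ->
  (\int[area]_(y in D) ((1 - sqmod u1 y - sqmod u2 y) ^+ 2)%:E <= P%:E)%E ->
  P <= 2 * beta ^+ 2 * (r * t) ^+ 2 ->
  (area (low_density_set D (r * t) beta u1 u2) < eta%:E)%E.
Proof.
move=> H1 H2 l0 C0 e0 sg0 b0 t0 r0 sgr sgl OmE N0 k0 k0' K contra rtc layer E1 E2 hP Ple.
have K0 : 0 < K by rewrite divr_gt0// mulr_gt0.
have rt0 : 0 < r * t by exact: mulr_gt0.
have [B1 [mB1 aB1 hB1]] := bad_energy_set oD bD H1 C0 K0 r0 t0 E1.
have [B2 [mB2 aB2 hB2]] := bad_energy_set oD bD H2 C0 K0 r0 t0 E2.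
have mlow : measurable (low_density_set D (r * t) beta u1 u2 : set plane).
  have m1 := measurable_average oD H1 (r * t) measurableT (measurable_itv `]-oo, beta[).
  have m2 := measurable_average oD H2 (r * t) measurableT (measurable_itv `]-oo, beta[).
  have := measurableI _ _ mD (measurableU _ _ m1 m2); rewrite !setTI.
  by congr measurable; apply/seteqP; split=> x /=; rewrite /low_density_set/= !in_itv.
(* Low density of one component bounds the deficit of the other, whose scale estimate contradicts
   [contra]. The roles of the components are exchanged at the end. *)
have good u w x : csobolev_H1 D u -> csobolev_H1 D w ->
    (\int[area]_(y in D) ((1 - sqmod u y - sqmod w y) ^+ 2)%:E <= P%:E)%E ->
    box x (r * t) `<=` D ->
    \int[area]_(y in box x (r * t)) sqmod_cov_grad D Om u y <= K * r ^+ 2 ->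
    ~ average (disk x (r * t) `&` D) (sqmod w) < beta.
  move=> Hu Hw hPu xD hK avg.
  have hY := deficit_bound oD bD Hu Hw rt0 b0 xD hPu Ple avg.
  have hY' : \int[area]_(y in disk x (r * t)) `|1 - sqmod u y| <= 7 * beta * r ^+ 2 * t ^+ 2.
    by apply: le_trans hY _; rewrite exprMn mulrA.
  have [k kN hk] := scale_estimate oD bD Hu l0 t0 r0 sg0 sgr sgl OmE xD hK hY' N0 k0 k0'.
  exact: contra kN hk.
have sub : low_density_set D (r * t) beta u1 u2 `<=` (D `\` inner D c) `|` (B1 `|` B2).
  move=> x [Dx low]; apply: contrapT => /not_orP[nl /not_orP[n1 n2]].
  have xin : inner D c x by apply: contrapT => h; apply: nl.
  have xD : box x (r * t) `<=` D.
    by move=> y /boxP[h1 h2]; apply: xin; [apply: lt_trans h1 _|apply: lt_trans h2 _].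
  case: low => low; last exact: good H1 H2 hP xD (hB1 _ n1 xD) low.
  apply: good H2 H1 _ xD (hB2 _ n2 xD) low; apply: le_trans hP.
  rewrite le_eqVlt; apply/orP; left; apply/eqP; apply: eq_integral => y _.
  by rewrite addrAC.
have ml : measurable (D `\` inner D c : set plane).
  by apply: measurableD => //; exact: measurable_inner.
have mB : measurable (B1 `|` B2) by exact: measurableU.
apply: (@le_lt_trans _ _ (area ((D `\` inner D c) `|` (B1 `|` B2)))).
  by apply: le_measure; rewrite ?inE//; exact: measurableU.
apply: (@le_lt_trans _ _ (area (D `\` inner D c) + (area B1 + area B2))%E).
  apply: le_trans (measureU2 _ _ _) _ => //.
  by rewrite leeD2l// measureU2.
apply: (@lt_le_trans _ _ ((eta / 3)%:E + ((eta / 6)%:E + (eta / 6)%:E))%E); last first.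
  by rewrite -!EFinD lee_fin; move: e0; lra.
have e6 : 4 * C / K = eta / 6 by rewrite /K; field; rewrite !gt_eqF.
rewrite e6 in aB1 aB2.
apply: lte_leD => //; last exact: leeD.
by rewrite fin_numD !ge0_fin_numE ?measure_ge0// !(le_lt_trans _ (ltry (eta / 6))).
Qed.

End LowDensitySet.

Theorem theorem1p4 (R : realType) (D : set (R * R)) (alpha lambda : R)
    (delta Omega : R -> R)
    (hD : smooth_bounded_domain D)
    (halpha : 0 < alpha < 1) (hlambda : 0 < lambda)
    (hdelta : forall eps : R, 0 < eps -> 1 < delta eps)
    (hdelta1 : delta eps @[eps --> (0 : R)^'+] --> (1 : R))
    (htilde : eps_tilde delta eps @[eps --> (0 : R)^'+] --> (0 : R))
    (hOmega : forall eps : R, 0 < eps ->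
       Omega eps = lambda / eps_tilde delta eps ^+ 2)
    (hll : eps / eps_tilde delta eps ^+ 2 @[eps --> (0 : R)^'+] --> (0 : R)) :
  forall eta : R, 0 < eta ->
  exists beta R0 : R, [/\ 0 < beta, 0 < R0 &
    forall r : R, R0 < r ->
    \forall eps \near (0 : R)^'+,
    forall u1 u2 : R * R -> R[i],
    minimizer D alpha eps (delta eps) (Omega eps) u1 u2 ->
    (area (low_density_set D (r * eps_tilde delta eps) beta u1 u2)
     < eta%:E)%E].
Proof.
move=> eta eta0; have [Dn0 oD _ bD _] := hD.
have [C C0 hC] := minimizer_bounds oD bD Dn0 halpha hlambda.
have K0 : 0 < 24 * C / eta by rewrite divr_gt0// mulr_gt0.
have [sg [beta [R0 [sg0 sgl b0 [R00 sgR [N [kap [kap' [N0 k0 k0' contra]]]]]]]]] :=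
  exists_constants hlambda K0.
exists beta, R0; split=> // r rR.
have r0 : 0 < r := lt_trans R00 rR.
have e3 : 0 < eta / 3 by rewrite divr_gt0.
have [c c0 layer] := area_boundary_layer oD bD e3.
have cr : 0 < c / r by rewrite divr_gt0.
(* Threshold for eps / t^2. As q <= 1, q^2 <= q, which avoids a square root. *)
pose q := Num.min 1 (2 * beta ^+ 2 * r ^+ 2 / C).
have q0 : 0 < q by rewrite lt_min ltr01 divr_gt0// !mulr_gt0// exprn_gt0.
have qC : C * q ^+ 2 <= 2 * beta ^+ 2 * r ^+ 2.
  have q1 : q <= 1 by rewrite ge_min lexx.
  have q2 : q <= 2 * beta ^+ 2 * r ^+ 2 / C by rewrite ge_min lexx orbT.
  rewrite mulrC -ler_pdivlMr//; apply: le_trans q2.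
  by rewrite expr2 ler_piMl// ltW.
have /cvgrPdist_lt/(_ _ cr) near1 := htilde.
have /cvgrPdist_lt/(_ _ q0) near2 := hll.
near=> eps => u1 u2 umin.
have eps0 : 0 < eps by near: eps; exact: nbhs_right_gt.
have d1 := hdelta _ eps0.
pose t := eps_tilde delta eps.
have t0 : 0 < t by rewrite divr_gt0// sqrtr_gt0 subr_gt0.
have rtc : r * t < c.
  rewrite mulrC -ltr_pdivlMr//.
  have : `|0 - eps_tilde delta eps| < c / r by near: eps; exact: near1.
  by rewrite sub0r normrN gtr0_norm.
have eq : eps / t ^+ 2 < q.
  have : `|0 - eps / eps_tilde delta eps ^+ 2| < q by near: eps; exact: near2.
  by rewrite sub0r normrN gtr0_norm// divr_gt0// exprn_gt0.
have [E1 E2 E3] := hC eps (delta eps) t (Omega eps) u1 u2 eps0 d1 erefl (hOmega _ eps0) umin.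
have [[H1 H2 _ _] _] := umin.
apply: (low_density_lt oD bD H1 H2 hlambda C0 eta0 sg0 b0 t0 r0 _ sgl (hOmega _ eps0)
  N0 k0 k0' _ rtc layer E1 E2 E3).
- exact: le_trans sgR (ltW rR).
- by move=> k; exact: contra.
rewrite (exprMn 2 r t) [leRHS]mulrA.
(* The penalty bound is (eps / t^2)^2 relative to the area scale t^2: here the assumption that eps /
   t^2 tends to 0 enters. *)
have -> : C * (eps ^+ 2 / t ^+ 2) = C * (eps / t ^+ 2) ^+ 2 * t ^+ 2.
  by field; rewrite gt_eqF.
rewrite ler_wpM2r ?sqr_ge0//; apply: le_trans qC.
have e0 : 0 <= eps / t ^+ 2 by rewrite divr_ge0 ?sqr_ge0// ltW.
rewrite ler_wpM2l ?(ltW C0)// ler_pXn2r ?nnegrE ?(ltW q0)//.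
exact: ltW.
Unshelve. all: by end_near. Qed.
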